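(* For every integer $n\ge1$, $$\left.\Theta_{e_{1^{n-1}}}e_1\right|_{t=1}=\sum_{u}R_u(q)\,x^u,$$ where the sum runs over all words $u=(u_1,\dots,u_n)$ of length $n$ in the positive integers and $x^u=\prod_{i=1}^n x_{u_i}$.
   Context: **Symmetric functions.** $\Lambda$ is the graded algebra of symmetric functions in $x_1,x_2,\dots$ over $\mathbb{Q}(q,t)$, $\Lambda^{(n)}$ its degree $n$ part; $e_\lambda$ are the elementary symmetric functions, $e_{1^n}=e_1^n$ ($e_{1^0}=1$). Put $M=(1-q)(1-t)$; for $f\in\Lambda$, the plethysm $f[X/M]$ is the image of $f$ under the $\mathbb{Q}(q,t)$-algebra map $p_k\mapsto p_k/((1-q^k)(1-t^k))$ ($p_k$ the power sums). For a partition $\mu$, $\widetilde H_\mu=\sum_{\lambda\vdash|\mu|}K_{\lambda\mu}(q,1/t)\,t^{n(\mu)}s_\lambda$ is the modified Macdonald polynomial, where $K_{\lambda\mu}(q,t)$ are the Macdonald $q,t$-Kostka coefficients and $n(\mu)=\sum_i(i-1)\mu_i$; $\widetilde H_\varnothing=1$. They form a basis of $\Lambda$. Identify $\mu$ with its Ferrers diagram (row $1$, of length $\mu_1$, at the bottom); for a cell $c$, $a'_\mu(c)$ and $l'_\mu(c)$ are the numbers of cells of $\mu$ strictly to its left in its row, and strictly below it in its column. Let $\Pi_\mu=\prod_c(1-q^{a'_\mu(c)}t^{l'_\mu(c)})$, over all cells $c\neq$ the bottom-left corner, $\Pi_\varnothing=1$. Let $\mathbf{\Pi}:\Lambda\to\Lambda$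 be the (invertible) linear operator with $\mathbf{\Pi}\widetilde H_\mu=\Pi_\mu\widetilde H_\mu$. **Theta operators.** For $f\in\Lambda^{(n)}$, $F\in\Lambda^{(m)}$: $\Theta_fF=0$ if $n\ge1$ and $m=0$; $\Theta_fF=fF$ if $n=m=0$; otherwise $\Theta_fF=\mathbf{\Pi}\big(f[X/M]\cdot\mathbf{\Pi}^{-1}F\big)$. Extend linearly in $f$ and $F$. The notation $|_{t=1}$ means evaluating the coefficients at $t=1$. **Inversion graphs and Tutte polynomials.** For a word $u=(u_1,\dots,u_n)$, its inversion graph $K_u$ is the graph with vertex set $\{1,\dots,n\}$ and edge set $\{\{i,j\}\mid i<j,\ u_i>u_j\}$. For a finite simple graph $G$ with a fixed total order on its edges, the Tutte polynomial is $T_G(x,y)=\sum_T x^{\mathsf{int}(T)}y^{\mathsf{ext}(T)}$, summed over spanning trees $T$ of $G$ (so it is $0$ if $G$ is disconnected). Here $\mathsf{int}(T)$ is the number of edges $e\in T$ that are minimal among the edges of $G$ joining the two components of $T\setminus\{e\}$, and $\mathsf{ext}(T)$ is the number of edges $e\in G\setminus T$ that are minimal in the unique circuit of $T\cup\{e\}$; the polynomial is independent of the order. Set $R_u(q)=T_{K_u}(1,q)$. *)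

(* Defs.v *)
From HB Require Import structures.
From mathcomp Require Import all_boot all_order fingroup perm all_algebra.
From mathcomp Require Import boolp.
From mathcomp Require Import mpoly.
From mathcomp Require Import zify.
From Stdlib Require Import ClassicalEpsilon.

Set Implicit Arguments.
Unset Strict Implicit.
Unset Printing Implicit Defensive.

Import GRing.Theory.
Local Open Scope ring_scope.

(* Symmetric functions in x_1, x_2, ... over R: the inverse limit of the rings
   of symmetric polynomials in N variables along x_{N+1} |-> 0, restricted to
   families of bounded degree. The variable x_{i+1} is 'X_i in each component. *)

Section SymmetricFunctions.
Variable R : comNzRingType.

Definition last_var0 N (p : {mpoly R[N.+1]}) : {mpoly R[N]} :=
  p \mPo rcons_tuple [tuple 'X_i | i < N] 0.

Record is_symfun (f : forall N, {mpoly R[N]}) : Prop := IsSymfun {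
  symfun_sym : forall N, f N \is symmetric;
  symfun_compat : forall N, last_var0 (f N.+1) = f N;
  symfun_bounded : exists d, forall N, (msize (f N) <= d)%N }.

Record symfun := Symfun {
  component :> forall N, {mpoly R[N]};
  symfunP : is_symfun component }.

Lemma symfun_ext (f g : symfun) : (forall N, f N = g N) -> f = g.
Proof.
case: f g => f pf [g pg] /= fg.
have E : f = g by apply: functional_extensionality_dep.
by case: g / E pg fg => pg _; congr Symfun; apply: Prop_irrelevance.
Qed.

HB.instance Definition _ := gen_eqMixin symfun.
HB.instance Definition _ := gen_choiceMixin symfun.

Fact symfun0_subproof : is_symfun (fun N => 0).
Proof.
split=> [N|N|]; first exact: rpred0; first exact: raddf0.
by exists 0%N => N; rewrite msize0.
Qed.

Fact symfun1_subproof : is_symfun (fun N => 1).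
Proof.
split=> [N|N|]; first exact: rpred1; first exact: rmorph1.
by exists 1%N => N; rewrite msize1.
Qed.

Fact symfunN_subproof (f : symfun) : is_symfun (fun N => - f N).
Proof.
case: f => f [fs fc [d fd]] /=; split=> [N|N|]; first by rewrite rpredN fs.
- by rewrite /last_var0 raddfN; congr (- _); exact: fc.
- by exists d => N; rewrite mmeasureN.
Qed.

Fact symfunD_subproof (f g : symfun) : is_symfun (fun N => f N + g N).
Proof.
case: f g => f [fs fc [d fd]] [g [gs gc [e ge]]] /=.
split=> [N|N|]; first by rewrite rpredD ?fs ?gs.
- by rewrite /last_var0 raddfD; congr (_ + _); [exact: fc | exact: gc].
- exists (maxn d e) => N; apply: leq_trans (mmeasureD_le _ _ _) _.
  by rewrite geq_max !leq_max fd ge orbT.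
Qed.

Fact symfunM_subproof (f g : symfun) : is_symfun (fun N => f N * g N).
Proof.
case: f g => f [fs fc [d fd]] [g [gs gc [e ge]]] /=.
split=> [N|N|]; first by rewrite rpredM ?fs ?gs.
- by rewrite /last_var0 rmorphM; congr (_ * _); [exact: fc | exact: gc].
- exists (d + e).+1 => N; apply: leq_trans (msizeM_le _ _) _.
  by rewrite ltnS leq_add ?fd ?ge.
Qed.

Fact symfunZ_subproof (c : R) (f : symfun) : is_symfun (fun N => c *: f N).
Proof.
case: f => f [fs fc [d fd]] /=; split=> [N|N|]; first by rewrite rpredZ ?fs.
- by rewrite /last_var0 linearZ; congr (_ *: _); exact: fc.
- by exists d => N; apply: leq_trans (msizeZ_le _ _) (fd N).
Qed.

Definition symfun0 := Symfun symfun0_subproof.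
Definition symfun1 := Symfun symfun1_subproof.
Definition symfunN f := Symfun (symfunN_subproof f).
Definition symfunD f g := Symfun (symfunD_subproof f g).
Definition symfunM f g := Symfun (symfunM_subproof f g).
Definition symfunZ c f := Symfun (symfunZ_subproof c f).

Fact symfunDA : associative symfunD.
Proof. by move=> f g h; apply: symfun_ext => N /=; rewrite addrA. Qed.
Fact symfunDC : commutative symfunD.
Proof. by move=> f g; apply: symfun_ext => N /=; rewrite addrC. Qed.
Fact symfun0D : left_id symfun0 symfunD.
Proof. by move=> f; apply: symfun_ext => N /=; rewrite add0r. Qed.
Fact symfunND : left_inverse symfun0 symfunN symfunD.
Proof. by move=> f; apply: symfun_ext => N /=; rewrite addNr. Qed.

HB.instance Definition _ :=
  GRing.isZmodule.Build symfun symfunDA symfunDC symfun0D symfunND.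

Fact symfunMA : associative symfunM.
Proof. by move=> f g h; apply: symfun_ext => N /=; rewrite mulrA. Qed.
Fact symfunMC : commutative symfunM.
Proof. by move=> f g; apply: symfun_ext => N /=; rewrite mulrC. Qed.
Fact symfun1M : left_id symfun1 symfunM.
Proof. by move=> f; apply: symfun_ext => N /=; rewrite mul1r. Qed.
Fact symfunMDl : left_distributive symfunM symfunD.
Proof. by move=> f g h; apply: symfun_ext => N /=; rewrite mulrDl. Qed.
Fact symfun1_neq0 : symfun1 != symfun0.
Proof.
apply/eqP => /(congr1 (fun f : symfun => f 0%N)) /= /eqP.
by rewrite oner_eq0.
Qed.

HB.instance Definition _ := GRing.Zmodule_isComNzRing.Build symfun
  symfunMA symfunMC symfun1M symfunMDl symfun1_neq0.

Fact symfunZA a b f : symfunZ a (symfunZ b f) = symfunZ (a * b) f.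
Proof. by apply: symfun_ext => N /=; rewrite scalerA. Qed.
Fact symfun1Z : left_id 1 symfunZ.
Proof. by move=> f; apply: symfun_ext => N /=; rewrite scale1r. Qed.
Fact symfunZDr : right_distributive symfunZ +%R.
Proof. by move=> a f g; apply: symfun_ext => N /=; rewrite scalerDr. Qed.
Fact symfunZDl f : {morph symfunZ^~ f : a b / a + b}.
Proof. by move=> a b; apply: symfun_ext => N /=; rewrite scalerDl. Qed.

HB.instance Definition _ := GRing.Zmodule_isLmodule.Build R symfun
  symfunZA symfun1Z symfunZDr symfunZDl.

Fact symfunZAl (a : R) (f g : symfun) : a *: (f * g) = (a *: f) * g.
Proof. by apply: symfun_ext => N /=; rewrite scalerAl. Qed.

HB.instance Definition _ := GRing.Lmodule_isLalgebra.Build R symfun symfunZAl.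
HB.instance Definition _ := GRing.Lalgebra_isComAlgebra.Build R symfun.

End SymmetricFunctions.

Section ClassicalFamilies.
Variable R : comNzRingType.

Lemma mcoeff_last_var0 N (p : {mpoly R[N.+1]}) (m : 'X_{1..N}) :
  (last_var0 p)@_m = p@_(mnmwiden m).
Proof.
have lastZ c m' : last_var0 (c *: 'X_[m']) = c *: last_var0 'X_[R, m'].
  exact: comp_mpolyZ.
have last_sum : last_var0 p = \sum_(m' <- msupp p) p@_m' *: last_var0 'X_[m'].
  rewrite {1}(mpolyE p) [LHS]raddf_sum.
  by apply: eq_bigr => m' _; exact: lastZ.
rewrite last_sum [in RHS](mpolyE p) !(raddf_sum (mcoeff _)) /=.
apply: eq_bigr => m' _; rewrite !mcoeffZ; congr (_ * _).
rewrite /last_var0 comp_mpolyX big_ord_recr /= (tnth_nth 0) /= nth_rcons size_map.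
rewrite size_enum_ord ltnn eqxx.
have -> : \prod_(i < N) tnth (rcons_tuple [tuple 'X_i | i < N] (0 : {mpoly R[N]}))
      (widen_ord (leqnSn N) i) ^+ m' (widen_ord (leqnSn N) i) =
    'X_[[multinom m' (widen_ord (leqnSn N) i) | i < N]].
  rewrite [RHS]mpolyXE_id; apply: eq_bigr => i _; rewrite mnmE; congr (_ ^+ _).
  rewrite (tnth_nth 0) /= nth_rcons size_map size_enum_ord ltn_ord.
  by rewrite (nth_map i) ?size_enum_ord // nth_ord_enum.
rewrite expr0n; have [m'0|m'n0] := eqVneq (m' ord_max) 0%N.
  rewrite mulr1 !mcoeffX; congr (_%:R); congr nat_of_bool.
  apply/eqP/eqP => [<-|->].
    apply/mnmP => i; case: (unliftP ord_max i) => [j ->|->]; last first.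
      by rewrite mnmwiden_ordmax.
    have -> : lift ord_max j = widen_ord (leqnSn N) j.
      by apply: val_inj; rewrite /= /bump leqNgt ltn_ord.
    by rewrite mnmwiden_widen mnmE.
  by apply/mnmP => i; rewrite mnmE mnmwiden_widen.
rewrite mulr0 mcoeff0 mcoeffX; case: eqP => // m'E.
by rewrite m'E mnmwiden_ordmax in m'n0.
Qed.

Lemma is_symfun_mcoeff (f : forall N, {mpoly R[N]}) (d : nat) :
    (forall N, (msize (f N) <= d)%N) ->
    (forall N (m : 'X_{1..N}) (s : 'S_N),
       (f N)@_[multinom m (s i) | i < N] = (f N)@_m) ->
    (forall N (m : 'X_{1..N}), (f N.+1)@_(mnmwiden m) = (f N)@_m) ->
  is_symfun f.
Proof.
move=> fd fs fc; split; last by exists d.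
- by move=> N; apply/issymP => s; apply/mpolyP => m; rewrite mcoeff_sym fs.
- by move=> N; apply/mpolyP => m; rewrite mcoeff_last_var0 fc.
Qed.

Lemma msize_sumX N (k : nat) (P : pred 'X_{1..N < k}) :
  (msize (\sum_(m : 'X_{1..N < k} | P m) 'X_[R, m])%R <= k)%N.
Proof.
apply: leq_trans (mmeasure_sum _ _ _ _) _.
by apply/bigmax_leqP => m _; rewrite msizeX bmdeg.
Qed.

Lemma mcoeff_sumX N (k : nat) (P : pred 'X_{1..N}) (m : 'X_{1..N}) :
  (\sum_(m' : 'X_{1..N < k} | P m') 'X_[R, m'])@_m = ((mdeg m < k)%N && P m)%:R.
Proof.
rewrite raddf_sum /=.
have [mk|mk] /= := boolP (mdeg m < k)%N; last first.
  rewrite big1 // => m' _; rewrite mcoeffX; case: eqP => // E.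
  by rewrite -E bmdeg in mk.
have [Pm|Pm] /= := boolP (P m).
  rewrite (bigD1 (BMultinom mk)) //= mcoeffX eqxx big1 ?addr0 // => m' /andP[_ ne].
  by rewrite mcoeffX -val_eqE /= in ne *; rewrite (negbTE ne).
rewrite big1 // => m' Pm'; rewrite mcoeffX; case: eqP => // E.
by rewrite -E Pm' in Pm.
Qed.

Lemma perm_mnm_perm N (m : 'X_{1..N}) (s : 'S_N) :
  perm_eq ([multinom m (s i) | i < N] : 'X_{1..N}) m.
Proof.
have -> : tval (multinom_val [multinom m (s i) | i < N])
  = map (fun i => m (s i)) (enum 'I_N) by [].
have -> : tval (multinom_val m) = map (fun i => m i) (enum 'I_N).
  apply: (@eq_from_nth _ 0%N) => [|i]; first by rewrite size_map size_tuple size_enum_ord.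
  rewrite size_tuple => lt_i; rewrite (nth_map (Ordinal lt_i)) ?size_enum_ord //.
  by rewrite (mnm_nth 0%N) nth_enum_ord.
rewrite (map_comp m s); apply: perm_map.
apply: uniq_perm; rewrite ?enum_uniq ?(map_inj_uniq perm_inj) ?enum_uniq // => i.
rewrite mem_enum; apply/mapP; exists ((s^-1)%g i); first by rewrite mem_enum.
by rewrite permKV.
Qed.

Lemma mdeg_sumn N (m : 'X_{1..N}) : mdeg m = sumn m.
Proof. by rewrite sumnE. Qed.

Definition monomial_poly (la : seq nat) N : {mpoly R[N]} :=
  \sum_(m : 'X_{1..N < (sumn la).+1} | perm_eq [seq k <- bmnm m | k != 0%N] la)
    'X_[m].

Fact monomial_subproof la : is_symfun (monomial_poly la).
Proof.
apply: (@is_symfun_mcoeff _ (sumn la).+1) => [N|N m s|N m].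
- exact: msize_sumX.
- rewrite !(mcoeff_sumX _ (fun m => perm_eq [seq k <- m | k != 0%N] la)).
  have pm := perm_mnm_perm m s; rewrite !mdeg_sumn (perm_sumn pm).
  by rewrite (permPl (perm_filter _ pm)).
- rewrite !(mcoeff_sumX _ (fun m => perm_eq [seq k <- m | k != 0%N] la)).
  by rewrite !mdeg_sumn /= sumn_rcons addn0 filter_rcons eqxx.
Qed.

(* m_la; zero unless all parts of la are positive *)
Definition monomial_sf la : symfun R := Symfun (monomial_subproof la).

Fact elementary_subproof k : is_symfun (fun N => mesym N R k).
Proof.
have mecharE N (m : 'X_{1..N}) :
    mechar k m = (sumn m == k) && all (fun i => (i <= 1)%N) m.
  rewrite /mechar mdeg_sumn; congr andb; apply/forallP/allP => H i.
    by case/tnthP => j ->; exact: H.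
  by apply: H; exact: mem_tnth.
apply: (@is_symfun_mcoeff _ k.+1) => [N|N m s|N m].
- by rewrite mesymE; apply: leq_trans (mmeasure_sum _ _ _ _) _;
    apply/bigmax_leqP => h /eqP <-; rewrite msizeX mdeg_mesym1.
- have pm := perm_mnm_perm m s.
  by rewrite !mcoeff_mesym !mecharE (perm_sumn pm) (perm_all _ pm).
- by rewrite !mcoeff_mesym !mecharE /= sumn_rcons addn0 all_rcons.
Qed.

Definition elementary k : symfun R := Symfun (elementary_subproof k).
Definition elementary_prod (la : seq nat) : symfun R :=
  \prod_(k <- la) elementary k.

Definition complete_poly k N : {mpoly R[N]} :=
  \sum_(m : 'X_{1..N < k.+1} | mdeg (bmnm m) == k) 'X_[m].

Fact complete_subproof k : is_symfun (complete_poly k).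
Proof.
apply: (@is_symfun_mcoeff _ k.+1) => [N|N m s|N m].
- exact: msize_sumX.
- rewrite !(mcoeff_sumX _ (fun m => mdeg m == k)).
  by rewrite !mdeg_sumn (perm_sumn (perm_mnm_perm m s)).
- rewrite !(mcoeff_sumX _ (fun m => mdeg m == k)).
  by rewrite !mdeg_sumn /= sumn_rcons addn0.
Qed.

Definition complete k : symfun R := Symfun (complete_subproof k).

(* p_k for k > 0; the junk value at k = 0 is 0, since \sum_i x_i^0 is not a
   symmetric function *)
Definition power_sum_poly k N : {mpoly R[N]} :=
  \sum_(i < N) 'X_i ^+ k *+ (0 < k)%N.

Fact power_sum_subproof k : is_symfun (power_sum_poly k).
Proof.
case: k => [|k]; rewrite /power_sum_poly; split=> [N|N|].
- by rewrite big1 ?rpred0 // => i _; rewrite mulr0n.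
- rewrite !big1 ?[LHS]raddf0 // => i _; exact: mulr0n.
- by exists 0%N => N; rewrite big1 ?msize0 // => i _; rewrite mulr0n.
- apply/issymP => s; rewrite raddf_sum [RHS](reindex_inj (@perm_inj _ s)) /=.
  apply: eq_bigr => i _; rewrite !mulr1n rmorphXn /= msymX; congr ('X_[_] ^+ _).
  by apply/mnmP => j; rewrite !mnmE -[in RHS](inj_eq (@perm_inj _ s^-1)%g) permK.
- rewrite [LHS]raddf_sum big_ord_recr /= !mulr1n.
  have lastXn i : comp_mpoly (rcons_tuple [tuple 'X_i | i < N] 0) ('X_i ^+ k.+1)
      = comp_mpoly (rcons_tuple [tuple 'X_i | i < N] (0 : {mpoly R[N]})) 'X_i ^+ k.+1.
    exact: rmorphXn.
  rewrite lastXn comp_mpolyXU /= nth_rcons size_map size_enum_ord ltnn eqxx.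
  rewrite expr0n addr0; apply: eq_bigr => i _.
  rewrite !mulr1n lastXn comp_mpolyXU /= nth_rcons size_map size_enum_ord.
  by rewrite ltn_ord (nth_map i) ?size_enum_ord // nth_ord_enum.
- exists k.+2 => N; apply: leq_trans (mmeasure_sum _ _ _ _) _.
  apply/bigmax_leqP => i _.
  by rewrite mulr1n mpolyXn msizeX mdegMn mdeg1 mul1n.
Qed.

Definition power_sum k : symfun R := Symfun (power_sum_subproof k).
Definition power_sum_prod (la : seq nat) : symfun R :=
  \prod_(k <- la) power_sum k.

(* Jacobi-Trudi: s_la = det (h_{la_i - i + j}), with h_k = 0 for k < 0 *)
Definition schur (la : seq nat) : symfun R :=
  \det (\matrix_(i < size la, j < size la)
    if (i <= nth 0%N la i + j)%N then complete (nth 0%N la i + j - i) else 0).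

Definition homogeneous_sf (d : nat) (f : symfun R) :=
  forall N, f N \is d.-homog.

End ClassicalFamilies.

Section Partitions.

Definition is_partition (la : seq nat) := sorted geq la && (0%N \notin la).

Definition partitions (n : nat) : seq (seq nat) :=
  [seq la <- [seq map val (b : seq 'I_n.+1) | b : {bseq n of 'I_n.+1}]
     | is_partition la && (sumn la == n)].

Lemma mem_partitions n la :
  (la \in partitions n) = is_partition la && (sumn la == n).
Proof.
rewrite mem_filter; apply: andb_idr => /andP[/andP[_ la0] /eqP sum_la].
have lt_la k : k \in la -> (k < n.+1)%N.
  by move=> /path.splitPr E; case: E sum_la => l1 l2 <-; rewrite sumn_cat /=; lia.
have size_la : (size (map (@inord n) la) <= n)%N.
  rewrite size_map -sum_la {lt_la sum_la}; elim: la la0 => //= k la IH.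
  by rewrite inE negb_or; case: k => // k /IH; lia.
apply/mapP; exists (Bseq size_la); first by rewrite mem_enum.
rewrite /= -map_comp -[LHS]map_id; apply/eq_in_map => k /lt_la kn /=.
by rewrite inordK.
Qed.

Lemma partitions_uniq n : uniq (partitions n).
Proof.
apply: filter_uniq; rewrite map_inj_uniq ?enum_uniq // => b1 b2 E.
by apply: val_inj; apply: (inj_map val_inj).
Qed.

Definition dominated (la mu : seq nat) :=
  (sumn la == sumn mu) &&
  all (fun i => sumn (take i la) <= sumn (take i mu))%N (iota 0 (sumn la).+1).

Definition zpart (la : seq nat) : nat :=
  \prod_(1 <= k < (sumn la).+1) (k ^ count_mem k la * (count_mem k la)`!).

Definition npart (mu : seq nat) : nat := \sum_(i < size mu) i * nth 0 mu i.

(* Rows and columns are numbered from 0, row 0 being the longest: the cell in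
   row i and column j has coarm j and coleg i. *)
Definition arm (mu : seq nat) (i j : nat) : nat := (nth 0 mu i - j.+1)%N.
Definition leg (mu : seq nat) (i j : nat) : nat :=
  (count (fun k => j < k) mu - i.+1)%N.

End Partitions.

Section MacdonaldPolynomials.
Variable F : fieldType.
Implicit Types q t : F.
Local Notation Lam := (symfun F).

(* Below, an object that its defining property determines uniquely (over
   partitions, in characteristic 0 and for generic q, t) is introduced with
   epsilon, whose first argument is an irrelevant default. *)

(* The algebra map p_k |-> c_k p_k. *)
Definition scale_power_sums (c : nat -> F) : {lrmorphism Lam -> Lam} :=
  epsilon (inhabits (idfun : {lrmorphism Lam -> Lam}))
    (fun phi => forall k, (0 < k)%N ->
       phi (power_sum F k) = c k *: power_sum F k).

(* f[X/M] *)
Definition plethysm_over_M q t : {lrmorphism Lam -> Lam} :=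
  scale_power_sums (fun k => ((1 - q ^+ k) * (1 - t ^+ k))^-1).

(* Macdonald's <p_la, p_mu> = delta_{la mu} z_la(q,t) *)
Definition is_qt_scalar_product q t (B : Lam -> Lam -> F) :=
  [/\ forall f, scalar (B f), forall g, scalar (B^~ g)
    & forall la mu, is_partition la -> is_partition mu ->
      B (power_sum_prod F la) (power_sum_prod F mu) =
        if la == mu then
          (zpart la)%:R * \prod_(k <- la) ((1 - q ^+ k) / (1 - t ^+ k))
        else 0].

Definition qt_scalar_product q t : Lam -> Lam -> F :=
  epsilon (inhabits (fun _ _ => 0)) (is_qt_scalar_product q t).

Definition is_macdonald_P q t (P : seq nat -> Lam) :=
  (forall mu, is_partition mu -> exists u : seq nat -> F,
     P mu = monomial_sf F mu +
       \sum_(la <- partitions (sumn mu) | dominated la mu && (la != mu))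
          u la *: monomial_sf F la) /\
  (forall la mu, is_partition la -> is_partition mu -> la != mu ->
     qt_scalar_product q t (P la) (P mu) = 0).

Definition macdonald_P q t : seq nat -> Lam :=
  epsilon (inhabits (fun _ => 0)) (is_macdonald_P q t).

(* J_mu = c_mu(q,t) P_mu with c_mu = \prod_s (1 - q^{arm s} t^{leg s + 1}) *)
Definition macdonald_J q t (mu : seq nat) : Lam :=
  (\prod_(i < size mu) \prod_(j < nth 0%N mu i)
     (1 - q ^+ arm mu i j * t ^+ (leg mu i j).+1)) *: macdonald_P q t mu.

(* S_la(x;t), the image of s_la under p_k |-> (1 - t^k) p_k *)
Definition big_schur t (la : seq nat) : Lam :=
  scale_power_sums (fun k => 1 - t ^+ k) (schur F la).

(* K_{la mu}(q,t), defined by J_mu = \sum_la K_{la mu}(q,t) S_la(x;t) *)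
Definition qt_kostka q t : seq nat -> seq nat -> F :=
  epsilon (inhabits (fun _ _ => 0)) (fun K =>
    forall mu, is_partition mu ->
      macdonald_J q t mu =
        \sum_(la <- partitions (sumn mu)) K la mu *: big_schur t la).

Definition macdonald_H q t (mu : seq nat) : Lam :=
  \sum_(la <- partitions (sumn mu))
     (qt_kostka q t^-1 la mu * t ^+ npart mu) *: schur F la.

Definition Pi_coeff q t (mu : seq nat) : F :=
  \prod_(i < size mu) \prod_(j < nth 0%N mu i | (0 < i + j)%N)
     (1 - q ^+ j * t ^+ i).

Definition Pi_op q t : {linear Lam -> Lam} :=
  epsilon (inhabits (idfun : {linear Lam -> Lam}))
    (fun L => forall mu, is_partition mu ->
       L (macdonald_H q t mu) = Pi_coeff q t mu *: macdonald_H q t mu).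

Definition Pi_inv q t : {linear Lam -> Lam} :=
  epsilon (inhabits (idfun : {linear Lam -> Lam}))
    (fun L => cancel (Pi_op q t) L /\ cancel L (Pi_op q t)).

Definition is_theta q t (T : Lam -> Lam -> Lam) :=
  [/\ forall f, linear (T f), forall G, linear (T^~ G)
    & forall n m f G, homogeneous_sf n f -> homogeneous_sf m G ->
      T f G = if (0 < n)%N && (m == 0)%N then 0
              else if (n == 0)%N && (m == 0)%N then f * G
              else Pi_op q t (plethysm_over_M q t f * Pi_inv q t G)].

(* Theta q t f G is Theta_f G *)
Definition Theta q t : Lam -> Lam -> Lam :=
  epsilon (inhabits (fun _ _ => 0)) (is_theta q t).

End MacdonaldPolynomials.

Section Tutte.
Variable V : finType.
Implicit Types (A C T E : {set {set V}}) (e f : {set V}).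

(* A simple graph on V is given by its set of edges, which are 2-sets. *)
Definition adjacent A : rel V := fun x y => (x != y) && ([set x; y] \in A).

Definition connected_graph A := [forall x, forall y, connect (adjacent A) x y].

Definition is_circuit A C :=
  [exists c : {bseq #|V| of V},
     [&& (2 < size c)%N, ucycleb (adjacent A) c
       & C == [set [set x; next c x] | x in (c : seq V)]]].

Definition spanning_tree E T :=
  [&& T \subset E, connected_graph T & [forall C, ~~ is_circuit T C]].

(* the edges of E joining the two components of T minus e *)
Definition cut_edges E T e : {set {set V}} :=
  [set f in E | [exists x in f, exists y in f,
                   ~~ connect (adjacent (T :\ e)) x y]].

Variable le : rel {set V}.

Definition minimal_in A e := (e \in A) && [forall f in A, le e f].

Definition int_activity E T := #|[set e in T | minimal_in (cut_edges E T e) e]|.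

Definition ext_activity E T :=
  #|[set e in E :\: T | [exists C, is_circuit (e |: T) C && minimal_in C e]]|.

Definition tutte (R : comNzRingType) E (x y : R) : R :=
  \sum_(T : {set {set V}} | spanning_tree E T)
     x ^+ int_activity E T * y ^+ ext_activity E T.

End Tutte.

Section Words.
Variables (n N : nat).

Definition inversion_graph (u : n.-tuple 'I_N) : {set {set 'I_n}} :=
  [set [set ij.1; ij.2] | ij in
     [set ij : 'I_n * 'I_n | (ij.1 < ij.2)%N && (tnth u ij.2 < tnth u ij.1)%N]].

(* Sets of vertices listed in increasing order and compared lexicographically;
   any other total order gives the same Tutte polynomial. *)
Definition lex_edge : rel {set 'I_n} := fun e f =>
  ((enum e : seqlexi 'I_n) <= (enum f : seqlexi 'I_n))%O.

Lemma lex_edge_total_order :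
  [/\ total lex_edge, antisymmetric lex_edge & transitive lex_edge].
Proof.
split=> [e f|e f|f e g]; first exact: Order.TotalTheory.le_total.
- move=> /Order.POrderTheory.le_anti eq_ef.
  by apply/setP => i; rewrite -[LHS]mem_enum eq_ef mem_enum.
- exact: Order.POrderTheory.le_trans.
Qed.

Definition R_word (R : comNzRingType) (q : R) (u : n.-tuple 'I_N) : R :=
  tutte lex_edge (inversion_graph u) 1 q.

End Words.

(* Q(q,t) is the fraction field of Q[q][t]: the outer variable is t. *)
Notation Qq := {fraction {poly rat}}.
Notation Qqt := {fraction {poly {poly rat}}}.
Notation "x %:F" := (@FracField.tofrac _ x) : ring_scope.

Definition q_Qq : Qq := 'X%:F.
Definition q_Qqt : Qqt := 'X%:P%:F.
Definition t_Qqt : Qqt := 'X%:F.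

(* c has no pole at t = 1, and its value there is v *)
Definition value_at_t1 (c : Qqt) (v : Qq) :=
  exists a b : {poly {poly rat}},
    [/\ b.[1] != 0, c = a%:F / b%:F & v = a.[1]%:F / b.[1]%:F].

(* The coefficientwise evaluation f|_{t=1} equals g, where g is a formal power
   series of bounded degree given by its truncations to x_1, ..., x_N. *)
Definition symfun_at_t1 (f : symfun Qqt) (g : forall N, {mpoly Qq[N]}) :=
  forall N (m : 'X_{1..N}), value_at_t1 (f N)@_m (g N)@_m.

(* Main.v *)
Require Import Defs.
From HB Require Import structures.
From mathcomp Require Import all_boot all_order fingroup perm all_algebra.
From mathcomp Require Import boolp.
From mathcomp Require Import mpoly.
From mathcomp Require Import zify ring.
From Stdlib Require Import ClassicalEpsilon.

Set Implicit Arguments.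
Unset Strict Implicit.
Unset Printing Implicit Defensive.

Import GRing.Theory.
Local Open Scope ring_scope.

(* Let D_m map f to the coefficient of z^m in f[X + M/z] \sum_i (-z)^i e_i, let D*_m
   be its analogue for 1/q, 1/t, and put B_mu = \sum_c q^a'(c) t^l'(c). Up to a
   plethysm, D_0 is Macdonald's difference operator: it is triangular for dominance
   and self-adjoint, so H_mu is an eigenvector of D_0 and D*_0, with eigenvalues
   1 - M B_mu and 1 - M* B*_mu, where * stands for q, t |-> 1/q, 1/t. Since
   [D_0, p_1] = M D_1 and [D_1, D*_0] is multiplication by a multiple of p_1, every
   H_nu occurring in p_1 H_mu satisfies (B_nu - B_mu) (B*_nu - B*_mu) = 1. This forces
   nu to be mu plus one cell, hence Pi_nu = Pi_mu (1 - (B_nu - B_mu)). It follows that Pi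
   conjugates multiplication by p_1 to p_1 + D_1, and that Theta_{e_1^{n-1}} e_1 is
   ((p_1 + D_1) / M)^{n-1} p_1.

   At t = 1, (p_1 + D_1) / M becomes the derivation theta of Lambda with
   theta p_k = k (1 + q + ... + q^{k-1}) (-1)^{k+1} e_{k+1}. Let W_n be the sum of
   q^{inv u} x^u over the words u of length n. As W_n / ((1 - q) ... (1 - q^n)) is the
   coefficient of z^n in exp (\sum_k p_k z^k / (k (1 - q^k))), one finds
   W_{n+1} = (p_1 + (q - 1) theta) W_n, and therefore
   W_{n+1} = \sum_k C(n,k) (q - 1)^k theta^k(e_1) W_{n-k}.
   On the other hand q^{inv u} is the sum of (q - 1)^|A| over the subgraphs A of K_u, and
   singling out the component of the first vertex yields the same recursion with
   (q - 1)^k theta^k(e_1) replaced by the sum over words u of length k + 1 and connected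
   subgraphs of K_u. For each u, the latter sum is (q - 1)^k R_u(q): grouping the
   connected subgraphs by their Kruskal spanning tree leaves a free choice of externally
   active edges. *)

(** * Bases of the ring of symmetric functions *)

(** Theta and what it is built from are picked by [epsilon], so each object must be shown to exist
    before its defining property can be used: the scalar product, P, the Kostka coefficients (hence
    spanning by Schur functions), Pi, its inverse, Theta itself. As H_mu is built from K(q, 1/t),
    the Macdonald theory is needed at the parameters q, 1/t. The operators D, its dual and
    Macdonald's difference operator all belong to one family [vop a b m], determined by its value at
    1 and by how it passes a factor p_k; identities are therefore proved by induction along products
    of power sums. No Pieri formula enters: its coefficients stay unknown, and the second operator
    D*_0, diagonal in the same basis because it is self-adjoint for the same scalar product,
    supplies the equation that restricts its support. Conjugating by Pi is what makes t = 1
    accessible: both Pi and f[X/M] degenerate there, whereas p_1 + D_1 vanishes at t = 1 and its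
    quotient by M has a limit. *)

Section Coefficients.
Variable R : comNzRingType.
Local Notation Lam := (symfun R).
Implicit Types (f g : Lam) (la mu : seq nat).

(* the coefficient of x^la, read off in size la variables *)
Definition coefm f la : R := (f (size la))@_(Multinom (in_tuple la)).

Lemma perm_mcoeff N (f : {mpoly R[N]}) (m m' : 'X_{1..N}) :
  f \is symmetric -> perm_eq m m' -> f@_m = f@_m'.
Proof.
move=> /issymP fs /tuple_permP[s Es].
have -> : m = [multinom m' (s i) | i < N].
  apply/mnmP => i; rewrite mnmE (mnm_nth 0%N) /= Es.
  by rewrite -tnth_nth tnth_mktuple.
by rewrite -mcoeff_sym fs.
Qed.

Lemma last_zero_mcoeff f N (m : 'X_{1..N.+1}) (s : seq nat) :
  val m = rcons s 0%N :> seq nat ->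
  exists m' : 'X_{1..N}, val m' = s :> seq nat /\ (f N.+1)@_m = (f N)@_m'.
Proof.
move=> E.
have szs : size s == N.
  by have := size_tuple (val m); rewrite [tval _]E size_rcons => -[->].
exists (Multinom (Tuple szs)); split=> //.
have -> : m = mnmwiden (Multinom (Tuple szs)).
  by apply: val_inj; apply: val_inj; exact: E.
by rewrite -[in RHS](symfun_compat (symfunP f)) mcoeff_last_var0.
Qed.

(** Symmetry moves the zero exponents to the end and stability removes them one variable at a time,
    so the coefficients at partitions determine a symmetric function. *)
Lemma mcoeff_coefm f N (m : 'X_{1..N}) :
  (f N)@_m = coefm f (sort geq [seq k <- m | k != 0%N]).
Proof.
set la := sort _ _.
have [k pla] : exists k, perm_eq m (la ++ nseq k 0%N).
  exists (size [seq k <- m | k == 0%N]).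
  have /all_pred1P <- : all (pred1 0%N) [seq k <- m | k == 0%N].
    exact: filter_all.
  rewrite perm_sym perm_catC /la (perm_trans (perm_cat (perm_refl _) (permEl (perm_sort _ _)))) //.
  exact: (permEl (perm_filterC (fun k => k == 0%N) m)).
move: la pla => la; elim: k N m => [|k IH] N m.
  rewrite cats0 => pm; have eN : N = size la.
    by rewrite -(perm_size pm) size_tuple.
  subst N; rewrite /coefm; apply: perm_mcoeff => //.
  exact: symfun_sym (symfunP f) _.
move=> pm; have eN : N = (size la + k).+1.
  by rewrite -(size_tuple (val m)) (perm_size pm) size_cat size_nseq addnS.
subst N.
have sz : size (la ++ nseq k.+1 0%N) == (size la + k).+1.
  by rewrite size_cat size_nseq addnS.
rewrite (@perm_mcoeff _ _ _ (Multinom (Tuple sz))) //; last first.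
  exact: symfun_sym (symfunP f) _.
have [|m' [Em' ->]] :=
    @last_zero_mcoeff f (size la + k) (Multinom (Tuple sz)) (la ++ nseq k 0%N).
  by rewrite /= rcons_cat; congr cat; elim: k {IH m pm sz} => //= k ->.
by apply: IH; rewrite [tval _]Em'.
Qed.

Lemma partition_geq_sort (s : seq nat) : is_partition (sort geq [seq k <- s | k != 0%N]).
Proof.
rewrite /is_partition sort_sorted /=; last by move=> x y; exact: leq_total.
by rewrite mem_sort mem_filter.
Qed.

Lemma symfun_coefm_ext f g :
  (forall la, is_partition la -> coefm f la = coefm g la) -> f = g.
Proof.
move=> fg; apply: symfun_ext => N; apply/mpolyP => m.
by rewrite !mcoeff_coefm fg // partition_geq_sort.
Qed.

Lemma coefmD f g la : coefm (f + g) la = coefm f la + coefm g la.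
Proof. exact: mcoeffD. Qed.
Lemma coefmB f g la : coefm (f - g) la = coefm f la - coefm g la.
Proof. exact: mcoeffB. Qed.
Lemma coefmZ c f la : coefm (c *: f) la = c * coefm f la.
Proof. exact: mcoeffZ. Qed.
Lemma coefm0 la : coefm 0 la = 0.
Proof. exact: mcoeff0. Qed.
Lemma coefm_sum I (r : seq I) (P : pred I) (F : I -> Lam) la :
  coefm (\sum_(i <- r | P i) F i) la = \sum_(i <- r | P i) coefm (F i) la.
Proof.
elim/big_rec2: _ => [|i x y _ <-]; [exact: coefm0 | exact: coefmD].
Qed.

Lemma coefm_monomial la mu : is_partition la -> is_partition mu ->
  coefm (monomial_sf R la) mu = (mu == la)%:R.
Proof.
move=> pla pmu; rewrite /coefm /= /monomial_poly.
rewrite (mcoeff_sumX _ _ (fun m => perm_eq [seq k <- m | k != 0%N] la)) mdeg_sumn /=.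
have -> : [seq k <- mu | k != 0%N] = mu.
  by apply/all_filterP/allP => k kla; apply: contraTneq pmu => k0; rewrite /is_partition -k0 kla andbF.
congr (nat_of_bool _)%:R; apply/idP/eqP => [/andP[_ pm]|->].
  case/andP: pla pmu => sla _ /andP[smu _].
  by apply: (sorted_eq (leT := geq)) pm => // [x y z | x y] /=; lia.
by rewrite ltnS leqnn perm_refl.
Qed.

(** Symmetric functions have bounded degree, so expansions can run over this finite list, with [d]
    large enough. *)
Definition parts d := flatten [seq partitions n | n <- iota 0 d].

Lemma mem_parts d la : (la \in parts d) = is_partition la && (sumn la < d)%N.
Proof.
apply/flattenP/andP => [[_ /mapP[n + ->]]|[pla lt]].
  by rewrite mem_iota mem_partitions => nd /andP[pla /eqP->].
exists (partitions (sumn la)); last by rewrite mem_partitions pla /=.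
by apply/mapP; exists (sumn la); rewrite ?mem_iota.
Qed.

Lemma parts_uniq d : uniq (parts d).
Proof.
elim: d => // d IH; rewrite /parts -addn1 iotaD map_cat flatten_cat cat_uniq IH /=.
rewrite cats0 partitions_uniq andbT; apply/hasPn => la /=.
rewrite mem_partitions add0n => /andP[_ /eqP sla].
by rewrite mem_parts sla ltnn andbF.
Qed.

Lemma coefm_bounded f : exists d, forall la, coefm f la != 0 -> (sumn la < d)%N.
Proof.
have [d fd] := symfun_bounded (symfunP f); exists d => la; rewrite /coefm -mcoeff_msupp => H.
have := leq_trans (msize_mdeg_lt H) (fd _).
by rewrite mdeg_sumn.
Qed.

End Coefficients.

Section Bases.
Variable F : fieldType.
Local Notation Lam := (symfun F).
Implicit Types (f g : Lam) (la mu : seq nat) (b : seq nat -> Lam).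

(** A numerical rank stands in for a partial order: [size] serves for products of power sums,
    [dom_rank] for Macdonald polynomials. *)
Definition triangular (rho : seq nat -> nat) b :=
  (forall la, is_partition la -> coefm (b la) la != 0) /\
  (forall la mu, is_partition la -> is_partition mu -> coefm (b mu) la != 0 ->
     la != mu -> sumn la = sumn mu /\ (rho la < rho mu)%N).

Lemma bigD1_partitions (V : nmodType) n la (a : seq nat -> V) : is_partition la -> sumn la = n ->
  \sum_(mu <- partitions n) a mu = a la + \sum_(mu <- partitions n | mu != la) a mu.
Proof.
move=> pla sla; rewrite (bigD1_seq la) ?partitions_uniq //.
by rewrite mem_partitions pla sla eqxx.
Qed.

Lemma triangular_sub_span rho b n (P : Lam -> Prop) : triangular rho b ->
    P 0 -> (forall f g, P f -> P g -> P (f + g)) -> (forall c f, P f -> P (c *: f)) ->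
  forall r, (forall la, is_partition la -> sumn la = n -> (rho la < r)%N -> P (b la)) ->
  forall f, (forall la, is_partition la -> coefm f la != 0 -> sumn la = n /\ (rho la < r)%N) -> P f.
Proof.
move=> [tr1 tr2] P0 PD PZ r Pb.
suff Pm la : is_partition la -> sumn la = n -> (rho la < r)%N -> P (monomial_sf F la).
  move=> f suppf; have -> : f = \sum_(la <- partitions n) coefm f la *: monomial_sf F la.
    apply: symfun_coefm_ext => la pla; rewrite coefm_sum.
    have [sla|nsla] := eqVneq (sumn la) n.
      rewrite (bigD1_partitions _ pla sla) coefmZ coefm_monomial // eqxx mulr1.
      rewrite big_seq_cond big1 ?addr0 // => mu; rewrite mem_partitions => /andP[/andP[pmu _] ne].
      by rewrite coefmZ coefm_monomial // eq_sym (negbTE ne) mulr0.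
    rewrite big_seq big1 => [|mu]; first by apply: contraNeq nsla => /suppf[] // ->.
    rewrite mem_partitions => /andP[pmu /eqP smu].
    rewrite coefmZ coefm_monomial // (_ : la == mu = false) ?mulr0 //.
    by apply: contraNF nsla => /eqP->; rewrite smu.
  rewrite big_seq; elim/big_ind: _ => // la; rewrite mem_partitions => /andP[pla /eqP sla].
  have [->|/suppf[] // _ lt] := eqVneq (coefm f la) 0; first by rewrite scale0r.
  by apply: PZ; exact: Pm.
(* Solve the expansion of [b la] for its leading term: what remains are monomial functions of
   smaller rank, covered by induction. *)
have [k] := ubnP (rho la); elim: k la => // k IH la; rewrite ltnS => rk pla sla lt.
have -> : monomial_sf F la = (coefm (b la) la)^-1 *: (b la
     - \sum_(mu <- partitions n | mu != la) coefm (b la) mu *: monomial_sf F mu).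
  apply: (@scalerI _ _ (coefm (b la) la)); first exact: tr1.
  rewrite scalerA divff ?tr1 // scale1r; apply/eqP; rewrite eq_sym subr_eq; apply/eqP.
  rewrite -(@bigD1_partitions _ n la (fun mu => coefm (b la) mu *: monomial_sf F mu)) //.
  apply: symfun_coefm_ext => nu pnu; rewrite coefm_sum.
  have [snu|nsnu] := eqVneq (sumn nu) n.
    rewrite (bigD1_partitions _ pnu snu) coefmZ coefm_monomial // eqxx mulr1.
    rewrite big_seq_cond big1 ?addr0 // => mu; rewrite mem_partitions => /andP[/andP[pmu _] ne].
    by rewrite coefmZ coefm_monomial // eq_sym (negbTE ne) mulr0.
  rewrite big_seq big1 => [|mu].
    have [E|/(tr2 _ _ pnu pla) H] := eqVneq (coefm (b la) nu) 0; first by rewrite E.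
    case/negP: nsnu; have [->|/H[-> _]] := eqVneq nu la; by rewrite sla.
  rewrite mem_partitions => /andP[pmu /eqP smu].
  rewrite coefmZ coefm_monomial // (_ : nu == mu = false) ?mulr0 //.
  by apply: contraNF nsnu => /eqP->; rewrite smu.
apply: (PZ); apply: (PD); first exact: Pb.
rewrite -scaleN1r; apply: (PZ); rewrite big_seq_cond; elim/big_ind: _ => // mu.
rewrite mem_partitions => /andP[/andP[pmu /eqP smu] ne].
have [->|/tr2 H] := eqVneq (coefm (b la) mu) 0; first by rewrite scale0r.
have [//|//|//|_ lt'] := H; apply: PZ.
by apply: IH => //; [exact: leq_trans lt' rk | exact: ltn_trans lt' lt].
Qed.

Lemma triangular_span rho b n f : triangular rho b ->
    (forall la, is_partition la -> coefm f la != 0 -> sumn la = n) ->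
  exists c, f = \sum_(la <- partitions n) c la *: b la.
Proof.
move=> tr suppf; pose r := \max_(la <- partitions n) (rho la).+1.
have rP la : is_partition la -> sumn la = n -> (rho la < r)%N.
  move=> pla sla; apply: (leq_trans (leqnn (rho la).+1)).
  by rewrite /r (bigD1_seq la) ?partitions_uniq ?mem_partitions ?pla ?sla ?eqxx //= leq_maxl.
apply: (@triangular_sub_span rho b n (fun f => exists c, f = \sum_(la <- partitions n) c la *: b la) tr _ _ _ r) => //.
- by exists (fun=> 0); rewrite big1 // => la _; rewrite scale0r.
- move=> _ _ [c ->] [c' ->]; exists (fun la => c la + c' la).
  by rewrite -big_split; apply: eq_bigr => la _; rewrite scalerDl.
- move=> a _ [c ->]; exists (fun la => a * c la).
  by rewrite scaler_sumr; apply: eq_bigr => la _; rewrite scalerA.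
- move=> la pla sla _; exists (fun mu => (mu == la)%:R).
  rewrite (@bigD1_partitions _ n la) // eqxx scale1r big1 ?addr0 // => mu /negbTE->.
  by rewrite scale0r.
- by move=> la pla nz; split; [exact: suppf | apply: rP => //; exact: suppf].
Qed.

Definition sf_basis b :=
  (forall f, exists d c, f = \sum_(la <- parts d) c la *: b la) /\
  (forall d c, \sum_(la <- parts d) c la *: b la = 0 ->
     forall la, la \in parts d -> c la = 0).

Lemma sum_parts_recr (V : nmodType) d (a : seq nat -> V) :
  \sum_(la <- parts d.+1) a la
    = \sum_(la <- parts d) a la + \sum_(la <- partitions d) a la.
Proof.
by rewrite /parts -addn1 iotaD map_cat flatten_cat big_cat /= cats0.
Qed.

Lemma triangular_basis rho b : triangular rho b -> sf_basis b.
Proof.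
move=> tr; split=> [f|d c E].
  have [d fd] := coefm_bounded f; exists d.
  have {}fd la : is_partition la -> coefm f la != 0 -> (sumn la < d)%N by move=> _; exact: fd.
  elim: d f fd => [|d IH] f fd.
    exists (fun=> 0); rewrite big1 => [|la _]; last by rewrite scale0r.
    by apply: symfun_coefm_ext => la pla; rewrite coefm0; apply/eqP/negPn/negP => /(fd _ pla).
  (* [g] is the component of [f] of top degree [d]; it is expanded by itself, and [f - g] has degree
     less than [d]. *)
  pose g := \sum_(la <- partitions d) coefm f la *: monomial_sf F la.
  have gE la : is_partition la -> coefm g la = if sumn la == d then coefm f la else 0.
    move=> pla; rewrite coefm_sum; have [sla|nsla] := eqVneq (sumn la) d.
      rewrite (bigD1_partitions _ pla sla) coefmZ coefm_monomial // eqxx mulr1.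
      rewrite big_seq_cond big1 ?addr0 // => mu; rewrite mem_partitions => /andP[/andP[pmu _] ne].
      by rewrite coefmZ coefm_monomial // eq_sym (negbTE ne) mulr0.
    rewrite big_seq big1 // => mu; rewrite mem_partitions => /andP[pmu /eqP smu].
    rewrite coefmZ coefm_monomial // (_ : la == mu = false) ?mulr0 //.
    by apply: contraNF nsla => /eqP->; rewrite smu.
  have [c0 Eg] : exists c, g = \sum_(la <- partitions d) c la *: b la.
    apply: triangular_span tr _ => la pla; rewrite gE //.
    by case: (sumn la =P d) => //; rewrite eqxx.
  have [la pla|c1 Ef] := IH (f - g).
    rewrite coefmB gE //; case: (sumn la =P d) => [_|ne]; first by rewrite subrr eqxx.
    by rewrite subr0 => /(fd _ pla); rewrite ltnS leq_eqVlt => /orP[/eqP|].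
  exists (fun la => if (sumn la < d)%N then c1 la else c0 la).
  rewrite sum_parts_recr -[LHS](subrK g) Ef Eg; congr (_ + _); apply: eq_big_seq => la.
    by rewrite mem_parts => /andP[_ ->].
  by rewrite mem_partitions => /andP[_ /eqP->]; rewrite ltnn.
have [tr1 tr2] := tr; pose r := \max_(la <- parts d) rho la.
have rP la : la \in parts d -> (rho la <= r)%N.
  by move=> la_d; rewrite /r (bigD1_seq la) ?parts_uniq //= leq_maxl.
(* Descending induction on the rank: at x^la, the relation involves only [c la] and the [c mu] of
   larger rank. *)
suff H k la : (r < rho la + k)%N -> la \in parts d -> c la = 0.
  by move=> la la_d; apply: (H r.+1) => //; lia.
elim: k la => [|k IH] la lt la_d; first by have := rP _ la_d; lia.
have /andP[pla _] : is_partition la && (sumn la < d)%N by rewrite -mem_parts.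
have := congr1 (fun g : symfun F => coefm g la) E; rewrite coefm0 coefm_sum (bigD1_seq la) ?parts_uniq //=.
rewrite coefmZ big_seq_cond big1 ?addr0 => [/eqP|mu /andP[mu_d ne]].
  by rewrite mulf_eq0 (negbTE (tr1 _ pla)) orbF => /eqP.
have /andP[pmu _] : is_partition mu && (sumn mu < d)%N by rewrite -mem_parts.
rewrite coefmZ; have [->|nz] := eqVneq (coefm (b mu) la) 0; first by rewrite mulr0.
have ne' : la != mu by rewrite eq_sym.
have [_ lt'] := tr2 la mu pla pmu nz ne'.
by rewrite (IH mu) ?mul0r //; lia.
Qed.

(* iota need not make A an lmodule over F in the usual way: A may be {poly Lam} *)
Lemma basis_extension b (A : nzRingType) (iota : {rmorphism F -> A}) (a : seq nat -> A) :
  sf_basis b -> exists phi : Lam -> A,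
    [/\ forall f g, phi (f + g) = phi f + phi g,
        forall c f, phi (c *: f) = iota c * phi f
      & forall la, is_partition la -> phi (b la) = a la].
Proof.
case=> span indep.
pose rep f (x : nat * (seq nat -> F)) := f = \sum_(la <- parts x.1) x.2 la *: b la.
have ex f : exists x, rep f x.
  by have [d [c E]] := span f; exists (d, c).
pose r f := projT1 (cid (ex f)).
have rP f : rep f (r f) by rewrite /r; case: cid.
pose val (x : nat * (seq nat -> F)) := \sum_(la <- parts x.1) iota (x.2 la) * a la.
(* Coefficients are padded with zeros up to a common degree bound; two expansions of one [f] can
   then be subtracted, and independence makes the value well defined. *)
have widen (V : nmodType) (h : F -> seq nat -> V) d d' c : (d <= d')%N ->
    (forall la, h 0 la = 0) ->
    \sum_(la <- parts d) h (c la) la =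
    \sum_(la <- parts d') h (if (sumn la < d)%N then c la else 0) la.
  move=> dd' h0; rewrite -(subnKC dd') /parts iotaD map_cat flatten_cat big_cat /=.
  rewrite -/(parts d) [X in _ + X]big_seq [X in _ + X]big1 ?addr0 => [|la].
    by apply: eq_big_seq => la; rewrite mem_parts => /andP[_ ->].
  case/flattenP => _ /mapP[n + ->]; rewrite mem_iota mem_partitions => dn /andP[_ /eqP->].
  by rewrite ltnNge (andP dn).1 h0.
have wd f x : rep f x -> val x = val (r f).
  move: x (r f) (rP f) => [d c] [d' c'] /= E' E.
  rewrite /val /= (widen _ (fun c la => iota c * a la) d (maxn d d')) ?leq_maxl //; last first.
    by move=> la; rewrite rmorph0 mul0r.
  rewrite (widen _ (fun c la => iota c * a la) d' (maxn d d')) ?leq_maxr //; last first.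
    by move=> la; rewrite rmorph0 mul0r.
  apply: eq_big_seq => la la_d; congr (iota _ * _); apply/eqP; rewrite -subr_eq0; apply/eqP.
  move: la la_d; apply: indep.
  transitivity (f - f); last exact: subrr.
  rewrite {1}E E' /= (widen _ (fun c la => c *: b la) d (maxn d d')) ?leq_maxl //; last first.
    by move=> la; rewrite scale0r.
  rewrite (widen _ (fun c la => c *: b la) d' (maxn d d')) ?leq_maxr //; last first.
    by move=> la; rewrite scale0r.
  by rewrite -sumrB; apply: eq_bigr => la _; rewrite scalerBl.
exists (fun f => val (r f)); split.
- move=> f g; pose d := maxn (r f).1 (r g).1.
  pose c h la := if (sumn la < (r h).1)%N then (r h).2 la else 0.
  have Ef : rep f (d, c f).
    rewrite /rep {1}(rP f) /= (widen _ (fun c la => c *: b la) _ d) ?leq_maxl // => la.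
    by rewrite scale0r.
  have Eg : rep g (d, c g).
    rewrite /rep {1}(rP g) /= (widen _ (fun c la => c *: b la) _ d) ?leq_maxr // => la.
    by rewrite scale0r.
  rewrite -(wd f (d, c f)) // -(wd g (d, c g)) // -(wd (f + g) (d, fun la => c f la + c g la)).
    by rewrite /val -big_split; apply: eq_bigr => la _; rewrite rmorphD mulrDl.
  by rewrite /rep {1}Ef {1}Eg -big_split; apply: eq_bigr => la _; rewrite scalerDl.
- move=> c f; rewrite -(wd (c *: f) ((r f).1, fun la => c * (r f).2 la)).
    by rewrite /val mulr_sumr; apply: eq_bigr => la _; rewrite rmorphM mulrA.
  by rewrite /rep {1}(rP f) scaler_sumr; apply: eq_bigr => la _; rewrite scalerA.
- move=> la pla; have la_d : la \in parts (sumn la).+1 by rewrite mem_parts pla ltnS leqnn.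
  rewrite -(wd (b la) ((sumn la).+1, fun mu => (mu == la)%:R)).
    rewrite /val (bigD1_seq la) ?parts_uniq //= eqxx rmorph1 mul1r big1 ?addr0 // => mu.
    by move/negbTE->; rewrite rmorph0 mul0r.
  rewrite /rep (bigD1_seq la) ?parts_uniq //= eqxx scale1r big1 ?addr0 // => mu.
  by move/negbTE->; rewrite scale0r.
Qed.

Lemma basis_ind b (P : Lam -> Prop) : sf_basis b -> P 0 ->
    (forall f g, P f -> P g -> P (f + g)) -> (forall c f, P f -> P (c *: f)) ->
    (forall la, is_partition la -> P (b la)) -> forall f, P f.
Proof.
move=> [span _] P0 PD PZ Pb f; have [d [c ->]] := span f.
rewrite big_seq; elim/big_ind: _ => // la; rewrite mem_parts => /andP[pla _].
by apply: PZ; exact: Pb.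
Qed.

End Bases.

Lemma partition_sorted_ge la i j : is_partition la -> (i <= j)%N -> (nth 0 la j <= nth 0 la i)%N.
Proof.
case/andP => s _ ij; case: (ltnP j (size la)) => [jl|/(nth_default 0%N) -> //].
have := sorted_leq_nth (leT := geq) _ _ 0%N s; rewrite /geq /=; apply=> //.
- by move=> x y z /=; lia.
- by move=> x /=; lia.
- by apply: leq_ltn_trans ij jl.
Qed.

(** * Power sums as free generators *)

Section PowerSums.
Variable R : comNzRingType.
Local Notation Lam := (symfun R).

(** The component in N variables under a name that can carry morphism instances. *)
Definition at_vars N (f : symfun R) : {mpoly R[N]} := f N.

Fact at_vars_zmod N : zmod_morphism (@at_vars N). Proof. by []. Qed.
Fact at_vars_monoid N : monoid_morphism (@at_vars N). Proof. by []. Qed.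
Fact at_vars_scale N : scalable (@at_vars N). Proof. by []. Qed.
HB.instance Definition _ N := GRing.isZmodMorphism.Build Lam {mpoly R[N]} (@at_vars N) (@at_vars_zmod N).
HB.instance Definition _ N := GRing.isMonoidMorphism.Build Lam {mpoly R[N]} (@at_vars N) (@at_vars_monoid N).
HB.instance Definition _ N := GRing.isScalable.Build R Lam {mpoly R[N]} _ (@at_vars N) (@at_vars_scale N).

Arguments at_vars : simpl never.

Lemma at_varsM N f g : at_vars N (f * g) = at_vars N f * at_vars N g.
Proof. by []. Qed.

Lemma at_vars_power_sum N k : (0 < k)%N -> at_vars N (power_sum R k) = \sum_(i < N) 'X_i ^+ k.
Proof. by case: k => // k _; apply: eq_bigr => i _; rewrite mulr1n. Qed.

(** Expanding p_la chooses a variable x_(f i) for each part la_i; this is the exponent of the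
    resulting monomial. *)
Definition word_mnm la N (f : {ffun 'I_(size la) -> 'I_N}) : 'X_{1..N} :=
  [multinom (\sum_(i < size la | f i == j) nth 0 la i)%N | j < N].

Lemma at_vars_power_sum_prod N la : 0%N \notin la ->
  at_vars N (power_sum_prod R la) =
    \sum_(f : {ffun 'I_(size la) -> 'I_N}) 'X_[word_mnm f].
Proof.
move=> la0; rewrite /power_sum_prod rmorph_prod (big_nth 0%N) big_mkord /=.
under eq_bigr => i _.
  rewrite at_vars_power_sum; last first.
    by rewrite lt0n; apply: contraNneq la0 => <-; exact: mem_nth.
  over.
rewrite bigA_distr_bigA /=; apply: eq_bigr => f _.
rewrite [RHS]mpolyXE_id.
under [in RHS]eq_bigr => j _ do rewrite mnmE -prodrXr.
rewrite (exchange_big_dep xpredT) //=; apply: eq_bigr => i _.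
by rewrite (big_pred1 (f i)) // => j; rewrite eq_sym.
Qed.

Lemma coefm_power_sum_prod la mu : is_partition la ->
  coefm (power_sum_prod R la) mu =
  (\sum_(f : {ffun 'I_(size la) -> 'I_(size mu)}) (word_mnm f == Multinom (in_tuple mu)))%N%:R.
Proof.
case/andP => _ la0; rewrite /coefm -[component _ _]/(at_vars _ _) at_vars_power_sum_prod //.
rewrite raddf_sum natr_sum; apply: eq_bigr => f _; exact: mcoeffX.
Qed.

(** A monomial x^mu of p_la merges the parts of la along a map [f], which is onto because the parts
    of mu are positive. If mu is not shorter than la, then [f] is a bijection and mu a rearrangement
    of la. *)
Lemma power_sum_prod_nz la mu : is_partition la -> is_partition mu ->
  coefm (power_sum_prod R la) mu != 0 -> la != mu ->
  sumn mu = sumn la /\ (size mu < size la)%N.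
Proof.
move=> pla pmu; rewrite coefm_power_sum_prod // => nz ne.
have [f /eqP fmu] : exists f : {ffun 'I_(size la) -> 'I_(size mu)}, word_mnm f == Multinom (in_tuple mu).
  apply/existsP; apply: contraNT nz; rewrite negb_exists => /forallP H.
  by rewrite big1 // => f _; rewrite (negbTE (H f)).
have muE (j : 'I_(size mu)) : nth 0%N mu j = (\sum_(i < size la | f i == j) nth 0 la i)%N.
  have := congr1 (fun m : 'X_{1..size mu} => m j) fmu; rewrite mnmE => ->.
  by rewrite (mnm_nth 0%N).
have sE : sumn mu = sumn la.
  rewrite !sumnE (big_nth 0%N) [RHS](big_nth 0%N) !big_mkord.
  under eq_bigr => j _ do rewrite muE.
  by rewrite (exchange_big_dep xpredT) //=; apply: eq_bigr => i _; rewrite (big_pred1 (f i)) // => j; rewrite eq_sym.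
split=> //.
have surj j : exists i, f i = j.
  have: (0 < nth 0 mu j)%N.
    by rewrite lt0n; apply: contraTneq pmu => j0; rewrite /is_partition -j0 mem_nth ?andbF.
  rewrite muE => H; have [i /eqP fi|E] := pickP [pred i | f i == j]; first by exists i.
  by rewrite big_pred0 in H.
have cE : codom f =i 'I_(size mu).
  by move=> j; rewrite inE; have [i <-] := surj j; exact: codom_f.
have le : (size mu <= size la)%N.
  rewrite -[size mu]card_ord -[size la]card_ord -(eq_card cE).
  by rewrite (leq_trans (leq_image_card _ _)).
rewrite ltn_neqAle le andbT; apply: contraNneq ne => eq_sz.
have inj : injective f.
  apply/injectiveP; rewrite /dinjectiveb /injectiveb; apply/card_uniqP.
  by rewrite size_map -cardE card_ord (eq_card cE) card_ord.
have pm : perm_eq la mu.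
  apply/(perm_iotaP 0%N).
  exists [seq val (f i) | i <- enum 'I_(size la)].
    apply: uniq_perm; rewrite ?iota_uniq //.
      by rewrite map_inj_uniq ?enum_uniq //; exact: inj_comp val_inj inj.
    move=> k; rewrite mem_iota add0n; apply/mapP/idP => [[i _ ->]|lt]; first exact: ltn_ord.
    by have [i fi] := surj (Ordinal lt); exists i; rewrite ?mem_enum // fi.
  apply: (@eq_from_nth _ 0%N).
    by rewrite 2!size_map size_enum_ord.
  move=> k lt; rewrite -map_comp (nth_map (Ordinal lt)) ?size_enum_ord //= muE.
  rewrite (big_pred1 (Ordinal lt)); last first.
    by move=> i /=; rewrite (inj_eq inj) (nth_ord_enum _ (Ordinal lt)).
  by [].
case/andP: pla pmu => sla _ /andP[smu _].
by apply/eqP; apply: (sorted_eq (leT := geq)) pm => // [x y z | x y] /=; lia.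
Qed.

(** The identity map is among those counted, so the diagonal coefficient is a positive integer,
    invertible in characteristic 0. *)
Lemma power_sum_prod_diag la : is_partition la ->
  exists n, coefm (power_sum_prod R la) la = n.+1%:R.
Proof.
move=> pla; rewrite coefm_power_sum_prod //.
rewrite (bigD1 [ffun i => i]) //=.
have -> : word_mnm [ffun i => i] = Multinom (in_tuple la) :> 'X_{1.._}.
  apply/mnmP => j; rewrite mnmE (mnm_nth 0%N) /= (big_pred1 j) // => i.
  by rewrite ffunE.
by rewrite eqxx; eexists; reflexivity.
Qed.

End PowerSums.

Section Generators.
Variable F : fieldType.
Hypothesis char0 : forall n, n.+1%:R != 0 :> F.
Local Notation Lam := (symfun F).
Local Notation p := (power_sum F).
Implicit Types f g : Lam.

Lemma power_sum_triangular : triangular size (power_sum_prod F).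
Proof.
split=> [la pla|la mu pla pmu nz ne].
  by have [n ->] := power_sum_prod_diag F pla.
by apply: power_sum_prod_nz nz _; rewrite // eq_sym.
Qed.

Lemma power_sum_basis : sf_basis (power_sum_prod F).
Proof. exact: triangular_basis power_sum_triangular. Qed.

Lemma power_sum_prod_perm la mu : perm_eq la mu -> power_sum_prod F la = power_sum_prod F mu.
Proof. exact: perm_big. Qed.

Lemma symfun_ind (P : Lam -> Prop) :
    (forall f g, P f -> P g -> P (f + g)) -> (forall c f, P f -> P (c *: f)) ->
    P 1 -> (forall k f, (0 < k)%N -> P f -> P (p k * f)) ->
  forall f, P f.
Proof.
move=> PD PZ P1 PM; apply: (basis_ind power_sum_basis) => //.
  by rewrite -(scale0r 1); exact: PZ.
move=> la /andP[_]; rewrite /power_sum_prod; elim: la => [|k la IH].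
  by rewrite big_nil.
rewrite inE negb_or eq_sym -lt0n big_cons => /andP[k0 /IH]; exact: PM.
Qed.

(** The linear map given by products on the basis p_la is multiplicative, because a list of positive
    parts can be sorted into a partition without changing its product. *)
Lemma symfun_extension (A : comNzRingType) (iota : {rmorphism F -> A}) (a : nat -> A) :
  exists phi : {rmorphism Lam -> A},
    (forall c f, phi (c *: f) = iota c * phi f) /\
    (forall k, (0 < k)%N -> phi (p k) = a k).
Proof.
have [phi [phiD phiZ phib]] :=
  basis_extension iota (fun la => \prod_(k <- la) a k) power_sum_basis.
have phip la : 0%N \notin la -> phi (power_sum_prod F la) = \prod_(k <- la) a k.
  move=> la0; have pl : perm_eq la (sort geq la) by rewrite perm_sym; exact/permEl/perm_sort.
  rewrite (power_sum_prod_perm pl) phib ?(perm_big _ pl) //.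
  by rewrite /is_partition sort_sorted ?mem_sort.
have phi1 : phi 1 = 1 by rewrite -[1 in LHS](big_nil _ _ _ _ : power_sum_prod F [::] = 1) phip // big_nil.
have phi_pM k f : (0 < k)%N -> phi (p k * f) = a k * phi f.
  move=> k0; move: f; apply: (basis_ind power_sum_basis).
  - by rewrite mulr0 -(scale0r 1) phiZ rmorph0 mul0r mulr0.
  - by move=> f g Ef Eg; rewrite mulrDr !phiD Ef Eg mulrDr.
  - by move=> c f Ef; rewrite -scalerAr !phiZ Ef mulrCA.
  move=> la /andP[_ la0].
  rewrite -[p k * _](big_cons _ _ _ _ _ _ : power_sum_prod F (k :: la) = _) !phip ?big_cons //.
  by rewrite inE negb_or la0 eq_sym -lt0n k0.
have phiM f g : phi (f * g) = phi f * phi g.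
  move: f; apply: symfun_ind.
  - by move=> f h Ef Eh; rewrite mulrDl !phiD Ef Eh mulrDl.
  - by move=> c f Ef; rewrite -scalerAl !phiZ Ef mulrA.
  - by rewrite phi1 !mul1r.
  - by move=> k f k0 Ef; rewrite -mulrA !phi_pM // Ef mulrA.
have phi_zmod : zmod_morphism phi.
  by move=> f g; rewrite phiD -scaleN1r phiZ rmorphN1 mulN1r.
pose z := GRing.isZmodMorphism.Build _ _ phi phi_zmod.
pose m := GRing.isMonoidMorphism.Build _ _ phi (conj phi1 phiM).
pose phi' : {rmorphism Lam -> A} := HB.pack phi z m.
exists phi'; split=> // k k0; rewrite -[p k]mulr1 -[phi' _]/(phi _) phi_pM //.
by rewrite phi1 mulr1.
Qed.

Lemma symfun_hom_eq (A : nzRingType) (phi psi : {rmorphism Lam -> A}) :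
    (forall c, phi c%:A = psi c%:A) -> (forall k, (0 < k)%N -> phi (p k) = psi (p k)) ->
  phi =1 psi.
Proof.
move=> Ec Ep; apply: symfun_ind.
- by move=> f g Ef Eg; rewrite !rmorphD Ef Eg.
- by move=> c f Ef; rewrite -mulr_algl !rmorphM Ec Ef.
- by rewrite !rmorph1.
- by move=> k f k0 Ef; rewrite !rmorphM Ep // Ef.
Qed.

Lemma scale_power_sumsE (c : nat -> F) k : (0 < k)%N ->
  scale_power_sums c (p k) = c k *: p k.
Proof.
have [phi [phiZ phip]] := symfun_extension (in_alg Lam) (fun k => c k *: p k).
have phi_scale : scalable phi by move=> a f; rewrite phiZ /= mulr_algl.
pose s := GRing.isScalable.Build _ _ _ _ phi phi_scale.
pose phi' : {lrmorphism Lam -> Lam} := HB.pack (phi : Lam -> Lam) (GRing.RMorphism.class phi) s.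
have ex : exists phi : {lrmorphism Lam -> Lam}, forall k, (0 < k)%N -> phi (p k) = c k *: p k.
  by exists phi'.
exact: (epsilon_spec _ _ ex).
Qed.

Lemma scale_power_sums_comp (c d : nat -> F) f :
  scale_power_sums c (scale_power_sums d f) = scale_power_sums (fun k => c k * d k) f.
Proof.
move: f; apply: symfun_ind.
- by move=> f g Ef Eg; rewrite !linearD /= Ef Eg.
- by move=> a f Ef; rewrite !linearZ /= Ef.
- by rewrite !rmorph1.
- move=> k f k0 Ef; rewrite !rmorphM /= Ef !scale_power_sumsE // linearZ /=.
  by rewrite scale_power_sumsE // scalerA mulrC -mulrC (mulrC (d k)).
Qed.

Lemma scale_power_sums_id (c : nat -> F) f : (forall k, (0 < k)%N -> c k = 1) ->
  scale_power_sums c f = f.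
Proof.
move=> c1; move: f; apply: symfun_ind.
- by move=> f g Ef Eg; rewrite !linearD /= Ef Eg.
- by move=> a f Ef; rewrite !linearZ /= Ef.
- by rewrite !rmorph1.
- by move=> k f k0 Ef; rewrite !rmorphM /= Ef !scale_power_sumsE // c1 // scale1r.
Qed.

End Generators.

(** * Power series and vertex operators *)

Definition series (A : Type) := nat -> A.

Section SeriesRing.
Variable A : comNzRingType.
Implicit Types f g h : series A.

HB.instance Definition _ := gen_eqMixin (series A).
HB.instance Definition _ := gen_choiceMixin (series A).

Lemma series_ext f g : (forall n, f n = g n) -> f = g.
Proof. exact: functional_extensionality_dep. Qed.

Definition series0 : series A := fun=> 0.
Definition series1 : series A := fun n => (n == 0)%:R.
Definition seriesN f : series A := fun n => - f n.
Definition seriesD f g : series A := fun n => f n + g n.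
Definition seriesM f g : series A := fun n => \sum_(i < n.+1) f i * g (n - i)%N.

Fact seriesDA : associative seriesD.
Proof. by move=> f g h; apply: series_ext => n; exact: addrA. Qed.
Fact seriesDC : commutative seriesD.
Proof. by move=> f g; apply: series_ext => n; exact: addrC. Qed.
Fact series0D : left_id series0 seriesD.
Proof. by move=> f; apply: series_ext => n; exact: add0r. Qed.
Fact seriesND : left_inverse series0 seriesN seriesD.
Proof. by move=> f; apply: series_ext => n; exact: addNr. Qed.
HB.instance Definition _ := GRing.isZmodule.Build (series A) seriesDA seriesDC series0D seriesND.

(** Coefficients up to [n] of a product only see truncations, so commutativity and associativity are
    inherited from polynomials. *)
Let trunc n f := \poly_(i < n.+1) f i.

Let seriesM_trunc n f g k : (k <= n)%N -> seriesM f g k = (trunc n f * trunc n g)`_k.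
Proof.
move=> kn; rewrite coefM; apply: eq_bigr => i _; rewrite !coef_poly.
have := ltn_ord i; rewrite ltnS => ik.
by rewrite !ifT // ltnS; [exact: leq_trans (leq_subr _ _) kn | exact: leq_trans ik kn].
Qed.

Fact seriesMC : commutative seriesM.
Proof.
by move=> f g; apply: series_ext => n; rewrite !(seriesM_trunc _ _ (leqnn n)) mulrC.
Qed.

Fact seriesMA : associative seriesM.
Proof.
move=> f g h; apply: series_ext => n; transitivity ((trunc n f * trunc n g * trunc n h)`_n).
  rewrite -mulrA coefM; apply: eq_bigr => i _; rewrite (seriesM_trunc (n := n)) ?leq_subr //.
  by rewrite coef_poly ltn_ord.
rewrite coefM; apply: eq_bigr => i _; rewrite (seriesM_trunc (n := n)); last first.
  by rewrite -ltnS ltn_ord.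
by rewrite [in LHS]coef_poly ltnS leq_subr.
Qed.

Fact series1M : left_id series1 seriesM.
Proof.
move=> f; apply: series_ext => n; rewrite /seriesM big_ord_recl /= subn0 mul1r.
by rewrite big1 ?addr0 // => i _; rewrite /series1 mul0r.
Qed.

Fact seriesMDl : left_distributive seriesM seriesD.
Proof.
move=> f g h; apply: series_ext => n; rewrite /seriesD /seriesM -big_split.
by apply: eq_bigr => i _; rewrite mulrDl.
Qed.

Fact series1_neq0 : series1 != series0.
Proof.
by apply/eqP => /(congr1 (fun f : series A => f 0%N)) /eqP; rewrite /series1 oner_eq0.
Qed.

HB.instance Definition _ := GRing.Zmodule_isComNzRing.Build (series A)
  seriesMA seriesMC series1M seriesMDl series1_neq0.

Lemma series1E n : (1 : series A) n = (n == 0)%:R. Proof. by []. Qed.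
Lemma seriesDE f g n : (f + g) n = f n + g n. Proof. by []. Qed.
Lemma seriesNE f n : (- f) n = - f n. Proof. by []. Qed.
Lemma seriesME f g n : (f * g) n = \sum_(i < n.+1) f i * g (n - i)%N. Proof. by []. Qed.
Lemma series_sumE I (r : seq I) (P : pred I) (G : I -> series A) n :
  (\sum_(i <- r | P i) G i) n = \sum_(i <- r | P i) G i n.
Proof. by elim/big_rec2: _ => // i x y _ <-. Qed.

Definition seriesC (a : A) : series A := fun n => if n is 0 then a else 0.
Definition seriesX : series A := fun n => (n == 1)%:R.

Lemma seriesCM a f n : (seriesC a * f) n = a * f n.
Proof.
rewrite seriesME big_ord_recl subn0 big1 ?addr0 // => i _.
by rewrite mul0r.
Qed.

Lemma seriesXM f n : (seriesX * f) n = if n is n'.+1 then f n' else 0.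
Proof.
rewrite seriesME big_ord_recl mul0r add0r; case: n => [|n]; first by rewrite big_ord0.
rewrite big_ord_recl /= mul1r subSS subn0 big1 ?addr0 // => i _.
by rewrite mul0r.
Qed.

Lemma seriesM0 f g : (f * g) 0%N = f 0%N * g 0%N.
Proof. by rewrite seriesME big_ord_recl big_ord0 addr0. Qed.

(** The Euler operator z d/dz. *)
Definition sdelta f : series A := fun n => f n *+ n.

Lemma sdeltaD f g : sdelta (f + g) = sdelta f + sdelta g.
Proof. by apply: series_ext => n; exact: mulrnDl. Qed.

Lemma sdeltaM f g : sdelta (f * g) = sdelta f * g + f * sdelta g.
Proof.
apply: series_ext => n; rewrite /sdelta seriesDE !seriesME -big_split /= -sumrMnl.
apply: eq_bigr => i _; rewrite mulrnAl mulrnAr -mulrnDr subnKC //.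
by rewrite -ltnS ltn_ord.
Qed.

(* f = exp (\sum_k c_k z^k / k) *)
Definition newton (c f : series A) := f 0%N = 1 /\ sdelta f = c * f.

Lemma newton_mul c d f g : newton c f -> newton d g -> newton (c + d) (f * g).
Proof.
move=> [f0 df] [g0 dg]; split; first by rewrite seriesM0 f0 g0 mulr1.
by rewrite sdeltaM df dg; ring.
Qed.

Lemma newton0 : newton 0 1.
Proof.
by split=> //; rewrite mul0r; apply: series_ext => -[|n] //; rewrite /sdelta series1E mul0rn.
Qed.

Lemma newton_prod I (r : seq I) (c f : I -> series A) :
  (forall i, newton (c i) (f i)) -> newton (\sum_(i <- r) c i) (\prod_(i <- r) f i).
Proof.
move=> cf; elim: r => [|i r IH]; rewrite ?big_nil ?big_cons; first exact: newton0.
exact: newton_mul.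
Qed.

Definition sscale (r : A) f : series A := fun n => r ^+ n * f n.

Lemma sscaleM r f g : sscale r (f * g) = sscale r f * sscale r g.
Proof.
apply: series_ext => n; rewrite /sscale !seriesME mulr_sumr; apply: eq_bigr => i _.
rewrite mulrACA -exprD subnKC //; by rewrite -ltnS ltn_ord.
Qed.

Lemma newton_sscale r c f : newton c f -> newton (sscale r c) (sscale r f).
Proof.
case=> f0 df; split; first by rewrite /sscale expr0 f0 mulr1.
rewrite -sscaleM -df; apply: series_ext => n.
by rewrite /sdelta /sscale mulrnAr.
Qed.

Hypothesis torsion_free : forall n (x : A), x *+ n.+1 = 0 -> x = 0.

(** As [c] has no constant term, the coefficient of z^n in the equation expresses n f_n through
    earlier coefficients of [f]. *)
Lemma linear_ode_uniq (c f : series A) : c 0%N = 0 -> f 0%N = 0 -> sdelta f = c * f -> f = 0.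
Proof.
move=> c0 f0 df; apply: series_ext => n; have [k] := ubnP n; elim: k n => // k IH [|n] // nk.
apply: (@torsion_free n); rewrite -[LHS]/(sdelta f n.+1) df seriesME big_ord_recl c0 mul0r add0r.
rewrite big1 // => i _; rewrite lift0 subSS IH ?mulr0 //.
by apply: leq_ltn_trans (leq_subr i n) _; exact: nk.
Qed.

Lemma newton_uniq (c f g : series A) : newton c f -> newton c g -> f = g.
Proof.
move=> [f0 df] [g0 dg]; apply/eqP; rewrite -subr_eq0; apply/eqP; apply: (@linear_ode_uniq c).
- have := congr1 (fun f : series A => f 0%N) df.
  by rewrite seriesM0 f0 mulr1 /sdelta mulr0n.
- by rewrite seriesDE seriesNE f0 g0 subrr.
rewrite mulrBr -df -dg; apply: series_ext => n.
by rewrite /sdelta !seriesDE !seriesNE mulrnBl.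
Qed.

End SeriesRing.

Arguments seriesX {A}.

Section SeriesMap.
Variables (A B : comNzRingType) (phi : {rmorphism A -> B}).
Definition smap (f : series A) : series B := fun n => phi (f n).

Lemma smapM f g : smap (f * g) = smap f * smap g.
Proof.
apply: series_ext => n; rewrite /smap !seriesME rmorph_sum.
by apply: eq_bigr => i _; exact: rmorphM.
Qed.

Lemma newton_smap c f : newton c f -> newton (smap c) (smap f).
Proof.
case=> f0 df; split; first by rewrite /smap f0 rmorph1.
by rewrite -smapM -df; apply: series_ext => n; rewrite /sdelta /smap rmorphMn.
Qed.
End SeriesMap.

Section Geometric.
Variable A : comNzRingType.
Implicit Types x : A.

Definition geom x : series A := fun n => x ^+ n.
(** The series xz / (1 - xz), which is z d/dz of log 1/(1 - xz). *)
Definition powers x : series A := fun n => if n is 0 then 0 else x ^+ n.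

Lemma geomE x : (1 - seriesC x * seriesX) * geom x = 1.
Proof.
apply: series_ext => n; rewrite mulrBl mul1r -mulrA seriesDE seriesNE seriesCM seriesXM.
case: n => [|n]; first by rewrite mulr0 subr0.
by rewrite /geom exprS subrr.
Qed.

Lemma newton_lin x : newton (- powers x) (1 - seriesC x * seriesX).
Proof.
have E : sdelta (1 - seriesC x * seriesX) = - (seriesC x * seriesX).
  apply: series_ext => n; rewrite /sdelta seriesDE !seriesNE seriesCM series1E /seriesX.
  by case: n => [|[|n]] /=; rewrite ?mulr0n ?mulr1n ?mulr0 ?mulr1 ?add0r ?oppr0 ?mul0rn.
split; first by rewrite seriesDE seriesNE seriesM0 mulr0 subr0.
rewrite E; have -> : powers x = seriesC x * seriesX * geom x.
  by apply: series_ext => -[|n]; rewrite -mulrA seriesCM seriesXM ?mulr0 // /geom -exprS.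
by rewrite -[LHS]mulr1 -[X in _ * X = _](geomE x); ring.
Qed.

Lemma newton_geom x : newton (powers x) (geom x).
Proof.
have [l0 dl] := newton_lin x; split; first by rewrite /geom expr0.
have H : sdelta ((1 - seriesC x * seriesX) * geom x) = 0.
  by rewrite geomE; case: (newton0 A) => _ ->; rewrite mul0r.
move: H; rewrite sdeltaM dl -mulrA geomE mulr1 => /eqP; rewrite addrC subr_eq0 => /eqP H.
by rewrite -[LHS]mul1r -(geomE x) mulrAC H mulrC.
Qed.

Lemma seriesCB x y : seriesC (x - y) = seriesC x - seriesC y.
Proof. by apply: series_ext => -[|n] //; rewrite seriesDE seriesNE subr0. Qed.
Lemma seriesC_M x y : seriesC (x * y) = seriesC x * seriesC y.
Proof. by apply: series_ext => -[|n]; rewrite seriesCM //= mulr0. Qed.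
Lemma seriesC1 : seriesC (1 : A) = 1.
Proof. by apply: series_ext => -[|n]. Qed.
End Geometric.

Section Complete.
Variable R : comNzRingType.

Lemma power_sum0 : power_sum R 0 = 0.
Proof. by apply: symfun_ext => N; rewrite /= /power_sum_poly big1 // => i _; rewrite mulr0n. Qed.

Lemma mcoeff_Xcomplete N n (m1 m : 'X_{1..N}) :
  ('X_[m1] * complete_poly R n N)@_m = ((m1 <= m)%MM && (mdeg (m - m1) == n))%:R.
Proof.
rewrite /complete_poly mulr_sumr raddf_sum /=.
under eq_bigr => m2 _ do rewrite -mpolyXD mcoeffX.
have [le|nle] /= := boolP (m1 <= m)%MM; last first.
  rewrite big1 // => m2 _; case: eqP => // E; case/negP: nle.
  by rewrite -E; apply/mnm_lepP => i; rewrite mnmDE leq_addr.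
have [dn|dn] /= := eqVneq (mdeg (m - m1)) n.
  have lt : (mdeg (m - m1) < n.+1)%N by rewrite dn.
  rewrite (bigD1 (BMultinom lt)) /= ?dn ?eqxx // addmC submK // eqxx big1 ?addr0 //.
  move=> m2 /andP[_ ne]; case: eqP => // E; case/negP: ne; rewrite -val_eqE /=.
  by rewrite -E addmC addmK.
rewrite big1 // => m2 d2; case: eqP => // E; case/negP: dn.
by rewrite -E addmC addmK.
Qed.

(* Both sides have coefficient |m| = n at x^m: on the right, x^m is obtained from
   x_i^k for each i and each 0 < k <= m_i. *)
Lemma newton_complete : newton (power_sum R : series (symfun R)) (complete R).
Proof.
split.
  apply: symfun_ext => N; apply/mpolyP => m; rewrite -[LHS](congr1 (mcoeff m) (mul1r _)).
  rewrite -mpolyX0 mcoeff_Xcomplete mcoeff1 -mdeg_eq0.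
  have -> : (0 <= m)%MM by apply/mnm_lepP => i; rewrite mnm0E.
  by rewrite /= (_ : m - 0 = m)%MM //; apply/mnmP => i; rewrite mnmBE mnm0E subn0.
apply: series_ext => n; apply: symfun_ext => N; apply/mpolyP => m.
rewrite seriesME big_ord_recl power_sum0 mul0r add0r.
rewrite -[component _ _ in RHS]/(at_vars N _) (raddf_sum (at_vars N)) (raddf_sum (mcoeff m)).
rewrite /sdelta -[component _ _]/(at_vars N _) (raddfMn (at_vars N)) mcoeffMn.
have -> : (at_vars N (complete R n))@_m = (mdeg m == n)%:R.
  rewrite -[LHS](congr1 (mcoeff m) (mul1r _)) -mpolyX0 mcoeff_Xcomplete.
  have -> : (0 <= m)%MM by apply/mnm_lepP => i; rewrite mnm0E.
  by rewrite /= (_ : m - 0 = m)%MM //; apply/mnmP => i; rewrite mnmBE mnm0E subn0.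
rewrite (eq_bigr (fun k : 'I_n => \sum_(i < N) (((U_(i) *+ lift ord0 k <= m)%MM &&
    (mdeg (m - U_(i) *+ lift ord0 k) == n - lift ord0 k)%N)%:R : R))); last first.
  move=> k _.
  rewrite -[LHS]/((at_vars N (power_sum R (lift ord0 k)) * complete_poly R (n - lift ord0 k) N)@_m).
  rewrite at_vars_power_sum // mulr_suml (raddf_sum (mcoeff m)).
  by apply: eq_bigr => i _; rewrite -mcoeff_Xcomplete -mpolyXn.
have E (k : 'I_n) (i : 'I_N) : ((U_(i) *+ lift ord0 k <= m)%MM &&
    (mdeg (m - U_(i) *+ lift ord0 k) == n - lift ord0 k)%N) = (mdeg m == n) && (k < m i)%N.
  rewrite lift0; have -> : (U_(i) *+ k.+1 <= m)%MM = (k < m i)%N.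
    apply/mnm_lepP/idP => [/(_ i)|lt j]; rewrite mulmnE mnm1E ?eqxx ?mul1n //.
    by case: eqP => [<-|]; rewrite ?mul1n ?mul0n.
  have [lt|] /= := boolP (k < m i)%N; last by rewrite andbF.
  have le : (U_(i) *+ k.+1 <= m)%MM.
    by apply/mnm_lepP => j; rewrite mulmnE mnm1E; case: eqP => [<-|]; rewrite ?mul1n ?mul0n.
  have <- : (mdeg (m - U_(i) *+ k.+1) + k.+1)%N = mdeg m.
    rewrite -{2}(submK le) mdegD mdegMn mdeg1 mul1n //.
  by rewrite andbT; have := ltn_ord k; lia.
under eq_bigr => k _ do under eq_bigr => i _ do rewrite E.
have [dn|] /= := eqVneq (mdeg m) n; last first.
  by rewrite mul0rn big1 // => k _; rewrite big1.
rewrite exchange_big /= -[X in _ *+ X]dn mdegE natr_sum; apply: eq_bigr => i _.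
have le : (m i <= n)%N by rewrite -dn mdegE (bigD1 i) //= leq_addr.
rewrite -natr_sum; congr (_%:R).
rewrite -[LHS]card_ord -sum1_card.
rewrite (big_ord_widen _ (fun=> 1%N) le) big_mkcond /=.
by apply: eq_bigr => k _; case: ltnP.
Qed.
End Complete.

Section VertexOperators.
Variable F : fieldType.
Hypothesis char0 : forall n, n.+1%:R != 0 :> F.
Local Notation Lam := (symfun F).
Local Notation p := (power_sum F).
Implicit Types (f g : Lam) (a b c : nat -> F).

Lemma lmod_torsion_free (V : lmodType F) n (x : V) : x *+ n.+1 = 0 -> x = 0.
Proof.
by rewrite -scaler_nat => /eqP; rewrite scaler_eq0 (negbTE (char0 n)) => /eqP.
Qed.

Lemma poly_torsion_free n (x : {poly Lam}) : x *+ n.+1 = 0 -> x = 0.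
Proof.
move=> E; apply/polyP => i; rewrite coef0; apply: (@lmod_torsion_free Lam n).
by rewrite -coefMn E coef0.
Qed.

(* the coefficient of z^n in exp (\sum_k b_k p_k z^k / k) *)
Definition hexp b n : Lam := scale_power_sums b (complete F n).

Definition pseries b : series Lam := fun k => b k *: p k.

Lemma newton_hexp b : newton (pseries b) (hexp b).
Proof.
have := newton_smap (scale_power_sums b : {rmorphism Lam -> Lam}) (newton_complete F).
congr newton; apply: series_ext => -[|k]; rewrite /smap /pseries; last exact: scale_power_sumsE.
by rewrite power_sum0 raddf0 scaler0.
Qed.

Lemma hexp_uniq b (h : series Lam) : newton (pseries b) h -> h = hexp b.
Proof. by move=> nh; apply: (newton_uniq (@lmod_torsion_free Lam) nh (newton_hexp b)). Qed.

Lemma hexp0 b : hexp b 0 = 1. Proof. by case: (newton_hexp b). Qed.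

Lemma hexp1 b : hexp b 1 = b 1%N *: p 1.
Proof.
have [_ /(congr1 (fun f : series Lam => f 1%N))] := newton_hexp b.
rewrite seriesME !big_ord_recl big_ord0 /= /pseries power_sum0 scaler0 mul0r add0r addr0.
by rewrite subnn hexp0 mulr1.
Qed.

Lemma hexp_ext b b' n : (forall k, (0 < k)%N -> b k = b' k) -> hexp b n = hexp b' n.
Proof.
move=> E; congr (_ n); apply: hexp_uniq.
rewrite (_ : pseries b' = pseries b); first exact: newton_hexp.
by apply: series_ext => -[|k]; rewrite /pseries ?power_sum0 ?scaler0 // E.
Qed.

Lemma hexpM b b' : (hexp b : series Lam) * hexp b' = hexp (fun k => b k + b' k).
Proof.
apply: hexp_uniq; have := newton_mul (newton_hexp b) (newton_hexp b').
by congr newton; apply: series_ext => k; rewrite /pseries scalerDl.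
Qed.

Lemma hexp_zero n : hexp (fun=> 0) n = (n == 0)%:R.
Proof.
rewrite -[RHS]series1E; congr (_ n); symmetry; apply: hexp_uniq.
have := newton0 Lam; congr newton; apply: series_ext => k.
by rewrite /pseries scale0r.
Qed.

Lemma hexp_sscale b r n : hexp (fun k => r ^+ k * b k) n = r ^+ n *: hexp b n.
Proof.
have := @newton_sscale _ (r%:A : Lam) _ _ (newton_hexp b).
rewrite (_ : sscale _ (pseries b) = pseries (fun k => r ^+ k * b k)) => [/hexp_uniq/esym E|].
  by rewrite [hexp _]E /sscale -[_ ^+ n](rmorphXn (in_alg Lam)) /= mulr_algl.
apply: series_ext => k.
by rewrite /sscale -[_ ^+ k](rmorphXn (in_alg Lam)) /= mulr_algl /pseries scalerA.
Qed.

Lemma scale_hexp b c n : scale_power_sums c (hexp b n) = hexp (fun k => c k * b k) n.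
Proof. exact: scale_power_sums_comp. Qed.

Definition const_poly : {rmorphism F -> {poly Lam}} := polyC \o in_alg Lam.

(* f[X + Y] with p_k[Y] = a_k y^k *)
Definition shift a : {rmorphism Lam -> {poly Lam}} :=
  epsilon (inhabits (polyC : {rmorphism Lam -> {poly Lam}})) (fun phi : {rmorphism Lam -> {poly Lam}} =>
    (forall (x : F) f, phi (x *: f) = const_poly x * phi f) /\
    (forall k, (0 < k)%N -> phi (p k) = (p k)%:P + const_poly (a k) * 'X^k)).

Lemma shift_spec a :
  (forall (x : F) f, shift a (x *: f) = const_poly x * shift a f) /\
  (forall k, (0 < k)%N -> shift a (p k) = (p k)%:P + const_poly (a k) * 'X^k).
Proof.
exact: (epsilon_spec _ _ (symfun_extension char0 const_poly _)).
Qed.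

Lemma const_polyM (c : F) (P : {poly Lam}) i : (const_poly c * P)`_i = c *: P`_i.
Proof. by rewrite coefCM /= mulr_algl. Qed.

Definition sh a i f : Lam := (shift a f)`_i.

Lemma shD a i f g : sh a i (f + g) = sh a i f + sh a i g.
Proof. by rewrite /sh rmorphD coefD. Qed.
Lemma shZ a i (c : F) f : sh a i (c *: f) = c *: sh a i f.
Proof. by rewrite /sh (shift_spec a).1 const_polyM. Qed.
Lemma sh_zero a i : sh a i 0 = 0.
Proof. by rewrite /sh rmorph0 coef0. Qed.
Lemma sh1 a i : sh a i 1 = (i == 0)%:R.
Proof. by rewrite /sh rmorph1 coef1. Qed.
Lemma sh_pM a i k f : (0 < k)%N ->
  sh a i (p k * f) = p k * sh a i f + a k *: (if (i < k)%N then 0 else sh a (i - k) f).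
Proof.
move=> k0; rewrite /sh rmorphM (shift_spec a).2 // mulrDl coefD coefCM; congr (_ + _).
by rewrite -mulrA const_polyM coefXnM.
Qed.

Lemma sh0 a f : sh a 0 f = f.
Proof.
move: f; apply: (symfun_ind char0).
- by move=> f g Ef Eg; rewrite shD Ef Eg.
- by move=> c f Ef; rewrite shZ Ef.
- by rewrite sh1.
- by move=> k f k0 Ef; rewrite sh_pM // Ef k0 scaler0 addr0.
Qed.

Lemma sh_sscale a r i f : sh (fun k => r ^+ k * a k) i f = r ^+ i *: sh a i f.
Proof.
move: f i; apply: (symfun_ind char0).
- by move=> f g Ef Eg i; rewrite !shD Ef Eg scalerDr.
- by move=> c f Ef i; rewrite !shZ Ef !scalerA mulrC.
- by move=> [|i]; rewrite !sh1 ?scale1r // scaler0.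
- move=> k f k0 Ef i; rewrite !sh_pM // !Ef scalerDr scalerAr; congr (_ + _).
  case: ltnP => ki; first by rewrite !scaler0.
  by rewrite !scalerA mulrAC -exprD subnKC.
Qed.

Lemma sh_ext a a' i f : (forall k, (0 < k)%N -> a k = a' k) -> sh a i f = sh a' i f.
Proof.
move=> E; move: f i; apply: (symfun_ind char0).
- by move=> f g Ef Eg i; rewrite !shD Ef Eg.
- by move=> c f Ef i; rewrite !shZ Ef.
- by move=> i; rewrite !sh1.
- by move=> k f k0 Ef i; rewrite !sh_pM // !Ef E.
Qed.

Lemma sh_big a i f : (size (shift a f) <= i)%N -> sh a i f = 0.
Proof. exact: nth_default. Qed.

(* the coefficient of y^-m in f[X + Y] exp (\sum_k b_k p_k y^-k / k) *)
Definition vop a b m f : Lam := \sum_(i < size (shift a f)) sh a i f * hexp b (m + i).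

Lemma vopE a b m f n : (size (shift a f) <= n)%N ->
  vop a b m f = \sum_(i < n) sh a i f * hexp b (m + i).
Proof.
move=> sn; rewrite /vop (big_ord_widen _ (fun i => sh a i f * hexp b (m + i)) sn).
rewrite big_mkcond; apply: eq_bigr => i _; case: ltnP => // /sh_big->.
by rewrite mul0r.
Qed.

Lemma vopD a b m f g : vop a b m (f + g) = vop a b m f + vop a b m g.
Proof.
pose n := maxn (size (shift a (f + g))) (maxn (size (shift a f)) (size (shift a g))).
rewrite !(@vopE _ _ _ _ n) ?leq_max ?leqnn ?orbT // -big_split.
by apply: eq_bigr => i _; rewrite shD mulrDl.
Qed.

Lemma vopZ a b m (c : F) f : vop a b m (c *: f) = c *: vop a b m f.
Proof.
pose n := maxn (size (shift a (c *: f))) (size (shift a f)).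
rewrite !(@vopE _ _ _ _ n) ?leq_max ?leqnn ?orbT // scaler_sumr.
by apply: eq_bigr => i _; rewrite shZ scalerAl.
Qed.

Fact vop_linear a b m : linear (vop a b m).
Proof. by move=> c f g; rewrite vopD vopZ. Qed.
HB.instance Definition _ a b m := GRing.isLinear.Build F Lam Lam _ (vop a b m) (vop_linear a b m).

Lemma vop1 a b m : vop a b m 1 = hexp b m.
Proof. by rewrite /vop rmorph1 size_poly1 big_ord1 sh1 mul1r addn0. Qed.

(** The shift sends p_k to p_k + a_k y^k, and the factor y^k turns the coefficient of y^-m into that
    of y^-(m + k). Together with [vop1] this recursion determines the operator. *)
Lemma vop_pM a b m k f : (0 < k)%N ->
  vop a b m (p k * f) = p k * vop a b m f + a k *: vop a b (m + k) f.
Proof.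
move=> k0; pose n := maxn (size (shift a (p k * f))) (size (shift a f)).
rewrite (@vopE _ _ m (p k * f) (k + n)); last by rewrite (leq_trans (leq_maxl _ _) (leq_addl _ _)).
rewrite (@vopE _ _ m f (k + n)); last by rewrite (leq_trans (leq_maxr _ _) (leq_addl _ _)).
rewrite (@vopE _ _ (m + k) f n) ?leq_maxr // mulr_sumr scaler_sumr.
under eq_bigr => i _ do rewrite sh_pM // mulrDl -mulrA.
rewrite big_split /=; congr (_ + _).
rewrite big_split_ord /= big1 ?add0r => [|i _].
  apply: eq_bigr => i _; rewrite ltnNge leq_addr /= addKn -scalerAl.
  by rewrite addnA.
by rewrite ltn_ord scaler0 mul0r.
Qed.

(** A plethysm p_k -> c_k p_k turns one vertex operator into another, with y rescaled by r. It
    carries Macdonald's difference operator to D_0, and its analogue at 1/q, 1/t to D*_0. *)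
Lemma vop_scale a b a' b' c (r : F) m f :
    (forall k, (0 < k)%N -> c k * a' k = a k * r ^+ k) ->
    (forall k, (0 < k)%N -> c k * b k = r ^+ k * b' k) ->
  scale_power_sums c (vop a b m f) = r ^+ m *: vop a' b' m (scale_power_sums c f).
Proof.
move=> Ea Eb; move: f m; apply: (symfun_ind char0).
- by move=> f g Ef Eg m; rewrite vopD !linearD /= Ef Eg.
- by move=> d f Ef m; rewrite vopZ !linearZ /= Ef !scalerA mulrC.
- by move=> m; rewrite rmorph1 !vop1 scale_hexp (hexp_ext _ Eb) hexp_sscale.
- move=> k f k0 Ef m; rewrite vop_pM // linearD linearZ !rmorphM /= !Ef scale_power_sumsE //.
  rewrite -!scalerAl vopZ vop_pM // !scalerDr !scalerA.
  rewrite -scalerAr scalerA [c k * _]mulrC; congr (_ + _ *: _).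
  by rewrite -mulrA Ea // exprD; ring.
Qed.

Lemma vop_commutator a b m f : vop a b m (p 1 * f) - p 1 * vop a b m f = a 1%N *: vop a b m.+1 f.
Proof. by rewrite vop_pM // addrAC subrr add0r addn1. Qed.

(** As with dual numbers: a ring morphism [phi] with constant coefficient f is prescribed on the
    p_k, and its linear coefficient is a derivation. *)
Lemma derivation_exists (d : nat -> Lam) : exists theta : Lam -> Lam,
  [/\ forall f g, theta (f + g) = theta f + theta g,
      forall (x : F) f, theta (x *: f) = x *: theta f,
      forall f g, theta (f * g) = f * theta g + theta f * g
    & forall k, (0 < k)%N -> theta (p k) = d k].
Proof.
have [phi [phiZ phip]] := symfun_extension char0 const_poly (fun k => (p k)%:P + (d k)%:P * 'X).
have phi0 : forall f, (phi f)`_0 = f.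
  apply: (symfun_ind char0).
  - by move=> f g Ef Eg; rewrite rmorphD coefD Ef Eg.
  - by move=> c f Ef; rewrite phiZ const_polyM Ef.
  - by rewrite rmorph1 coef1.
  - move=> k f k0 Ef; rewrite rmorphM phip // mulrDl coefD coefCM -mulrA coefCM coefXM.
    by rewrite mulr0 addr0 Ef.
exists (fun f => (phi f)`_1); split.
- by move=> f g; rewrite rmorphD coefD.
- by move=> c f; rewrite phiZ const_polyM.
- by move=> f g; rewrite rmorphM coefM !big_ord_recl big_ord0 /= addr0 !phi0.
- by move=> k k0; rewrite phip // coefD coefC coefCM coefX mulr1 add0r.
Qed.

End VertexOperators.

(** * Self-adjointness for Macdonald's scalar product *)

Section ScalarProduct.
Variable F : fieldType.
Hypothesis char0 : forall n, n.+1%:R != 0 :> F.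
Local Notation Lam := (symfun F).
Local Notation p := (power_sum F).
Implicit Types (f g : Lam) (a b c : nat -> F).

Lemma power_sum_prod_cons k la : power_sum_prod F (k :: la) = p k * power_sum_prod F la.
Proof. exact: big_cons. Qed.

Lemma qt_scalar_productP (q t : F) : is_qt_scalar_product q t (qt_scalar_product q t).
Proof.
apply: epsilon_spec.
have basis := power_sum_basis char0.
(* The coordinate along p_la; the form is then diagonal in this basis. *)
have coord la : exists x : Lam -> F, [/\ forall f g, x (f + g) = x f + x g,
    forall (c : F) f, x (c *: f) = c * x f
  & forall mu, is_partition mu -> x (power_sum_prod F mu) = (mu == la)%:R].
  exact: (basis_extension idfun (fun mu => (mu == la)%:R) basis).
have [x xP] := boolp.choice coord.
pose w la := (zpart la)%:R * \prod_(k <- la) ((1 - q ^+ k) / (1 - t ^+ k)).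
have form g : exists L : Lam -> F, [/\ forall f g, L (f + g) = L f + L g,
    forall (c : F) f, L (c *: f) = c * L f
  & forall la, is_partition la -> L (power_sum_prod F la) = w la * x la g].
  exact: (basis_extension idfun (fun la => w la * x la g) basis).
have [L LP] := boolp.choice form.
exists (fun f g => L g f); split.
- move=> f a g h; move: f; apply: (basis_ind basis).
  + have E u : L u 0 = 0 by have [_ Z _] := LP u; rewrite -(scale0r 0) Z mul0r.
    by rewrite !E mulr0 addr0.
  + move=> f f' Ef Ef'; have D u : {morph L u : x y / x + y} by have [] := LP u.
    by rewrite !D Ef Ef' mulrDr addrACA.
  + move=> c f Ef; have Z u d v : L u (d *: v) = d * L u v by have [] := LP u.
    by rewrite !Z Ef mulrDr mulrCA.
  + move=> la pla; have E u : L u (power_sum_prod F la) = w la * x la u.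
      by have [_ _ ->] := LP u.
    by rewrite !E; have [-> -> _] := xP la; rewrite mulrDr mulrCA.
- by move=> g a f h; have [D Z _] := LP g; rewrite D Z.
- move=> la mu pla pmu; have [_ _ ->] := LP (power_sum_prod F mu) => //.
  have [_ _ ->] := xP la => //; rewrite eq_sym; case: eqP => _; last by rewrite mulr0.
  by rewrite mulr1.
Qed.

Lemma sum_sumn_widen la n : (sumn la <= n)%N ->
  zpart la = (\prod_(1 <= k < n.+1) (k ^ count_mem k la * (count_mem k la)`!))%N.
Proof.
move=> sn; rewrite /zpart (big_cat_nat (n := (sumn la).+1) (p := n.+1)) //=.
rewrite [X in (_ * X)%N]big_nat_cond [X in (_ * X)%N]big1 ?muln1 // => k /andP[/andP[lt _] _].
rewrite (_ : count_mem k la = 0)%N ?expn0 //; apply/count_memPn.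
apply: contraTN lt => kla; rewrite -leqNgt.
by move/path.splitPr: kla => -[l1 l2]; rewrite sumn_cat /=; lia.
Qed.

Lemma zpart_cons k la : (0 < k)%N -> zpart (k :: la) = (k * (count_mem k la).+1 * zpart la)%N.
Proof.
move=> k0; rewrite (@sum_sumn_widen (k :: la) (k + sumn la)) // (@sum_sumn_widen la (k + sumn la)) ?leq_addl //.
have kin : k \in index_iota 1 (k + sumn la).+1 by rewrite mem_index_iota k0 ltnS leq_addr.
rewrite !(bigD1_seq k kin) ?iota_uniq //= eqxx add1n expnS factS.
rewrite (eq_bigr (fun i => i ^ count_mem i la * (count_mem i la)`!)%N); last first.
  by move=> i; rewrite eq_sym => /negbTE->.
ring.
Qed.

Lemma zpart_perm la mu : perm_eq la mu -> zpart la = zpart mu.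
Proof.
move=> pm; rewrite /zpart (perm_sumn pm); apply: eq_bigr => k _.
by rewrite (seq.permP pm).
Qed.

Variables q t : F.
Let w k := (1 - q ^+ k) / (1 - t ^+ k).
Local Notation B := (qt_scalar_product q t).

Lemma sprodDl f g h : B (f + g) h = B f h + B g h.
Proof. by have [_ + _] := qt_scalar_productP q t => /(_ h 1 f g); rewrite scale1r mul1r. Qed.
Lemma sprodDr f g h : B f (g + h) = B f g + B f h.
Proof. by have [+ _ _] := qt_scalar_productP q t => /(_ f 1 g h); rewrite scale1r mul1r. Qed.
Lemma sprod0l f : B 0 f = 0.
Proof. by apply: (addrI (B 0 f)); rewrite -sprodDl !addr0. Qed.
Lemma sprod0r f : B f 0 = 0.
Proof. by apply: (addrI (B f 0)); rewrite -sprodDr !addr0. Qed.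
Lemma sprodZl (x : F) f g : B (x *: f) g = x * B f g.
Proof. by have [_ + _] := qt_scalar_productP q t => /(_ g x f 0); rewrite sprod0l !addr0. Qed.
Lemma sprodZr (x : F) f g : B f (x *: g) = x * B f g.
Proof. by have [+ _ _] := qt_scalar_productP q t => /(_ f x g 0); rewrite sprod0r !addr0. Qed.
Lemma sprod_suml I (r : seq I) (P : pred I) (G : I -> Lam) g :
  B (\sum_(i <- r | P i) G i) g = \sum_(i <- r | P i) B (G i) g.
Proof. by elim/big_rec2: _ => [|i x y _ <-]; rewrite ?sprod0l ?sprodDl. Qed.
Lemma sprod_sumr I (r : seq I) (P : pred I) (G : I -> Lam) g :
  B g (\sum_(i <- r | P i) G i) = \sum_(i <- r | P i) B g (G i).
Proof. by elim/big_rec2: _ => [|i x y _ <-]; rewrite ?sprod0r ?sprodDr. Qed.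

Lemma sprodpp la mu : is_partition la -> is_partition mu ->
  B (power_sum_prod F la) (power_sum_prod F mu) =
    if la == mu then (zpart la)%:R * \prod_(k <- la) w k else 0.
Proof. by have [_ _] := qt_scalar_productP q t; apply. Qed.

Lemma sprodC f g : B f g = B g f.
Proof.
move: f; apply: (basis_ind (power_sum_basis char0)).
- by rewrite sprod0l sprod0r.
- by move=> f h Ef Eh; rewrite sprodDl sprodDr Ef Eh.
- by move=> c f Ef; rewrite sprodZl sprodZr Ef.
move=> la pla; move: g; apply: (basis_ind (power_sum_basis char0)).
- by rewrite sprod0l sprod0r.
- by move=> f h Ef Eh; rewrite sprodDl sprodDr Ef Eh.
- by move=> c f Ef; rewrite sprodZl sprodZr Ef.
by move=> mu pmu; rewrite !sprodpp // eq_sym; case: eqP => // ->.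
Qed.

(** The partial derivative with respect to p_k. *)
Definition pderiv k : Lam -> Lam :=
  projT1 (cid (derivation_exists char0 (fun j => (j == k)%:R))).

Lemma pderivP k : [/\ forall f g, pderiv k (f + g) = pderiv k f + pderiv k g,
      forall (x : F) f, pderiv k (x *: f) = x *: pderiv k f,
      forall f g, pderiv k (f * g) = f * pderiv k g + pderiv k f * g
    & forall j, (0 < j)%N -> pderiv k (p j) = (j == k)%:R].
Proof. by rewrite /pderiv; case: cid. Qed.

Lemma pderivD k f g : pderiv k (f + g) = pderiv k f + pderiv k g.
Proof. by case: (pderivP k). Qed.
Lemma pderivZ k (x : F) f : pderiv k (x *: f) = x *: pderiv k f.
Proof. by case: (pderivP k). Qed.
Lemma pderiv1 k : pderiv k 1 = 0.
Proof.
have [_ _ + _] := pderivP k => /(_ 1 1); rewrite !mulr1 mul1r => E.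
by apply: (addrI (pderiv k 1)); rewrite -E addr0.
Qed.
Lemma pderiv_pM k j f : (0 < j)%N -> pderiv k (p j * f) = p j * pderiv k f + (if j == k then f else 0).
Proof. by move=> j0; have [_ _ -> -> //] := pderivP k; case: eqP; rewrite ?mul1r ?mul0r. Qed.

Lemma pderiv_prod k la : 0%N \notin la ->
  pderiv k (power_sum_prod F la) = (count_mem k la)%:R *: power_sum_prod F (rem k la).
Proof.
elim: la => [_|j la IH]; first by rewrite /power_sum_prod big_nil pderiv1 scale0r.
rewrite inE negb_or eq_sym -lt0n => /andP[j0 la0].
rewrite power_sum_prod_cons pderiv_pM // IH //=; have [->|ne] := eqVneq j k; last first.
  by rewrite addr0 add0n power_sum_prod_cons scalerAr.
rewrite -scalerAr -power_sum_prod_cons; have [kla|kla] := boolP (k \in la).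
  rewrite (power_sum_prod_perm F (_ : perm_eq (k :: rem k la) la)); last by rewrite perm_sym perm_to_rem.
  by rewrite natrD scalerDl scale1r addrC.
by rewrite (count_memPn kla) !scale0r add0r scale1r.
Qed.

(** On products of power sums, both sides vanish unless mu is la with a part k added, and then z_mu
    is k times the multiplicity of k in mu times z_la. *)
Lemma sprod_pM k f g : (0 < k)%N -> B (p k * f) g = k%:R * w k * B f (pderiv k g).
Proof.
move=> k0; move: f; apply: (basis_ind (power_sum_basis char0)).
- by rewrite mulr0 !sprod0l mulr0.
- by move=> f h Ef Eh; rewrite mulrDr !sprodDl Ef Eh mulrDr.
- by move=> x f Ef; rewrite -scalerAr !sprodZl Ef mulrCA.
move=> la pla; move: g; apply: (basis_ind (power_sum_basis char0)).
- by rewrite -(scale0r 1) pderivZ !sprodZr !mul0r mulr0.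
- by move=> f h Ef Eh; rewrite pderivD !sprodDr Ef Eh mulrDr.
- by move=> x f Ef; rewrite pderivZ !sprodZr Ef mulrCA.
move=> mu pmu; have [/andP[sla la0] /andP[smu mu0]] := (pla, pmu).
rewrite pderiv_prod // sprodZr -power_sum_prod_cons.
have pk : is_partition (sort geq (k :: la)).
  rewrite /is_partition sort_sorted; last by move=> x y; exact: leq_total.
  by rewrite mem_sort inE negb_or la0 eq_sym -lt0n k0.
have pm : perm_eq (k :: la) (sort geq (k :: la)) by rewrite perm_sym perm_sort.
rewrite (power_sum_prod_perm F pm) sprodpp //.
have [kmu|kmu] := boolP (k \in mu); last first.
  rewrite (count_memPn kmu) mul0r mulr0; case: eqP => // E; case/negP: kmu.
  by rewrite -E mem_sort mem_head.
have prem : is_partition (rem k mu).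
  rewrite /is_partition (contra (@mem_rem _ _ _ _)) // andbT.
  by apply: subseq_sorted (rem_subseq _ _) smu => x y z /=; lia.
rewrite sprodpp //; have -> : (sort geq (k :: la) == mu) = (la == rem k mu).
  apply/eqP/eqP => E.
    case/andP: prem => srem _; apply: (sorted_eq (leT := geq)) => //; [by move=> x y z /=; lia|by move=> x y /=; lia|].
    rewrite -(perm_cons k) (perm_trans pm) // E; exact: perm_to_rem.
  apply: (sorted_eq (leT := geq)) => //; [by move=> x y z /=; lia|by move=> x y /=; lia|by case/andP: pk|].
  rewrite perm_sort E perm_sym; exact: perm_to_rem.
case: eqP => [E|_]; last by rewrite !mulr0.
have pm' : perm_eq mu (k :: la) by rewrite E perm_to_rem.
rewrite -(zpart_perm pm) -(perm_big _ pm) /= big_cons zpart_cons // (seq.permP pm') /= eqxx.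
rewrite add1n !natrM; ring.
Qed.

(** Chain rule for y d/dy applied to g[X + Y], in which each p_k becomes p_k + a_k y^k. *)
Lemma sum_sh_pderiv a i g :
  \sum_(k < i.+1) k%:R *: (a k *: sh a (i - k) (pderiv k g)) = i%:R *: sh a i g.
Proof.
move: g i; apply: (symfun_ind char0).
- move=> f g Ef Eg i; rewrite shD scalerDr -Ef -Eg -big_split; apply: eq_bigr => k _.
  by rewrite pderivD shD !scalerDr.
- move=> x f Ef i; transitivity (x *: (i%:R *: sh a i f)); last first.
    by rewrite (shZ char0) !scalerA mulrC.
  rewrite -Ef scaler_sumr; apply: eq_bigr => k _.
  by rewrite pderivZ (shZ char0) !scalerA; congr (_ *: _); ring.
- move=> i; rewrite big1 => [|k _].
    by rewrite sh1; case: i => [|i]; rewrite ?scale0r ?scaler0.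
  by rewrite pderiv1 sh_zero !scaler0.
move=> j f j0 IH i; rewrite sh_pM // scalerDr.
have E (k : 'I_i.+1) : k%:R *: (a k *: sh a (i - k) (pderiv k (p j * f))) =
    p j * (k%:R *: (a k *: sh a (i - k) (pderiv k f)))
    + (a j *: (if (j + k <= i)%N then k%:R *: (a k *: sh a (i - j - k) (pderiv k f)) else 0)
    + (if k == j :> nat then j%:R *: (a j *: sh a (i - j) f) else 0)).
  rewrite pderiv_pM // shD sh_pM // !scalerDr -!scalerAr -addrA; congr (_ + (_ + _)).
    rewrite (_ : (j + k <= i)%N = ~~ (i - k < j)%N); last by have := ltn_ord k; lia.
    case: ifP => H; rewrite ?scaler0 //= subnAC.
    by rewrite !scalerA; congr (_ *: _); ring.
  by rewrite eq_sym; case: eqP => [<-|_] //; rewrite sh_zero !scaler0.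
rewrite (eq_bigr _ (fun k _ => E k)) !big_split /= -mulr_sumr IH -scalerAr; congr (_ + _).
rewrite -scaler_sumr -!big_mkcond /=; case: ltnP => [ij|ji].
  rewrite !big_pred0 ?scaler0 ?addr0 // => k.
    by apply: ltn_eqF; apply: leq_trans (ltn_ord k) _.
  by apply/negbTE; rewrite -ltnNge (leq_trans ij) ?leq_addr.
rewrite [X in _ + X](big_pred1 (Ordinal (ji : (j < i.+1)%N))) //=.
rewrite (_ : \sum_(k < i.+1 | (j + k <= i)%N) _ = (i - j)%:R *: sh a (i - j) f).
  rewrite !scalerA -scalerDl mulrC -mulrDl -natrD subnK //.
have le : ((i - j).+1 <= i.+1)%N by rewrite ltnS leq_subr.
rewrite -IH (big_ord_widen _ (fun k => k%:R *: (a k *: sh a (i - j - k) (pderiv k f))) le).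
by apply: eq_bigl => k; lia.
Qed.

(** Multiplication by p_k is adjoint to k w_k d/dp_k, so the recursion [newton_hexp] for the
    exponential matches the recursion [sum_sh_pderiv] for the shift. *)
Lemma sprod_hexpM b i f g : B (hexp b i * f) g = B f (sh (fun k => w k * b k) i g).
Proof.
have [n] := ubnP i; elim: n i f g => // n IH i f g; rewrite ltnS => ni.
case: i ni => [|i] ni; first by rewrite hexp0 // mul1r sh0.
apply: (@mulfI F i.+1%:R) => //.
rewrite -sprodZl -sprodZr -sum_sh_pderiv scalerAl scaler_nat.
have [_ /(congr1 (fun f : series Lam => f i.+1))] := newton_hexp char0 b.
rewrite /sdelta => ->; rewrite seriesME mulr_suml sprod_suml sprod_sumr.
apply: eq_bigr => k _; rewrite /pseries -!scalerAl sprodZl !sprodZr.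
case: k => -[|k] /= lt; first by rewrite power_sum0 !mul0r sprod0l mulr0.
by rewrite -mulrA sprod_pM // IH ?subSS; [ring | lia].
Qed.

(** Moving the exponential to the other side turns the i-th term into r^i B(sh_i f, sh_i g), which
    is symmetric in f and g. *)
Lemma vop_self_adjoint a b (r : F) f g :
    (forall k, (0 < k)%N -> w k * b k = r ^+ k * a k) ->
  B (vop a b 0 f) g = B f (vop a b 0 g).
Proof.
move=> E; pose n := maxn (size (shift a f)) (size (shift a g)).
rewrite !(@vopE F _ _ _ _ n) ?leq_maxl ?leq_maxr // sprod_suml sprod_sumr.
apply: eq_bigr => i _; rewrite add0n mulrC sprod_hexpM [RHS]sprodC mulrC sprod_hexpM.
rewrite !(sh_ext char0 _ _ E) !sh_sscale // !sprodZr sprodC; congr (_ * _).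
Qed.

End ScalarProduct.

(** * The commutator of D and its dual *)

Section Commutators.
Variable F : fieldType.
Hypothesis char0 : forall n, n.+1%:R != 0 :> F.
Local Notation Lam := (symfun F).
Local Notation p := (power_sum F).
Implicit Types (f g : Lam) (a b c : nat -> F).

(** Shifting exp (sum_k b_k p_k z^k / k) by a_k y^k multiplies it by kappa(yz), where kappa(v) = exp
    (sum_k a_k b_k v^k / k): both solve one Newton equation over polynomials in y. *)
Lemma sh_hexp a b (c kappa : series F) n i :
    newton c kappa -> (forall k, (0 < k)%N -> c k = a k * b k) ->
  sh a i (hexp b n) = if (i <= n)%N then kappa i *: hexp b (n - i) else 0.
Proof.
move=> nk cE; have c0 : c 0%N = 0.
  by have [k0 /(congr1 (fun f : series F => f 0%N))] := nk; rewrite seriesM0 k0 mulr1.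
pose Z : series {poly Lam} := fun k => const_poly F (kappa k) * 'X^k.
have nZ : newton (fun k => const_poly F (c k) * 'X^k) Z.
  case: nk => k0 dk; split; first by rewrite /Z k0 rmorph1 mul1r expr0.
  apply: series_ext => k; rewrite seriesME /sdelta /Z -mulrnAl -rmorphMn.
  rewrite -[kappa k *+ k]/(sdelta kappa k) dk seriesME rmorph_sum mulr_suml.
  apply: eq_bigr => j _; rewrite rmorphM mulrACA -exprD subnKC //.
  by rewrite -ltnS ltn_ord.
have nC := newton_smap (polyC : {rmorphism Lam -> {poly Lam}}) (newton_hexp char0 b).
have := newton_uniq (poly_torsion_free char0) (newton_smap (shift a) (newton_hexp char0 b)).
move=> /(_ (smap polyC (hexp b) * Z)); rewrite (_ : smap (shift a) (pseries b)
  = smap polyC (pseries b) + (fun k => const_poly F (c k) * 'X^k)) => [|].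
  move=> /(_ (newton_mul nC nZ)) /(congr1 (fun f : series {poly Lam} => (f n)`_i)).
  rewrite /= seriesME coef_sum => E; rewrite -[LHS]/((smap (shift a) (hexp b) n)`_i) E.
  under eq_bigr => j _ do rewrite coefCM const_polyM coefXn.
  case: leqP => [le|lt].
    have lt : (n - i < n.+1)%N by rewrite ltnS leq_subr.
    rewrite (bigD1 (Ordinal lt)) //= subKn // eqxx big1 ?addr0 => [|j ne].
      by rewrite -scalerAr mulr1.
    rewrite (_ : i == _ = false) ?scaler0 ?mulr0 //; apply: contraNF ne => /eqP E'.
    by rewrite -val_eqE /= E' subKn // -ltnS ltn_ord.
  rewrite big1 // => j _; rewrite (_ : i == _ = false) ?scaler0 ?mulr0 //.
  by apply: gtn_eqF; apply: leq_ltn_trans lt; rewrite leq_subr.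
apply: series_ext => -[|k].
  by rewrite seriesDE /smap /pseries power_sum0 scaler0 !rmorph0 add0r c0 rmorph0 mul0r.
rewrite seriesDE /smap /pseries (shift_spec char0 a).1 (shift_spec char0 a).2 // mulrDr.
rewrite mulrA -rmorphM /= cE // [b _ * _]mulrC; congr (_ + _).
by rewrite -rmorphM /= mulr_algl.
Qed.

Lemma vop_hexp a b b' (c kappa : series F) m n :
    newton c kappa -> (forall k, (0 < k)%N -> c k = a k * b' k) ->
  vop a b m (hexp b' n) = \sum_(i < n.+1) kappa i *: (hexp b' (n - i) * hexp b (m + i)).
Proof.
move=> nk cE; rewrite (@vopE _ _ _ _ _ n.+1).
  by apply: eq_bigr => i _; rewrite (sh_hexp _ _ nk) // -ltnS ltn_ord scalerAl.
apply/leq_sizeP => j nj; rewrite -[LHS]/(sh a j (hexp b' n)) (sh_hexp _ _ nk) //.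
by rewrite leqNgt nj.
Qed.

(** (1 - qz)(1 - tz) / ((1 - z)(1 - qtz)), the exponential of sum_k (1 - q^k)(1 - t^k) z^k / k. It
    is the scalar factor that appears when [D] is applied to [hexp bS]. *)
Definition kappa4 (q t : F) : series F :=
  ((1 - seriesC q * seriesX) * (1 - seriesC t * seriesX)) * (geom 1 * geom (q * t)).

Lemma newton_kappa4 q t :
  newton (- powers q - powers t + (powers 1 + powers (q * t))) (kappa4 q t).
Proof.
by apply: newton_mul; apply: newton_mul; (apply: newton_lin || apply: newton_geom).
Qed.

(** Partial fractions: the series is 1 + alpha (1 / (1 - z) - 1 / (1 - qtz)). *)
Lemma kappa4E (q t alpha : F) n : alpha * (1 - q * t) = (1 - q) * (1 - t) ->
  kappa4 q t n = (n == 0)%:R + alpha * (1 - (q * t) ^+ n).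
Proof.
move=> Ea; have H : seriesC alpha * (1 - seriesC q * seriesC t) = (1 - seriesC q) * (1 - seriesC t).
  by rewrite -seriesC1 -seriesC_M -!seriesCB -!seriesC_M Ea.
have -> : kappa4 q t = 1 + seriesC alpha * (geom 1 - geom (q * t)).
  have [e1 e2] := (geomE (1 : F), geomE (q * t)).
  rewrite /kappa4; rewrite seriesC1 mul1r in e1; rewrite seriesC_M in e2.
  set g1 := geom 1 in e1 *; set g2 := geom (q * t) in e2 *.
  set X := seriesX in H e1 e2 *; set Q := seriesC q in H e2 *; set T := seriesC t in H e2 *.
  set A := seriesC alpha in H *.
  transitivity ((1 - X) * g1 * ((1 - Q * T * X) * g2)
     + A * (g1 * ((1 - Q * T * X) * g2) - g2 * ((1 - X) * g1))); last first.
    by rewrite e1 e2 !mulr1.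
  transitivity ((1 - X) * g1 * ((1 - Q * T * X) * g2)
     + A * (1 - Q * T) * (X * g1 * g2)); last by ring.
  by rewrite H; ring.
by rewrite seriesDE series1E seriesCM seriesDE seriesNE /geom expr1n.
Qed.

Variables q t : F.
Hypotheses (q0 : q != 0) (t0 : t != 0) (qt1 : 1 - q * t != 0).

(* With these parameters, vop is f |-> f[X + M/z] \sum_i (-z)^i e_i at z^m (for aD, bD),
   and the same operator at 1/q, 1/t with f[X - M/z] and h_i for (-1)^i e_i (for aS, bS). *)
Definition aD k := (1 - q ^+ k) * (1 - t ^+ k).
Definition aS k := - ((1 - q ^- k) * (1 - t ^- k)).
Definition bD (k : nat) : F := -1.
Definition bS (k : nat) : F := 1.
Local Notation D := (vop aD bD).
Local Notation S := (vop aS bS).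
Let alpha := (1 - q) * (1 - t) / (1 - q * t).
Let z := q * t.
Let h2 := hexp (fun k => 1 - z ^+ k).
Let gamma m r : Lam := alpha *: ((m + r == 0)%N%:R - z ^- m *: h2 (m + r)).

(** The two products of operators supply the ranges n >= m and n < m of a single sum of alpha (1 -
    z^(n - m)) [hexp bD n * hexp bS (m + r - n)]. Its two halves are coefficients of products of
    exponentials, namely 1 and [h2]. *)
Lemma DS_commutator1 m r : D m (hexp bS r) - S r (hexp bD m) = gamma m r.
Proof.
have z0 : z != 0 by rewrite mulf_neq0.
have Ea : alpha * (1 - z) = (1 - q) * (1 - t) by rewrite /alpha mulfVK.
(* Inverting q and t changes the sign of [alpha], which lets both expansions share one summand. *)
have Ea' : - alpha * (1 - q^-1 * t^-1) = (1 - q^-1) * (1 - t^-1).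
  transitivity (alpha * (1 - z) / z); first by rewrite /z; field; rewrite ?q0 ?t0.
  by rewrite Ea /z; field; rewrite ?q0 ?t0.
rewrite (@vop_hexp _ _ _ _ _ _ _ (newton_kappa4 q t)); last first.
  by case=> // k _; rewrite !seriesDE !seriesNE /powers expr1n exprMn /aD /bS; ring.
rewrite (@vop_hexp _ _ _ _ _ _ _ (newton_kappa4 q^-1 t^-1)); last first.
  by case=> // k _; rewrite !seriesDE !seriesNE /powers expr1n exprMn /aS /bD -!exprVn; ring.
have -> : gamma m r = \sum_(n < (m + r).+1) (alpha * (1 - z ^+ n / z ^+ m)) *: (hexp bD n * hexp bS (m + r - n)).
  rewrite /gamma /h2 -(hexp_zero char0) (hexp_ext char0 (b' := fun k => bD k + bS k)); last first.
    by move=> k _; rewrite /bD /bS addNr.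
  rewrite (hexp_ext char0 (b' := fun k => z ^+ k * bD k + bS k) (b := fun k => 1 - z ^+ k)); last first.
    by move=> k _; rewrite /bD /bS; ring.
  rewrite -!(hexpM char0) !seriesME scaler_sumr -sumrB scaler_sumr; apply: eq_bigr => n _.
  rewrite (hexp_sscale char0) -scalerAl scalerA -{1}[hexp bD n * _]scale1r -scalerBl scalerA.
  by congr (_ * (1 - _) *: _); rewrite mulrC.
rewrite -addnS big_split_ord /=.
have -> : \sum_(i < r.+1) kappa4 q t i *: (hexp bS (r - i) * hexp bD (m + i)) =
    hexp bD m * hexp bS r +
    \sum_(i < r.+1) (alpha * (1 - z ^+ (m + i) / z ^+ m)) *: (hexp bD (m + i) * hexp bS (m + r - (m + i))).
  rewrite [in LHS](eq_bigr (fun i : 'I_r.+1 => (i == 0 :> nat)%:R *: (hexp bD (m + i) * hexp bS (r - i))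
    + (alpha * (1 - z ^+ (m + i) / z ^+ m)) *: (hexp bD (m + i) * hexp bS (m + r - (m + i))))).
    rewrite big_split /=; congr (_ + _); rewrite big_ord_recl big1 ?addr0 => [|i _].
      by rewrite scale1r addn0 subn0.
    by rewrite scale0r.
  move=> i _; rewrite (kappa4E _ Ea) subnDl -scalerDl [hexp bS _ * _]mulrC.
  by rewrite exprD [z ^+ m * _]mulrC mulfK // expf_neq0.
rewrite addrAC; congr (_ + _).
rewrite big_ord_recl (kappa4E _ Ea') expr0 subrr mulr0 addr0 scale1r subn0 addn0.
rewrite opprD addrA subrr add0r (reindex_inj rev_ord_inj) /= -sumrN; apply: eq_bigr => i _.
rewrite (kappa4E _ Ea') /bump leq0n add1n add0r -scaleNr; have le := ltn_ord i.
rewrite (_ : m - (m - i.+1).+1 = i)%N; last by lia.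
rewrite (_ : r + (m - i.+1).+1 = m + r - i)%N; last by lia.
congr (_ *: _).
have -> : z ^+ i / z ^+ m = z ^- (m - i).
  by rewrite -[X in z ^+ i / z ^+ X](subnK (ltnW le)) exprD invfM mulrCA divff ?mulr1 // expf_neq0.
rewrite (_ : (m - i.+1).+1 = m - i)%N; last by lia.
by rewrite -invfM exprVn mulNr opprK.
Qed.

(** Passing from f to p_k f adds multiples of [gamma] at (m + k, r) and at (m, r + k), which cancel
    since aD k / z^k = - aS k. *)
Lemma DS_commutator m r f : D m (S r f) - S r (D m f) = gamma m r * f.
Proof.
have z0 : z != 0 by rewrite mulf_neq0.
move: f m r; apply: (symfun_ind char0).
- by move=> f g Ef Eg m r; rewrite mulrDr -Ef -Eg !(vopD) opprD addrACA.
- by move=> c f Ef m r; rewrite -scalerAr -Ef !(vopZ char0) scalerBr.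
- by move=> m r; rewrite !vop1 mulr1 DS_commutator1.
move=> k f k0 IH m r.
rewrite !(vop_pM char0) // !(vopD) !(vopZ char0) !(vop_pM char0) //.
transitivity (p k * (D m (S r f) - S r (D m f)) + aD k *: (D (m + k) (S r f) - S r (D (m + k) f))
   + aS k *: (D m (S (r + k) f) - S (r + k) (D m f))).
  rewrite mulrBr !scalerBr [X in _ - X]addrAC opprD addrACA; congr (_ + _).
  by rewrite opprD addrACA.
rewrite !IH mulrCA -addrA -[RHS]addr0; congr (_ + _).
rewrite !scalerAl -mulrDl /gamma !scalerA.
have nz u : (u + k == 0)%N = false by rewrite addn_eq0 andbC -[k]prednK.
rewrite (addnAC m k r) addnA !nz !sub0r !scalerN -opprD !scalerA -scalerDl.
rewrite (_ : aD k * alpha * _ + _ = 0) ?scale0r ?oppr0 ?mul0r //.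
rewrite /aD /aS exprD invfM mulrA /z !exprMn; field.
by rewrite !expf_neq0.
Qed.

End Commutators.

(** * Finitely many variables and triangularity *)

Section PartialFractions.
Variables (A : idomainType) (N : nat) (x : 'I_N -> A) (t : A).
Hypothesis x_inj : injective x.

(** Over all ordered pairs, so that c = 1 gives the square of the Vandermonde product up to sign.
    Taking c = [only_row k] multiplies it by prod_j (x_k - t x_j) / (x_k - x_j), without
    denominators. *)
Definition pair_prod (c : 'I_N -> 'I_N -> A) := \prod_i \prod_(j | j != i) (x i - c i j * x j).
Definition only_row (k i j : 'I_N) : A := if i == k then t else 1.

Lemma pair_prod_row k :
  pair_prod (only_row k) * \prod_(j | j != k) (x k - x j)
    = pair_prod (fun _ _ => 1) * \prod_(j | j != k) (x k - t * x j).
Proof.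
rewrite /pair_prod (bigD1 k) //= [in RHS](bigD1 k) //=.
rewrite [\prod_(j | j != k) (x k - 1 * x j)](eq_bigr (fun j => x k - x j)); last first.
  by move=> j _; rewrite mul1r.
transitivity (\prod_(j | j != k) (x k - t * x j) *
    (\prod_(i | i != k) \prod_(j | j != i) (x i - 1 * x j)) * \prod_(j | j != k) (x k - x j)); last by ring.
congr (_ * _ * _); first by apply: eq_bigr => j _; rewrite /only_row eqxx.
apply: eq_bigr => i ne; apply: eq_bigr => j _.
by rewrite /only_row (negbTE ne).
Qed.

(** Lagrange interpolation at the nodes x_i of prod_j (X - t x_j) - prod_j (X - x_j), whose degree
    is less than N, cleared of denominators. *)
Lemma interpolation :
  (pair_prod (fun _ _ => 1))%:P * (\prod_j ('X - (t * x j)%:P) - \prod_j ('X - (x j)%:P))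
  = \sum_i ((1 - t) * x i * pair_prod (only_row i))%:P * \prod_(j | j != i) ('X - (x j)%:P).
Proof.
apply/eqP; rewrite -subr_eq0; apply/eqP.
apply: (@roots_geq_poly_eq0 _ _ [seq x i | i <- enum 'I_N]).
- apply/allP => _ /mapP[k _ ->]; rewrite /root !hornerE horner_sum !horner_prod.
  have -> : \prod_i ('X - (x i)%:P).[x k] = 0 by rewrite (bigD1 k) //= !hornerE subrr mul0r.
  rewrite subr0 [X in _ - X](bigD1 k) //= [X in _ - (_ + X)]big1 ?addr0 => [|i ne].
    rewrite !hornerE horner_prod -mulrA (eq_bigr (fun j => x k - t * x j)); last first.
      by move=> j _; rewrite !hornerE.
    rewrite (bigD1 k) //= [\prod_(j | j != k) _.[_]](eq_bigr (fun j => x k - x j)); last first.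
      by move=> j _; rewrite !hornerE.
    rewrite subr_eq0; apply/eqP.
    transitivity ((1 - t) * x k * (pair_prod (fun _ _ => 1) * \prod_(j | j != k) (x k - t * x j))).
      by ring.
    by rewrite -pair_prod_row; ring.
  rewrite hornerM horner_prod [X in _ * X](bigD1 k) //=; last by rewrite eq_sym.
  have -> : ('X - (x k)%:P).[x k] = 0 by rewrite !hornerE subrr.
  by rewrite mul0r mulr0.
- by rewrite map_inj_uniq ?enum_uniq.
rewrite size_map size_enum_ord; apply/leq_sizeP => j Nj.
rewrite coefB coefCM coefB coef_sum [X in _ - X]big1 => [|i _].
  have sz (y : 'I_N -> A) : size (\prod_j ('X - (y j)%:P)) = N.+1.
    by rewrite size_prod_XsubC -[index_enum _]enumT size_enum_ord.
  have [jN|ne] := eqVneq j N.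
    have lead (y : 'I_N -> A) : (\prod_j ('X - (y j)%:P))`_N = 1.
      have /monicP := monic_prod_XsubC (index_enum 'I_N) xpredT y.
      by rewrite /lead_coef sz.
    by rewrite jN !lead subrr mulr0 subr0.
  by rewrite !nth_default ?sz ?subrr ?mulr0 ?subr0 // ltn_neqAle eq_sym ne.
rewrite coefCM nth_default ?mulr0 // -big_filter size_prod_XsubC size_filter.
rewrite (leq_trans _ Nj) // -[X in (_ < X)%N]card_ord -[index_enum _]enumT.
rewrite cardE -(count_predC (fun j => j != i)) -addn1 leq_add2l -has_count.
by apply/hasP; exists i; rewrite ?mem_enum //= eqxx.
Qed.

(** The product of the 1 - az is the reversed polynomial of the product of the X - a. *)
Lemma prod_lin_series (y : seq A) n :
  (\prod_(a <- y) (1 - seriesC a * seriesX) : series A) n =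
    if (n <= size y)%N then (\prod_(a <- y) ('X - a%:P))`_(size y - n) else 0.
Proof.
elim: y n => [|a y IH] n; first by rewrite !big_nil series1E coef1 leqn0; case: n.
rewrite !big_cons mulrBl mul1r -mulrA seriesDE seriesNE seriesCM seriesXM /=.
rewrite mulrBl coefB coefXM coefCM !IH.
have szy : size (\prod_(a <- y) ('X - a%:P)) = (size y).+1 by exact: size_prod_XsubC.
case: n => [|n]; first by rewrite !subn0 mulr0 [X in _ - _ * X]nth_default ?szy ?mulr0 ?subr0.
rewrite IH ltnS subSS; case: (ltngtP n (size y)) => [lt|gt|->].
- by rewrite subn_eq0 leqNgt lt /= -subnS.
- by rewrite mulr0 subrr.
- by rewrite subnn.
Qed.

(** Reversing the polynomials in [interpolation] and dividing by prod_i (1 - x_i z) gives the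
    partial fraction expansion of prod_i (1 - t x_i z) / (1 - x_i z). *)
Lemma partial_fractions j : (0 < j)%N ->
  pair_prod (fun _ _ => 1) * (\prod_i ((1 - seriesC (t * x i) * seriesX) * geom (x i)) : series A) j
  = (1 - t) * \sum_i pair_prod (only_row i) * x i ^+ j.
Proof.
case: j => // j _.
have E : seriesC (pair_prod (fun _ _ => 1)) * \prod_i (1 - seriesC (t * x i) * seriesX) =
   seriesC (pair_prod (fun _ _ => 1)) * \prod_i (1 - seriesC (x i) * seriesX)
   + \sum_i seriesC ((1 - t) * x i * pair_prod (only_row i)) * seriesX *
       \prod_(k | k != i) (1 - seriesC (x k) * seriesX) :> series A.
  have prodE (y : 'I_N -> A) (P : pred 'I_N) n : (\prod_(i | P i) (1 - seriesC (y i) * seriesX) : series A) n =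
    if (n <= #|P|)%N then (\prod_(i | P i) ('X - (y i)%:P))`_(#|P| - n) else 0.
    have := prod_lin_series [seq y i | i <- enum P] n.
    by rewrite !big_map !big_enum size_map -cardE.
  apply: series_ext => n; rewrite seriesDE series_sumE !seriesCM !prodE card_ord.
  have cardC (i : 'I_N) : #|(fun k => k != i)| = N.-1.
    by have := cardC1 i; rewrite card_ord => <-; apply: eq_card.
  case: n => [|n].
    rewrite !subn0 /= [X in _ = _ + X]big1 ?addr0 => [|i _]; last by rewrite -mulrA seriesCM seriesXM mulr0.
    have /(congr1 (fun P : {poly A} => P`_N)) := interpolation.
    rewrite coefCM coefB coef_sum [RHS]big1 => [|i _]; last first.
      rewrite coefCM nth_default ?mulr0 // -big_filter size_prod_XsubC size_filter.
      rewrite -[X in (_ < X)%N]card_ord -[index_enum _]enumT.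
      rewrite cardE -(count_predC (fun j => j != i)) -addn1 leq_add2l -has_count.
      by apply/hasP; exists i; rewrite ?mem_enum //= eqxx.
    by rewrite mulrBr => /eqP; rewrite subr_eq0 => /eqP.
  have [nN|Nn] := ltnP n N; last first.
    rewrite !mulr0 add0r [RHS]big1 // => i _; rewrite -mulrA seriesCM seriesXM prodE cardC.
    by rewrite ifF ?mulr0 //; have := ltn_ord i; lia.
  have /(congr1 (fun P : {poly A} => P`_(N - n.+1))) := interpolation.
  rewrite coefCM coefB mulrBr => /eqP; rewrite subr_eq addrC => /eqP->; congr (_ + _).
  rewrite coef_sum; apply: eq_bigr => i _; rewrite coefCM -[seriesC _ * _ * _]mulrA seriesCM seriesXM prodE cardC.
  rewrite ifT; last by lia.
  by congr (_ * _`_ _); lia.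
transitivity ((seriesC (pair_prod (fun _ _ => 1)) * \prod_i (1 - seriesC (t * x i) * seriesX)
   * \prod_i geom (x i) : series A) j.+1).
  by rewrite -mulrA seriesCM big_split.
have G : \prod_i (1 - seriesC (x i) * seriesX) * \prod_i geom (x i) = 1 :> series A.
  by rewrite -big_split /= big1 // => i _; rewrite geomE.
rewrite E mulrDl -mulrA G mulr1 seriesDE add0r mulr_suml series_sumE mulr_sumr.
apply: eq_bigr => i _.
have -> : \prod_i geom (x i) = geom (x i) * \prod_(k | k != i) geom (x k) :> series A.
  by rewrite (bigD1 i).
have H : \prod_(k | k != i) (1 - seriesC (x k) * seriesX) * \prod_(k | k != i) geom (x k) = 1 :> series A.
  by rewrite -big_split big1 // => k _; exact: geomE.
rewrite [X in X j.+1 = _](_ : _ = seriesC ((1 - t) * x i * pair_prod (only_row i)) * (seriesX * geom (x i)) *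
  (\prod_(k | k != i) (1 - seriesC (x k) * seriesX) * \prod_(k | k != i) geom (x k))); last by ring.
rewrite H mulr1 seriesCM seriesXM /geom exprS; ring.
Qed.
End PartialFractions.

(** * Leading terms for weights on the variables *)

Section Grading.
Variables (F : fieldType) (N : nat).
Local Notation P := {mpoly F[N]}.
Implicit Types (f : P) (m : 'X_{1..N}) (w : 'I_N -> nat).

Definition wt w m : nat := (\sum_i m i * w i)%N.

(* x_i |-> x_i u^(w i) *)
Definition gr w : P -> {poly P} :=
  locked (mmap ((polyC \o @mpolyC N F) : F -> {poly P}) (fun i => ('X_i)%:P * 'X^(w i))).

Lemma grE w : gr w = mmap ((polyC \o @mpolyC N F) : F -> {poly P}) (fun i => ('X_i)%:P * 'X^(w i)).
Proof. by rewrite /gr -lock. Qed.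

Fact gr_zmod w : zmod_morphism (gr w). Proof. by rewrite grE; exact: raddfB. Qed.
Fact gr_monoid w : monoid_morphism (gr w).
Proof. by rewrite grE; split; [exact: rmorph1 | exact: rmorphM]. Qed.
HB.instance Definition _ w := GRing.isZmodMorphism.Build P {poly P} (gr w) (gr_zmod w).
HB.instance Definition _ w := GRing.isMonoidMorphism.Build P {poly P} (gr w) (gr_monoid w).

Lemma grC w (c : F) : gr w c%:MP = c%:MP%:P. Proof. by rewrite grE mmapC. Qed.
Lemma grXi w i : gr w 'X_i = ('X_i)%:P * 'X^(w i). Proof. by rewrite grE mmapX mmap1U. Qed.

Lemma coef_gr w f d m : ((gr w f)`_d)@_m = if wt w m == d then f@_m else 0.
Proof.
rewrite grE /mmap coef_sum (raddf_sum (mcoeff m)) /=.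
have E m' : mmap1 (fun i => ('X_i)%:P * 'X^(w i)) m' = ('X_[m'])%:P * 'X^(wt w m') :> {poly P}.
  rewrite /mmap1 /wt (mpolyXE_id _ m') rmorph_prod -prodrXr -big_split /=.
  by apply: eq_bigr => i _; rewrite exprMn -exprM mulnC rmorphXn.
under eq_bigr => m' _ do rewrite E coefCM coefCM coefXn mcoeffCM.
have [mf|mf] := boolP (m \in msupp f).
  rewrite (bigD1_seq m) ?msupp_uniq //= big1 ?addr0 => [|m' ne].
    by rewrite eq_sym; case: eqP; rewrite ?mulr1 ?mulr0 ?mcoeff0 ?mulr0 // mcoeffX eqxx mulr1.
  rewrite mulr_natr raddfMn /= mcoeffX (negbTE ne) mul0rn mulr0 //.
rewrite big_seq big1 => [|m' m'f].
  by rewrite (memN_msupp_eq0 mf) if_same.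
rewrite mulr_natr raddfMn /= mcoeffX (_ : m' == m = false) ?mul0rn ?mulr0 //.
by apply: contraNF mf => /eqP <-.
Qed.

Lemma size_gr w f d : (forall m, f@_m != 0 -> (wt w m <= d)%N) -> (size (gr w f) <= d.+1)%N.
Proof.
move=> fd; apply/leq_sizeP => j dj; apply/mpolyP => m; rewrite coef_gr mcoeff0.
case: eqP => // E; apply/eqP; apply: contraTT dj => /fd.
by rewrite E -ltnNge.
Qed.

Definition rescale (c : 'I_N -> F) : P -> P :=
  locked (mmap (@mpolyC N F) (fun i => c i *: 'X_i)).

Lemma rescaleE c : rescale c = mmap (@mpolyC N F) (fun i => c i *: 'X_i).
Proof. by rewrite /rescale -lock. Qed.

Fact rescale_zmod c : zmod_morphism (rescale c). Proof. by rewrite rescaleE; exact: raddfB. Qed.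
Fact rescale_monoid c : monoid_morphism (rescale c).
Proof. by rewrite rescaleE; split; [exact: rmorph1 | exact: rmorphM]. Qed.
HB.instance Definition _ c := GRing.isZmodMorphism.Build P P (rescale c) (rescale_zmod c).
HB.instance Definition _ c := GRing.isMonoidMorphism.Build P P (rescale c) (rescale_monoid c).

Lemma rescaleC c (x : F) : rescale c x%:MP = x%:MP. Proof. by rewrite rescaleE mmapC. Qed.
Lemma rescaleX c i : rescale c 'X_i = c i *: 'X_i. Proof. by rewrite rescaleE mmapX mmap1U. Qed.

Lemma mcoeff_rescale c f m : (rescale c f)@_m = (\prod_i c i ^+ m i) * f@_m.
Proof.
rewrite rescaleE /mmap (raddf_sum (mcoeff m)) /=.
have E m' : mmap1 (fun i => c i *: 'X_i) m' = (\prod_i c i ^+ m' i) *: 'X_[m'] :> P.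
  rewrite /mmap1 (mpolyXE_id _ m') -scaler_prod.
  by apply: eq_bigr => i _; rewrite exprZn.
under eq_bigr => m' _ do rewrite E mcoeffCM mcoeffZ mcoeffX.
have [mf|mf] := boolP (m \in msupp f).
  rewrite [LHS](bigD1_seq m) ?msupp_uniq //= [X in _ + X]big1 ?addr0 => [|m' ne].
    by rewrite eqxx mulr1 mulrC.
  by rewrite (negbTE ne) !mulr0.
rewrite (memN_msupp_eq0 mf) mulr0 big_seq [LHS]big1 // => m' m'f.
rewrite (_ : m' == m = false) ?mulr0 //.
by apply: contraNF mf => /eqP <-.
Qed.

(** The degree in u is the same for every nonzero c; this is what allows comparing the numerators
    U_i with the denominator V. *)
Lemma gr_binomial w (c : F) i j : c != 0 -> i != j ->
  [/\ size (gr w ('X_i - c%:MP * 'X_j)) = (maxn (w i) (w j)).+1,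
      (w j < w i)%N -> lead_coef (gr w ('X_i - c%:MP * 'X_j)) = 'X_i
    & (w i < w j)%N -> lead_coef (gr w ('X_i - c%:MP * 'X_j)) = - c *: 'X_j].
Proof.
move=> c0 ij; have E : gr w ('X_i - c%:MP * 'X_j) = ('X_i)%:P * 'X^(w i) + (- c *: 'X_j)%:P * 'X^(w j).
  rewrite rmorphB rmorphM /= !grXi grC -mul_mpolyC mpolyCN mulNr polyCN mulNr polyCM.
  by rewrite mulrA.
have nzX k : 'X_k != 0 :> P by apply/eqP => /(congr1 (mcoeff U_(k))); rewrite mcoeffX eqxx mcoeff0; apply/eqP/oner_neq0.
have nzcX : - c *: 'X_j != 0 :> P by rewrite scaler_eq0 oppr_eq0 negb_or c0 nzX.
have szXn (a : P) k : a != 0 -> size (a%:P * 'X^k) = k.+1.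
  by move=> a0; rewrite mul_polyC size_scale // size_polyXn.
rewrite E; have [lt|gt|eq] := ltngtP (w i) (w j).
- split=> // [|_]; first by rewrite addrC size_polyDl ?szXn // ltnS.
  by rewrite addrC lead_coefDl ?szXn // mul_polyC lead_coefZ lead_coefXn mulr1.
- split=> // [|_]; first by rewrite size_polyDl ?szXn // ltnS.
  by rewrite lead_coefDl ?szXn // mul_polyC lead_coefZ lead_coefXn mulr1.
split=> //; rewrite eq -mulrDl -polyCD szXn //.
apply/eqP => /(congr1 (mcoeff U_(i))); rewrite mcoeffD mcoeffZ !mcoeffX mcoeff0 eqxx.
have -> : (U_(j) == U_(i) :> 'X_{1..N})%MM = false.
  apply: contraNF ij => /eqP /(congr1 (fun m : 'X_{1..N} => m j)).
  by rewrite !mnm1E eqxx; case: eqP.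
by rewrite mulr0 addr0; apply/eqP/oner_neq0.
Qed.

Lemma prod_same_size (I : finType) (Q : pred I) (G H : I -> {poly P}) :
    (forall i, Q i -> G i != 0) -> (forall i, Q i -> size (G i) = size (H i)) ->
  size (\prod_(i | Q i) G i) = size (\prod_(i | Q i) H i).
Proof.
move=> G0 GH; rewrite !size_prod //; last by move=> i Qi; rewrite -size_poly_eq0 -GH // size_poly_eq0 G0.
by congr (_ - _)%N; congr _.+1; apply: eq_bigr.
Qed.

Definition Xpair (c : 'I_N -> 'I_N -> F) : P := pair_prod (fun i => 'X_i) (fun i j => (c i j)%:MP).

Section Xpair.
Variables (w : 'I_N -> nat) (c : 'I_N -> 'I_N -> F).
Hypothesis c0 : forall i j, c i j != 0.

Let gr_nz i j : i != j -> gr w ('X_i - (c i j)%:MP * 'X_j) != 0.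
Proof. by move=> ij; have [sz _ _] := gr_binomial w (c0 i j) ij; rewrite -size_poly_eq0 sz. Qed.

Lemma gr_Xpair : gr w (Xpair c) = \prod_i \prod_(j | j != i) gr w ('X_i - (c i j)%:MP * 'X_j).
Proof. by rewrite /Xpair /pair_prod rmorph_prod; apply: eq_bigr => i _; rewrite rmorph_prod. Qed.

Lemma gr_Xpair_nz : gr w (Xpair c) != 0.
Proof.
rewrite gr_Xpair; apply/prodf_neq0 => i _; apply/prodf_neq0 => j ne.
by apply: gr_nz; rewrite eq_sym.
Qed.

Lemma size_gr_Xpair : size (gr w (Xpair c)) =
  size (\prod_(i < N) \prod_(j < N | j != i) 'X^(maxn (w i) (w j)) : {poly P}).
Proof.
rewrite gr_Xpair; apply: prod_same_size => i _; first by apply/prodf_neq0 => j ne; apply: gr_nz; rewrite eq_sym.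
apply: prod_same_size => j ne; first by apply: gr_nz; rewrite eq_sym.
by rewrite eq_sym in ne; have [-> _ _] := gr_binomial w (c0 i j) ne; rewrite size_polyXn.
Qed.

Lemma lead_gr_Xpair : (forall i j : 'I_N, (i < j)%N -> (w j < w i)%N) ->
  lead_coef (gr w (Xpair c)) =
    \prod_(i < N) \prod_(j < N | j != i) (if (i < j)%N then 'X_i else - c i j *: 'X_j).
Proof.
move=> dec; rewrite gr_Xpair lead_coef_prod; apply: eq_bigr => i _.
rewrite lead_coef_prod; apply: eq_bigr => j ne; rewrite eq_sym in ne.
have [_ l1 l2] := gr_binomial w (c0 i j) ne; case: ltngtP => [lt|gt|/val_inj E].
- by rewrite l1 ?dec.
- by rewrite l2 ?dec.
- by rewrite E eqxx in ne.
Qed.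
End Xpair.

(** For decreasing weights, x_k - t x_j leads with - t x_j exactly when j < k, so row k contributes
    k factors t. *)
Lemma lead_only_row w (t : F) k : t != 0 -> (forall i j : 'I_N, (i < j)%N -> (w j < w i)%N) ->
  lead_coef (gr w (Xpair (only_row t k))) = t ^+ k *: lead_coef (gr w (Xpair (fun _ _ => 1))).
Proof.
move=> t0 dec.
have ck (i j : 'I_N) : only_row t k i j != 0 by rewrite /only_row; case: ifP => // _; exact: oner_neq0.
have c1 (i j : 'I_N) : (1 : F) != 0 by exact: oner_neq0.
have e1 := lead_gr_Xpair (c := fun _ _ => 1) c1 dec.
have ek := lead_gr_Xpair ck dec.
apply: (etrans ek); apply: (etrans _ (congr1 ( *:%R (t ^+ k)) (esym e1))) => {ek e1}.
rewrite (bigD1 k) //= [in RHS](bigD1 k) //= scalerAl; congr (_ * _); last first.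
  apply: eq_bigr => i ne; apply: eq_bigr => j _.
  by rewrite /only_row (negbTE ne).
rewrite (eq_bigr (fun j : 'I_N => (if (j < k)%N then t else 1) *: (if (k < j)%N then 'X_k else - 1 *: 'X_j))).
  rewrite scaler_prod; congr (_ *: _); rewrite -big_mkcondr prodr_const; congr (_ ^+ _).
  rewrite (eq_card (B := [pred j : 'I_N | (j < k)%N])); last first.
    by move=> j; rewrite !unfold_in /= andb_idl // => /ltn_eqF; rewrite -val_eqE => /= ->.
  by rewrite -sum1_card -(big_ord_widen _ (fun=> 1%N) (ltnW (ltn_ord k))) sum1_card card_ord.
move=> j ne; case: ltngtP => [lt|gt|/val_inj E].
- by rewrite scale1r.
- by rewrite /only_row eqxx scalerA mulrN1.
- by rewrite E eqxx in ne.
Qed.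

Lemma coefM_top (A B : {poly P}) d e : (size A <= d.+1)%N -> (size B <= e.+1)%N ->
  (A * B)`_(d + e) = A`_d * B`_e.
Proof.
move=> sA sB; have lt : (d < (d + e).+1)%N by rewrite ltnS leq_addr.
rewrite coefM (bigD1 (Ordinal lt)) //= addKn big1 ?addr0 // => i ne.
have [le|gt] := leqP i d; last by rewrite (nth_default _ (leq_trans sA gt)) mul0r.
rewrite [B`__]nth_default ?mulr0 //; apply: leq_trans sB _.
have : nat_of_ord i != d by []; lia.
Qed.

End Grading.

(** * Macdonald's difference operator in N variables *)

Section FiniteVariables.
Variable F : fieldType.
Hypothesis char0 : forall n, n.+1%:R != 0 :> F.
Local Notation Lam := (symfun F).
Local Notation p := (power_sum F).
Variables q t : F.
Hypothesis t0 : t != 0.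

(** At y = x_i, the shift by q^k - 1 replaces x_i by q x_i in each p_k, while the exponential for 1
    - t^k is prod_i (1 - t x_i z) / (1 - x_i z). Partial fractions of the latter turn the vertex
    operator into a sum of q-shifts. *)
Definition aE (k : nat) := q ^+ k - 1.
Definition bE (k : nat) := 1 - t ^+ k.

Variable N : nat.
Local Notation P := {mpoly F[N]}.
Local Notation X := (fun i : 'I_N => 'X_i : P).
Local Notation V := (Xpair (fun _ _ : 'I_N => 1 : F)).
Local Notation U k := (Xpair (only_row t k)).
Definition qshift (i : 'I_N) : P -> P := rescale (fun j => if j == i then q else 1).
HB.instance Definition _ i := GRing.RMorphism.on (qshift i).

Lemma Xpair1E : V = pair_prod X (fun _ _ => 1).
Proof. by apply: eq_bigr => i _; apply: eq_bigr => j _; rewrite mpolyC1. Qed.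

Lemma Xpair_rowE k : U k = pair_prod X (only_row t%:MP k).
Proof.
apply: eq_bigr => i _; apply: eq_bigr => j _; rewrite /only_row.
by case: ifP => // _; rewrite mpolyC1.
Qed.

Lemma at_vars_hexpE j : at_vars N (hexp bE j) =
  (\prod_i ((1 - seriesC (t%:MP * 'X_i) * seriesX) * geom 'X_i) : series P) j.
Proof.
have n1 := newton_smap (at_vars N : {rmorphism Lam -> P}) (newton_hexp char0 bE).
have n2 : newton (\sum_(i < N) (- powers (t%:MP * 'X_i) + powers 'X_i) : series P)
    (\prod_(i < N) ((1 - seriesC (t%:MP * 'X_i) * seriesX) * geom 'X_i)).
  by apply: newton_prod => i; apply: newton_mul; [exact: newton_lin | exact: newton_geom].
have E : (\sum_(i < N) (- powers (t%:MP * 'X_i) + powers 'X_i) : series P) = smap (at_vars N) (pseries bE).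
  apply: series_ext => -[|k]; rewrite series_sumE /smap /pseries.
    by rewrite power_sum0 scaler0 rmorph0 big1 // => i _; rewrite seriesDE seriesNE /= oppr0 addr0.
  rewrite -[RHS]/(bE k.+1 *: at_vars N (p k.+1)) at_vars_power_sum // scaler_sumr.
  apply: eq_bigr => i _; rewrite seriesDE seriesNE /powers /bE scalerBl scale1r addrC exprMn.
  by rewrite -(rmorphXn (@mpolyC N F) k.+1 t) /= mul_mpolyC.
rewrite E in n2; have := newton_uniq (lmod_torsion_free char0 (V := P)) n1 n2.
by move=> /(congr1 (fun f : series P => f j)).
Qed.

Lemma sum_sh_qshift f n i : (size (shift aE f) <= n)%N ->
  \sum_(j < n) at_vars N (sh aE j f) * 'X_i ^+ j = qshift i (at_vars N f).
Proof.
move=> sn; pose phi : {rmorphism Lam -> P} := horner_eval ('X_i : P) \o map_poly (at_vars N) \o shift aE.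
pose psi : {rmorphism Lam -> P} := qshift i \o at_vars N.
transitivity (phi f).
  rewrite /phi /= /horner_eval (@horner_coef_wide _ n); last exact: leq_trans (size_poly _ _) sn.
  by apply: eq_bigr => j _; rewrite coef_map.
apply: (symfun_hom_eq char0 (phi := phi) (psi := psi)) => [c|k k0].
  rewrite /phi /psi /= (shift_spec char0 _).1 rmorph1 mulr1 /= map_polyC /= /horner_eval hornerC.
  have -> : (c%:A : P) = c%:MP by rewrite -mul_mpolyC mulr1.
  by rewrite /qshift rescaleC.
rewrite /phi /psi /= (shift_spec char0 _).2 // rmorphD rmorphM /= !map_polyC map_polyXn /=.
rewrite /horner_eval !hornerE.
rewrite [power_sum_poly F k N](at_vars_power_sum F N k0) rmorph_sum /=.
rewrite (bigD1 i) //= [in RHS](bigD1 i) //= !rmorphXn /= /qshift !rescaleX eqxx.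
rewrite exprZn /aE; rewrite [in RHS](eq_bigr (fun j => 'X_j ^+ k)); last first.
  by move=> j ne; rewrite rmorphXn /= rescaleX (negbTE ne) scale1r.
rewrite mulr_algl scalerBl scale1r; ring.
Qed.

(* Macdonald's difference operator \sum_i (U_i / V) (T_i - 1), with T_i : x_i |-> q x_i,
   after clearing denominators. *)
Lemma at_vars_vop f : V * at_vars N (vop aE bE 0 f) =
  V * at_vars N f + (1 - t) *: \sum_i U i * (qshift i (at_vars N f) - at_vars N f).
Proof.
have Xinj : injective X.
  move=> i j /(congr1 (mcoeff U_(i))); rewrite !mcoeffX eqxx; case: eqP => [E _|_ /eqP]; last by rewrite oner_eq0.
  by have := congr1 (fun m : 'X_{1..N} => m i) E; rewrite !mnm1E eqxx; case: eqP.
rewrite (@vopE _ _ _ _ _ (size (shift aE f)).+1) // (rmorph_sum (at_vars N)) big_ord_recl.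
rewrite mulrDr; congr (_ * _ + _).
  by rewrite (hexp0 char0 _ : hexp bE (0 + ord0) = 1) mulr1 sh0.
rewrite mulr_sumr; transitivity (\sum_(j < size (shift aE f)) \sum_i
   ((1 - t) *: (U i * (at_vars N (sh aE (lift ord0 j) f) * 'X_i ^+ lift ord0 j)))).
  apply: eq_bigr => j _.
  rewrite -[LHS]/(V * (at_vars N (sh aE (lift ord0 j) f) * at_vars N (hexp bE (0 + lift ord0 j)))).
  rewrite at_vars_hexpE mulrCA Xpair1E.
  rewrite (partial_fractions _ Xinj) // mulrCA mulr_sumr mulr_sumr; apply: eq_bigr => i _.
  rewrite -Xpair_rowE -mul_mpolyC mpolyCB mpolyC1; ring.
rewrite exchange_big scaler_sumr; apply: eq_bigr => i _ /=.
(* The sum starts at j = 1; the missing term, sh_0 f = f, is what T_i - 1 subtracts. *)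
rewrite -scaler_sumr -mulr_sumr -(sum_sh_qshift _ (leqnSn _)) big_ord_recl /= sh0 // expr0 mulr1.
by rewrite [X in _ = _ *: (_ * (X - _))]addrC addrK.
Qed.

Lemma coef_gr_qshift w i (f : P) d : (gr w (qshift i f))`_d = qshift i (gr w f)`_d.
Proof.
apply/mpolyP => m; rewrite coef_gr !mcoeff_rescale coef_gr.
by case: ifP; rewrite ?mulr0.
Qed.

Let rhs w (f : P) := gr w V * gr w f + (1 - t)%:MP%:P *
   \sum_i gr w (U i) * (gr w (qshift i f) - gr w f).

Let gr_vop w f : gr w V * gr w (at_vars N (vop aE bE 0 f)) = rhs w (at_vars N f).
Proof.
rewrite -rmorphM at_vars_vop rmorphD rmorphM; congr (_ + _).
rewrite -mul_mpolyC rmorphM; congr (_ * _); first exact: grC.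
by rewrite rmorph_sum; apply: eq_bigr => i _; rewrite rmorphM rmorphB.
Qed.

Let c1 (i j : 'I_N) : (1 : F) != 0. Proof. exact: oner_neq0. Qed.
Let ck k (i j : 'I_N) : only_row t k i j != 0.
Proof. by rewrite /only_row; case: ifP => // _; exact: oner_neq0. Qed.

Let sizeU w k : size (gr w (U k)) = size (gr w V).
Proof. exact: (etrans (size_gr_Xpair w (ck k)) (esym (size_gr_Xpair w c1))). Qed.

Let V0 w : gr w V != 0. Proof. exact: (gr_Xpair_nz w c1). Qed.

(** In [gr_vop], V and the U_i have the same degree in u and the q-shifts preserve weights;
    cancelling V shows that the operator raises no weight. *)
Lemma size_gr_vop w f d : (size (gr w (at_vars N f)) <= d.+1)%N ->
  (size (gr w (at_vars N (vop aE bE 0 f))) <= d.+1)%N.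
Proof.
move=> sf; have [->|g0] := eqVneq (gr w (at_vars N (vop aE bE 0 f))) 0; first by rewrite size_poly0.
have szV : (0 < size (gr w V))%N by rewrite lt0n size_poly_eq0 V0.
have szT i : (size (gr w (qshift i (at_vars N f)) - gr w (at_vars N f))%R <= d.+1)%N.
  apply/leq_sizeP => j dj; rewrite coefB coef_gr_qshift.
  by rewrite (nth_default _ (leq_trans sf dj)) rmorph0 subrr.
have : (size (rhs w (at_vars N f)) <= size (gr w V) + d)%N.
  rewrite /rhs (leq_trans (size_polyD _ _)) // geq_max; apply/andP; split.
    by rewrite (leq_trans (size_polyMleq _ _)) //; lia.
  rewrite mul_polyC (leq_trans (size_scale_leq _ _)) //.
  rewrite (leq_trans (size_sum _ _ _)) //; apply/bigmax_leqP => i _.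
  rewrite (leq_trans (size_polyMleq _ _)) // sizeU; have := szT i; lia.
rewrite -gr_vop size_mul //; move: szV; set u := size (gr w V); set v := size _.
clearbody u v; lia.
Qed.

Lemma mcoeff_gr_top w (f : P) d m : wt w m = d ->
  (forall m', f@_m' != 0 -> wt w m' = d -> m' = m) -> (gr w f)`_d = f@_m *: 'X_[m].
Proof.
move=> wm top; apply/mpolyP => m'; rewrite coef_gr mcoeffZ mcoeffX.
have [<-|ne] := eqVneq m m'; first by rewrite wm eqxx mulr1.
rewrite mulr0; case: eqP => // /eqP wm'; apply/eqP; apply: contraNT ne => nz.
by rewrite (top m') //; apply/eqP.
Qed.

(** Compare the coefficients of u^(e + d): the leading coefficient of U_i is t^i times that of V,
    and the i-th q-shift multiplies x^m by q^(m_i). *)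
Lemma vop_top_coef w (f : Lam) d (m : 'X_{1..N}) :
    (forall i j : 'I_N, (i < j)%N -> (w j < w i)%N) -> wt w m = d ->
    (size (gr w (at_vars N f)) <= d.+1)%N ->
    (forall m', (at_vars N f)@_m' != 0 -> wt w m' = d -> m' = m) ->
    (forall m', (at_vars N (vop aE bE 0 f))@_m' != 0 -> wt w m' = d -> m' = m) ->
  (at_vars N (vop aE bE 0 f))@_m =
    (1 + (1 - t) * \sum_(i < N) t ^+ i * (q ^+ m i - 1)) * (at_vars N f)@_m.
Proof.
move=> dec wm sf topf topg; have sg := size_gr_vop sf.
have szV : (0 < size (gr w V))%N by rewrite lt0n size_poly_eq0 V0.
pose e := (size (gr w V)).-1.
have sV : (size (gr w V) <= e.+1)%N by rewrite prednK.
have szT i : (size (gr w (qshift i (at_vars N f)) - gr w (at_vars N f))%R <= d.+1)%N.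
  apply/leq_sizeP => j dj; rewrite coefB coef_gr_qshift.
  by rewrite (nth_default _ (leq_trans sf dj)) rmorph0 subrr.
have /(congr1 (fun A : {poly P} => A`_(e + d))) := gr_vop w f.
rewrite (coefM_top sV sg) /rhs coefD (coefM_top sV sf) coefCM coef_sum.
have EU i : (gr w (U i) * (gr w (qshift i (at_vars N f)) - gr w (at_vars N f)))`_(e + d) =
    ((t ^+ i * (q ^+ m i - 1)) * (at_vars N f)@_m) *: ((gr w V)`_e * 'X_[m]).
  have sU : (size (gr w (U i)) <= e.+1)%N by rewrite sizeU.
  rewrite (coefM_top sU (szT i)) coefB coef_gr_qshift (mcoeff_gr_top wm topf).
  have -> : (gr w (U i))`_e = t ^+ i *: (gr w V)`_e.
    have := lead_only_row i t0 dec; rewrite /lead_coef sizeU; exact.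
  have -> : qshift i ((at_vars N f)@_m *: 'X_[m]) = (q ^+ m i * (at_vars N f)@_m) *: 'X_[m].
    apply/mpolyP => m'; rewrite mcoeff_rescale !mcoeffZ mcoeffX.
    case: eqP => [<-|]; last by rewrite !mulr0.
    rewrite (bigD1 i) //= eqxx big1 ?mulr1 // => j ne.
    by rewrite (negbTE ne) expr1n.
  rewrite -scalerBl -scalerAl -scalerAr !scalerA; congr (_ *: _); ring.
rewrite (eq_bigr _ (fun i _ => EU i)) (mcoeff_gr_top wm topf) (mcoeff_gr_top wm topg).
rewrite mul_mpolyC -scaler_suml scalerA -!scalerAr -scalerDl => /eqP.
rewrite -subr_eq0 -scalerBl scaler_eq0 => /orP[|]; last first.
  rewrite mulf_eq0 -[_`_e]/(lead_coef _) lead_coef_eq0 (negbTE (V0 w)) /= => /eqP.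
  by move=> /(congr1 (mcoeff m)); rewrite mcoeffX eqxx mcoeff0 => /eqP; rewrite oner_eq0.
rewrite subr_eq0 => /eqP->; rewrite -mulr_suml; ring.
Qed.

End FiniteVariables.

(** * Dominance order *)

Section Dominance.
Implicit Types la mu nu s r : seq nat.

(** The first k entries of a decreasing sequence have the largest sum. The induction removes the
    largest entry from [r] if it is there, and otherwise trades it for the first entry of [r]. *)
Lemma sumn_take_sub k mu r r' : sorted geq mu -> (size r <= k)%N -> perm_eq (r ++ r') mu ->
  (sumn r <= sumn (take k mu))%N.
Proof.
elim: mu k r r' => [|x mu IH] k r r' smu rk pm.
  have := perm_size pm; rewrite size_cat /= => /eqP; rewrite addn_eq0 size_eq0 => /andP[/eqP-> _].
  by [].
have xmax y : y \in r ++ r' -> (y <= x)%N.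
  rewrite (perm_mem pm) inE => /orP[/eqP->//|ymu]; move: smu => /=.
  by rewrite (path_sortedE (leT := geq)) => [/andP[/allP/(_ _ ymu)]|a b c /=]; last by lia.
have smu' : sorted geq mu by exact: path_sorted smu.
case: r rk pm xmax => [//|y r] /= rk pm xmax; case: k rk => // k rk /=.
have [xr|xr] := boolP (x \in y :: r).
  have p1 : perm_eq (y :: r) (x :: rem x (y :: r)) by exact: perm_to_rem.
  rewrite -[(y + sumn r)%N]/(sumn (y :: r)) (perm_sumn p1) /= leq_add2l.
  apply: (IH _ _ r') => //; first by have := perm_size p1; rewrite /=; case: ifP => /=; lia.
  by rewrite -(perm_cons x) -cat_cons -(permPl (perm_cat p1 (perm_refl r'))).
have xr' : x \in r'.
  have : x \in (y :: r) ++ r' by rewrite (perm_mem pm) mem_head.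
  by rewrite mem_cat (negbTE xr).
apply: leq_add; first by apply: xmax; rewrite mem_head.
apply: (IH _ _ (y :: rem x r')) => //.
rewrite -(perm_cons x) -(permPr pm) -[y :: r ++ r']/((y :: r) ++ r').
rewrite (permPr (perm_cat (perm_refl _) (perm_to_rem xr'))) /=.
rewrite -cat1s perm_catC -catA /= -[y :: _ ++ _]cat1s.
by apply/seq.permP => a /=; rewrite !count_cat /= !count_cat /=; lia.
Qed.

Lemma wt_take N k (m : 'X_{1..N}) : wt (fun i => (i < k)%N : nat) m = sumn (take k m).
Proof.
have E s : sumn (take k s) = (\sum_(i < size s) nth 0 s i * (i < k)%N)%N.
  elim: s k => [|x s IH] [|k] //=; rewrite ?big_ord0 //.
    by rewrite big1 // => i _; rewrite muln0.
  by rewrite big_ord_recl /= muln1 IH.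
rewrite E size_tuple /wt; apply: eq_bigr => i _.
by rewrite -mnm_nth.
Qed.

(** Adding up the partial sums that define dominance yields strictly decreasing weights, as required
    by [lead_only_row]. *)
Lemma wt_strict N (m : 'X_{1..N}) :
  wt (fun i => N - i)%N m = (\sum_(k < N) sumn (take k.+1 m))%N.
Proof.
rewrite /wt; under [RHS]eq_bigr => k _ do rewrite -wt_take /wt.
rewrite exchange_big /=; apply: eq_bigr => i _; rewrite -big_distrr /=; congr (_ * _)%N.
rewrite -[LHS]card_ord -sum1_card.
have := big_ord_widen_cond N (fun k => true) (fun=> 1%N) (leq_subr i N).
move=> /= ->; rewrite big_mkcond (reindex_inj rev_ord_inj) /=; apply: eq_bigr => k _ /=.
have lk := ltn_ord k; have li := ltn_ord i.
by case: ltnP => H1; case: ltnP => H2 //; lia.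
Qed.

Lemma eq_sumn_take s s' : size s = size s' ->
  (forall k, (k < size s)%N -> sumn (take k.+1 s) = sumn (take k.+1 s')) -> s = s'.
Proof.
move=> sz E; have E' k : (k <= size s)%N -> sumn (take k s) = sumn (take k s').
  by case: k => [|k] lt; [rewrite !take0 | exact: E].
apply: (@eq_from_nth _ 0%N) => // i lt; have := E i lt; rewrite (take_nth 0%N) // (take_nth 0%N) -?sz //.
by rewrite !sumn_rcons (E' i (ltnW lt)) => /addnI.
Qed.

Lemma partition_size la : is_partition la -> (size la <= sumn la)%N.
Proof.
case/andP => _; elim: la => //= x la IH; rewrite inE negb_or eq_sym -lt0n => /andP[x0 /IH].
lia.
Qed.

Lemma eq_partition_take la mu : 0%N \notin la -> 0%N \notin mu ->
  (forall k, sumn (take k la) = sumn (take k mu)) -> la = mu.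
Proof.
elim: la mu => [|x la IH] [|y mu] //=; rewrite ?inE ?negb_or.
- by move=> _ /andP[y0 _] /(_ 1%N) /=; rewrite take0 addn0 => E; rewrite E eqxx in y0.
- by move=> /andP[x0 _] _ /(_ 1%N) /=; rewrite take0 addn0 => E; rewrite E eqxx in x0.
move=> /andP[_ la0] /andP[_ mu0] E; have := E 1%N; rewrite /= !take0 !addn0 => xy.
by rewrite xy (IH mu) // => k; have := E k.+1; rewrite /= xy => /addnI.
Qed.

Lemma dominatedP la mu : is_partition la -> is_partition mu ->
  reflect (sumn la = sumn mu /\ forall k, (sumn (take k la) <= sumn (take k mu))%N) (dominated la mu).
Proof.
move=> pla pmu; apply: (iffP andP) => [[/eqP E /allP H]|[-> H]]; last by split=> //; apply/allP.
split=> // k.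
have [kn|nk] := leqP k (sumn la); first by apply: H; rewrite mem_iota ltnS.
rewrite !take_oversize ?E //; last exact: leq_trans (partition_size pla) (ltnW nk).
by apply: leq_trans (partition_size pmu) _; rewrite -E ltnW.
Qed.

(** A numerical rank that refines dominance. *)
Definition dom_rank mu := (\sum_(k < (sumn mu).+1) sumn (take k mu))%N.

Lemma dom_rank_lt la mu : is_partition la -> is_partition mu -> dominated la mu -> la != mu ->
  (dom_rank la < dom_rank mu)%N.
Proof.
move=> pla pmu /(dominatedP pla pmu)[E H] ne; rewrite /dom_rank E.
have L : (\sum_(k < (sumn mu).+1) sumn (take k la) <= \sum_(k < (sumn mu).+1) sumn (take k mu)
   ?= iff [forall (k : 'I_(sumn mu).+1 | true), sumn (take k la) == sumn (take k mu)])%N.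
  by apply: leqif_sum => k _; apply/leqif_eq.
rewrite ltn_neqAle L.1 andbT L.2; apply: contra ne => /forall_inP A; apply/eqP.
case/andP: (pla) (pmu) => _ la0 /andP[_ mu0]; apply: eq_partition_take => // k.
have [kn|nk] := leqP k (sumn mu); first by apply/eqP/(A (Ordinal (kn : (k < (sumn mu).+1)%N))).
rewrite !take_oversize //; first exact: leq_trans (partition_size pmu) (ltnW nk).
by apply: leq_trans (partition_size pla) _; rewrite E ltnW.
Qed.

Lemma dominated_trans la mu nu : is_partition la -> is_partition mu -> is_partition nu ->
  dominated la mu -> dominated mu nu -> dominated la nu.
Proof.
move=> pla pmu pnu /(dominatedP pla pmu)[E H] /(dominatedP pmu pnu)[E' H'].
by apply/dominatedP => //; split=> [|k]; [rewrite E | exact: leq_trans (H k) (H' k)].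
Qed.

End Dominance.

Section Triangularity.
Variable F : fieldType.
Hypothesis char0 : forall n, n.+1%:R != 0 :> F.
Local Notation Lam := (symfun F).
Local Notation p := (power_sum F).

Lemma natr_inj m n : m%:R = n%:R :> F -> m = n.
Proof.
wlog le : m n / (m <= n)%N => [H E|].
  by case/orP: (leq_total m n) => le; [exact: H | apply/esym/H].
move/esym/eqP; rewrite -subr_eq0 -natrB //; case E : (n - m)%N => [|k]; last by rewrite (negbTE (char0 k)).
by move=> _; apply/eqP; rewrite eqn_leq le -subn_eq0 E.
Qed.

Lemma coefm_grading (r : F) (f : Lam) la :
  coefm (scale_power_sums (fun k => r ^+ k) f) la = r ^+ sumn la * coefm f la.
Proof.
pose N := size la.
pose phi : {rmorphism Lam -> {mpoly F[N]}} := at_vars N \o scale_power_sums (fun k => r ^+ k).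
pose psi : {rmorphism Lam -> {mpoly F[N]}} := rescale (fun=> r) \o at_vars N.
have E : phi f = psi f.
  apply: (symfun_hom_eq char0) => [c|k k0]; rewrite /phi /psi /=.
    rewrite linearZ rmorph1 /=; have -> : (c%:A : {mpoly F[N]}) = c%:MP by rewrite -mul_mpolyC mulr1.
    by rewrite rescaleC.
  rewrite scale_power_sumsE // -[LHS]/(r ^+ k *: at_vars N (p k)) at_vars_power_sum //.
  rewrite [power_sum_poly F k N](at_vars_power_sum F N k0) rmorph_sum scaler_sumr.
  by apply: eq_bigr => i _; rewrite rmorphXn /= rescaleX exprZn.
rewrite /coefm -[(scale_power_sums _ f) _]/(phi f) E mcoeff_rescale; congr (_ * _).
by rewrite prodrXr -mdegE mdeg_sumn.
Qed.

Variables q t : F.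
Hypothesis t0 : t != 0.
Local Notation E := (vop (aE q) (bE t) 0).

Lemma grading_vop f (r : F) : scale_power_sums (fun k => r ^+ k) (E f) = E (scale_power_sums (fun k => r ^+ k) f).
Proof.
rewrite (@vop_scale F char0 _ _ (aE q) (bE t) _ r) ?expr0 ?scale1r // => k _.
by rewrite mulrC.
Qed.

(** The operator commutes with p_k -> 2^k p_k, which acts on degree n by 2^n; in characteristic 0
    these scalars separate the degrees. *)
Lemma coefm_vop_monomial_sumn la mu : is_partition mu ->
  coefm (E (monomial_sf F mu)) la != 0 -> sumn la = sumn mu.
Proof.
move=> pmu nz.
have := coefm_grading 2%:R (E (monomial_sf F mu)) la; rewrite grading_vop.
have -> : scale_power_sums (fun k => 2%:R ^+ k) (monomial_sf F mu) = 2%:R ^+ sumn mu *: monomial_sf F mu.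
  apply: symfun_coefm_ext => nu pnu; rewrite coefm_grading coefmZ coefm_monomial //.
  by case: eqP => [->|]; rewrite ?mulr1 ?mulr0.
rewrite vopZ // coefmZ => /(mulIf nz); rewrite -!natrX => /natr_inj /eqP.
by rewrite eqn_exp2l // eq_sym => /eqP.
Qed.

Lemma monomial_support N mu k (m : 'X_{1..N}) : is_partition mu ->
  (at_vars N (monomial_sf F mu))@_m != 0 -> (sumn (take k m) <= sumn (take k mu))%N.
Proof.
move=> pmu; rewrite /at_vars mcoeff_coefm coefm_monomial ?partition_geq_sort //.
case: (sort _ _ =P mu) => [Em _|_]; last by rewrite eqxx.
have Es (s : seq nat) : sumn s = sumn [seq j <- s | j != 0%N].
  by elim: s => //= j s ->; case: eqP => [->|].
rewrite (Es (take k m)); apply: (@sumn_take_sub _ _ _ [seq j <- drop k m | j != 0%N]).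
- by case/andP: pmu.
- by rewrite size_filter (leq_trans (count_size _ _)) // size_take; case: ltnP.
by rewrite -filter_cat cat_take_drop -Em perm_sym perm_sort.
Qed.

(** Apply [size_gr_vop] with weight 1 on the first k variables and 0 on the others: the weight is
    then a partial sum of exponents. *)
Lemma vop_monomial_support N mu k (m : 'X_{1..N}) : is_partition mu ->
  (at_vars N (E (monomial_sf F mu)))@_m != 0 -> (sumn (take k m) <= sumn (take k mu))%N.
Proof.
move=> pmu nz; rewrite leqNgt; apply: contra nz => lt.
have sz : (size (gr (fun i => (i < k)%N : nat) (at_vars N (monomial_sf F mu))) <= (sumn (take k mu)).+1)%N.
  by apply: size_gr => m' nz; rewrite wt_take; exact: monomial_support nz.
have := size_gr_vop char0 q t0 sz => /leq_sizeP/(_ (sumn (take k m)) lt).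
by move/(congr1 (mcoeff m)); rewrite coef_gr wt_take eqxx mcoeff0 => ->.
Qed.

Definition mac_eigenvalue mu : F := 1 + (1 - t) * \sum_(i < size mu) t ^+ i * (q ^+ nth 0%N mu i - 1).

Lemma vop_dominated la mu : is_partition la -> is_partition mu ->
  coefm (E (monomial_sf F mu)) la != 0 -> dominated la mu.
Proof.
move=> pla pmu nz; apply/dominatedP => //; split; first exact: coefm_vop_monomial_sumn nz.
by move=> k; apply: (vop_monomial_support (m := Multinom (in_tuple la)) k pmu nz).
Qed.

Lemma vop_diag mu : is_partition mu -> coefm (E (monomial_sf F mu)) mu = mac_eigenvalue mu.
Proof.
move=> pmu; pose N := size mu; pose w (i : 'I_N) := (N - i)%N; pose m := Multinom (in_tuple mu).
have Em k : sumn (take k m) = sumn (take k mu) by [].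
have dec (i j : 'I_N) : (i < j)%N -> (w j < w i)%N by rewrite /w; have := ltn_ord j; lia.
(* If all partial sums are bounded by those of mu, then the weight is maximal only where they are
   all equal, that is, only at the exponent mu. *)
have top (f : Lam) : (forall N m k, (at_vars N f)@_m != 0 -> (sumn (take k m) <= sumn (take k mu))%N) ->
    forall m', (at_vars N f)@_m' != 0 -> (wt w m' <= wt w m)%N /\ (wt w m' = wt w m -> m' = m).
  move=> H m' nz; rewrite !wt_strict.
  have L : (\sum_(k < N) sumn (take k.+1 m') <= \sum_(k < N) sumn (take k.+1 m)
     ?= iff [forall (k : 'I_N | true), sumn (take k.+1 m') == sumn (take k.+1 m)])%N.
    by apply: leqif_sum => k _; apply/leqif_eq; exact: H nz.
  split=> [|/eqP]; first exact: L.
  rewrite L.2 => /forall_inP A; apply: val_inj; apply: val_inj.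
  apply: eq_sumn_take => [|k]; first by rewrite !size_tuple.
  by rewrite size_tuple => lt; exact/eqP/(A (Ordinal lt)).
have topf := top _ (fun N m k => @monomial_support N mu k m pmu).
have topg := top _ (fun N m k => @vop_monomial_support N mu k m pmu).
have sf : (size (gr w (at_vars N (monomial_sf F mu))) <= (wt w m).+1)%N.
  by apply: size_gr => m' /topf[].
have := @vop_top_coef _ char0 q t t0 N w _ _ m dec erefl sf (fun m' nz => (topf m' nz).2) (fun m' nz => (topg m' nz).2).
rewrite -[(at_vars N (monomial_sf F mu))@_m]/(coefm _ mu) coefm_monomial // eqxx mulr1.
rewrite -[LHS]/(coefm _ mu) => ->; rewrite /mac_eigenvalue; congr (_ + _ * _).
by apply: eq_bigr => i _; rewrite (mnm_nth 0%N).
Qed.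

End Triangularity.

(** * Macdonald polynomials as eigenvectors *)

Section TriangularOperators.
Variable F : fieldType.
Hypothesis char0 : forall n, n.+1%:R != 0 :> F.
Local Notation Lam := (symfun F).
Local Notation msf := (monomial_sf F).
Implicit Types (f g : Lam) (la mu nu : seq nat).

Definition low mu f :=
  forall la, is_partition la -> coefm f la != 0 -> dominated la mu /\ la != mu.

Lemma low0 mu : low mu 0.
Proof. by move=> la _; rewrite coefm0 eqxx. Qed.
Lemma lowD mu f g : low mu f -> low mu g -> low mu (f + g).
Proof.
move=> lf lg la pla; rewrite coefmD; have [->|nz _] := eqVneq (coefm f la) 0; last exact: lf.
by rewrite add0r; exact: lg.
Qed.
Lemma lowZ mu (c : F) f : low mu f -> low mu (c *: f).
Proof. by move=> lf la pla; rewrite coefmZ mulf_eq0 negb_or => /andP[_]; exact: lf. Qed.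

Lemma low_expand mu f : is_partition mu -> low mu f ->
  f = \sum_(la <- partitions (sumn mu) | dominated la mu && (la != mu)) coefm f la *: msf la.
Proof.
move=> pmu lf; apply: symfun_coefm_ext => la pla; rewrite coefm_sum big_seq_cond.
have E nu : (nu \in partitions (sumn mu)) && (dominated nu mu && (nu != mu)) ->
    coefm (coefm f nu *: msf nu) la = if la == nu then coefm f la else 0.
  rewrite mem_partitions => /andP[/andP[pnu _] _]; rewrite coefmZ coefm_monomial //.
  by case: eqP => [->|]; rewrite ?mulr1 ?mulr0.
rewrite (eq_bigr _ E) -big_seq_cond.
have [Pla|nPla] := boolP (dominated la mu && (la != mu)).
  rewrite [RHS]big_mkcond [RHS](bigD1_seq la) ?partitions_uniq //=; last first.
    by rewrite mem_partitions pla; case/andP: Pla => /andP[].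
  by rewrite Pla eqxx big1 ?addr0 // => nu ne; rewrite [la == _]eq_sym (negbTE ne) if_same.
rewrite big1 => [|nu Pnu].
  by apply/eqP; apply: contraNT nPla => /lf[] // -> ->.
by case: eqP => // E'; rewrite E' Pnu in nPla.
Qed.

Lemma low_sum mu f (Q : Lam -> Prop) : is_partition mu -> low mu f -> Q 0 ->
    (forall f g, Q f -> Q g -> Q (f + g)) -> (forall (c : F) f, Q f -> Q (c *: f)) ->
    (forall la, is_partition la -> dominated la mu -> la != mu -> Q (msf la)) -> Q f.
Proof.
move=> pmu lf Q0 QD QZ Qm; rewrite (low_expand pmu lf) big_seq_cond.
elim/big_ind: _ => // la; rewrite mem_partitions => /andP[/andP[pla _] /andP[d ne]].
by apply: QZ; exact: Qm.
Qed.

Section Operator.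
Variables (E : Lam -> Lam) (ev : seq nat -> F).
Hypothesis ED : forall f g, E (f + g) = E f + E g.
Hypothesis EZ : forall (c : F) f, E (c *: f) = c *: E f.
Hypothesis E_tri : forall la mu, is_partition la -> is_partition mu ->
  coefm (E (msf mu)) la != 0 -> dominated la mu.
Hypothesis E_diag : forall mu, is_partition mu -> coefm (E (msf mu)) mu = ev mu.

Lemma E_low mu : is_partition mu -> low mu (E (msf mu) - ev mu *: msf mu).
Proof.
move=> pmu la pla; rewrite coefmB coefmZ coefm_monomial //; case: (la =P mu) => [->|/eqP ne].
  by rewrite mulr1 E_diag // subrr eqxx.
by rewrite mulr0 subr0 => nz; split=> //; exact: E_tri nz.
Qed.

Lemma E0 : E 0 = 0. Proof. by have := EZ 0 0; rewrite !scale0r. Qed.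
Lemma EB f g : E (f - g) = E f - E g. Proof. by rewrite -scaleN1r ED EZ scaleN1r. Qed.

(** On the span of the m_la below mu, E - ev mu is triangular with diagonal entries ev la - ev mu,
    which do not vanish; hence it is onto. *)
Lemma solve_low mu f : (forall la, is_partition la -> la != mu -> ev la != ev mu) ->
  is_partition mu -> low mu f -> exists2 g, low mu g & E g - ev mu *: g = f.
Proof.
move=> ev_ne pmu lf; pose S f := exists2 g, low mu g & E g - ev mu *: g = f.
have S0 : S 0 by exists 0; [exact: low0 | rewrite E0 scaler0 subrr].
have SD f1 f2 : S f1 -> S f2 -> S (f1 + f2).
  move=> [g1 l1 <-] [g2 l2 <-]; exists (g1 + g2); first exact: lowD.
  by rewrite ED scalerDr opprD addrACA.
have SZ (c : F) f1 : S f1 -> S (c *: f1).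
  move=> [g1 l1 <-]; exists (c *: g1); first exact: lowZ.
  by rewrite EZ scalerBr !scalerA mulrC.
apply: (low_sum pmu lf S0 SD SZ) => la.
have [k] := ubnP (dom_rank la); elim: k la => // k IH la; rewrite ltnS => rk pla d ne.
have [g lg Eg] : S (E (msf la) - ev la *: msf la).
  apply: (low_sum pla (E_low pla) S0 SD SZ) => nu pnu d' ne'.
  have lt := dom_rank_lt pnu pla d' ne'.
  apply: IH => //; [exact: leq_trans lt rk | exact: dominated_trans d | ].
  by apply: contraTneq (dom_rank_lt pla pmu d ne) => <-; rewrite -leqNgt ltnW.
have nz : ev la - ev mu != 0 by rewrite subr_eq0 ev_ne.
exists ((ev la - ev mu)^-1 *: (msf la - g)).
  apply: lowZ; apply: lowD; last by rewrite -scaleN1r; exact: lowZ.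
  by move=> nu pnu; rewrite coefm_monomial //; case: (nu =P la) => [->|_]; rewrite ?eqxx.
rewrite EZ scalerA mulrC -scalerA -scalerBr; apply: (scalerI nz).
have H (x y z w : Lam) : (x - y) - (z - w) = (x - z) - (y - w).
  by rewrite !opprD !opprK !addrA [x - y - z]addrAC.
rewrite scalerA divff // scale1r EB scalerBr H Eg opprB.
by rewrite addrC addrA subrK -scalerBl.
Qed.

Lemma eigenvector_exists mu : (forall la, is_partition la -> la != mu -> ev la != ev mu) ->
  is_partition mu -> exists2 P, low mu (P - msf mu) & E P = ev mu *: P.
Proof.
move=> ev_ne pmu; have [g lg Eg] := solve_low ev_ne pmu (E_low pmu).
exists (msf mu - g); first by rewrite addrAC subrr add0r -scaleN1r; exact: lowZ.
rewrite EB scalerBr; apply/eqP; rewrite subr_eq -addrA [- _ + E g]addrC Eg.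
by rewrite addrCA subrr addr0.
Qed.

End Operator.

Variables q t : F.
Hypotheses (q0 : forall k, (0 < k)%N -> 1 - q ^+ k != 0) (t1 : forall k, (0 < k)%N -> 1 - t ^+ k != 0).
Local Notation B := (qt_scalar_product q t).

(** The p_la form an orthogonal basis with nonzero norms z_la(q,t). *)
Lemma sprod_nondegenerate f : (forall g, B f g = 0) -> f = 0.
Proof.
move=> f0; have [d [c Ef]] := (power_sum_basis char0).1 f; rewrite Ef.
rewrite big_seq big1 // => la la_d; have /andP[pla _] : is_partition la && (sumn la < d)%N by rewrite -mem_parts.
have := f0 (power_sum_prod F la); rewrite Ef (sprod_suml char0) (bigD1_seq la) ?parts_uniq //=.
rewrite (sprodZl char0) (sprodpp char0) // eqxx [X in _ + X]big_seq_cond [X in _ + X]big1 ?addr0 => [/eqP|mu /andP[mu_d ne]].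
  rewrite mulf_eq0 => /orP[/eqP->|]; first by rewrite scale0r.
  rewrite mulf_eq0 => /orP[|].
    have : (0 < zpart la)%N.
      rewrite /zpart big_nat_cond; elim/big_ind: _ => // [x y|i /andP[/andP[i0 _] _]].
        by rewrite muln_gt0 => -> ->.
      by rewrite muln_gt0 fact_gt0 expn_gt0 i0.
    by case: zpart => // n _; rewrite (negbTE (char0 n)).
  rewrite prodf_seq_eq0 => /hasP[k kla /=].
  have k0 : (0 < k)%N by rewrite lt0n; apply: contraTneq pla => E; rewrite /is_partition -E kla andbF.
  by rewrite mulf_eq0 invr_eq0 (negbTE (q0 k0)) (negbTE (t1 k0)).
have /andP[pmu _] : is_partition mu && (sumn mu < d)%N by rewrite -mem_parts.
by rewrite (sprodZl char0) (sprodpp char0) // (negbTE ne) mulr0.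
Qed.

Section MacdonaldFamily.
Variable P : seq nat -> Lam.
Hypothesis P_mac : is_macdonald_P q t P.

Lemma macdonald_low mu : is_partition mu -> low mu (P mu - msf mu).
Proof.
move=> pmu; have [u ->] := P_mac.1 mu pmu; rewrite addrAC subrr add0r => la pla.
rewrite coefm_sum; have [/andP[-> ->]//|nd] := boolP (dominated la mu && (la != mu)).
rewrite big_seq_cond big1 ?eqxx // => nu; rewrite mem_partitions => /andP[/andP[pnu _] Q].
rewrite coefmZ coefm_monomial //; case: eqP => [E|]; rewrite ?mulr0 //.
by rewrite E Q in nd.
Qed.

Lemma coefm_macdonald mu la : is_partition mu -> is_partition la ->
  coefm (P mu) la = (la == mu)%:R + coefm (P mu - msf mu) la.
Proof. by move=> pmu pla; rewrite coefmB coefm_monomial // addrCA subrr addr0. Qed.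

Lemma macdonald_triangular : triangular dom_rank P.
Proof.
split=> [la pla|la mu pla pmu nz ne].
  rewrite coefm_macdonald // eqxx; have [->|nz] := eqVneq (coefm (P la - msf la) la) 0.
    by rewrite addr0 oner_neq0.
  by have [_] := macdonald_low pla pla nz; rewrite eqxx.
rewrite coefm_macdonald // (negbTE ne) add0r in nz.
have [d _] := macdonald_low pmu pla nz; split; last exact: dom_rank_lt.
by case/andP: d => /eqP.
Qed.

(** By triangularity, the P_la below mu span the same space as the m_la below mu. *)
Lemma low_macdonald_ind mu (Q : Lam -> Prop) f : is_partition mu -> low mu f -> Q 0 ->
    (forall f g, Q f -> Q g -> Q (f + g)) -> (forall (c : F) f, Q f -> Q (c *: f)) ->
    (forall la, is_partition la -> dominated la mu -> la != mu -> Q (P la)) -> Q f.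
Proof.
move=> pmu lf Q0 QD QZ QP; apply: (low_sum pmu lf Q0 QD QZ) => la.
have [k] := ubnP (dom_rank la); elim: k la => // k IH la; rewrite ltnS => rk pla d ne.
have -> : msf la = P la + (-1) *: (P la - msf la) by rewrite scaleN1r opprB addrCA subrr addr0.
apply: (QD); first exact: QP.
apply: (QZ); apply: (low_sum pla (macdonald_low pla) Q0 QD QZ) => nu pnu d' ne'.
have lt := dom_rank_lt pnu pla d' ne'.
apply: IH => //; [exact: leq_trans lt rk | exact: dominated_trans d | ].
by apply: contraTneq (dom_rank_lt pla pmu d ne) => <-; rewrite -leqNgt ltnW.
Qed.

Variables (E : Lam -> Lam) (ev : seq nat -> F).
Hypothesis ED : forall f g, E (f + g) = E f + E g.
Hypothesis EZ : forall (c : F) f, E (c *: f) = c *: E f.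
Hypothesis E_tri : forall la mu, is_partition la -> is_partition mu ->
  coefm (E (msf mu)) la != 0 -> dominated la mu.
Hypothesis E_diag : forall mu, is_partition mu -> coefm (E (msf mu)) mu = ev mu.
Hypothesis E_adj : forall f g, B (E f) g = B f (E g).

Lemma E_macdonald_low mu : is_partition mu -> low mu (E (P mu) - ev mu *: P mu).
Proof.
move=> pmu; rewrite -(subrK (msf mu) (P mu)); set g := P mu - msf mu.
have lg : low mu g := macdonald_low pmu.
rewrite ED scalerDr opprD addrACA; apply: lowD; last by apply: E_low.
apply: lowD; last by rewrite -scaleN1r; apply: lowZ; exact: lowZ.
apply: (low_sum pmu lg (Q := fun g => low mu (E g))).
- by rewrite (E0 EZ); exact: low0.
- by move=> f1 f2 l1 l2; rewrite ED; exact: lowD.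
- by move=> c f1 l1; rewrite EZ; exact: lowZ.
move=> la pla d ne nu pnu nz; have d' := E_tri pnu pla nz; have dd := dominated_trans pnu pla pmu d' d.
split=> //; apply: contraTneq (dom_rank_lt pla pmu d ne) => Enu; rewrite -leqNgt.
have [->//|ne'] := eqVneq mu la; apply: ltnW; apply: dom_rank_lt => //.
by rewrite -Enu.
Qed.

(* E (P mu) - ev mu P_mu only involves P_la for la below mu, and is orthogonal to these. *)
Lemma macdonald_eigenvector mu : is_partition mu -> E (P mu) = ev mu *: P mu.
Proof.
move=> pmu; apply/eqP; rewrite -subr_eq0; apply/eqP; set f := _ - _.
have lf : low mu f := E_macdonald_low pmu.
have BP nu : is_partition nu -> B f (P nu) = 0; last first.
  apply: sprod_nondegenerate; apply: (basis_ind (triangular_basis macdonald_triangular)) => //.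
  - exact: sprod0r.
  - by move=> g h Eg Eh; rewrite (sprodDr char0) Eg Eh addr0.
  - by move=> c g Eg; rewrite (sprodZr char0) Eg mulr0.
move=> pnu; have orth la ka : is_partition la -> is_partition ka -> la != ka -> B (P la) (P ka) = 0.
  exact: P_mac.2.
(* If nu is not below mu, then [f] is a combination of P_la with la below mu, hence with la
   different from nu. *)
have [/andP[d ne]|nd] := boolP (dominated nu mu && (nu != mu)); last first.
  apply: (low_macdonald_ind pmu lf (Q := fun f => B f (P nu) = 0)).
  - exact: sprod0l.
  - by move=> g h Eg Eh; rewrite (sprodDl char0) Eg Eh addr0.
  - by move=> c g Eg; rewrite (sprodZl char0) Eg mulr0.
  move=> la pla d ne; apply: orth => //; apply: contraNneq nd => <-.
  by rewrite d ne.
(* For nu below mu, E moves to the other side: E P_nu is a combination of P_nu and of P_la with la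
   below nu, all orthogonal to P_mu. *)
have ne' : mu != nu by rewrite eq_sym.
have -> : f = E (P mu) + (- ev mu) *: P mu by rewrite scaleNr.
rewrite (sprodDl char0) (sprodZl char0) orth // mulr0 addr0 E_adj.
rewrite -(subrK (ev nu *: P nu) (E (P nu))) (sprodDr char0) (sprodZr char0) orth // mulr0 addr0.
apply: (low_macdonald_ind pnu (E_macdonald_low pnu) (Q := fun f => B (P mu) f = 0)).
- exact: sprod0r.
- by move=> g h Eg Eh; rewrite (sprodDr char0) Eg Eh addr0.
- by move=> c g Eg; rewrite (sprodZr char0) Eg mulr0.
move=> la pla d' ne2; apply: orth => //.
apply: contraTneq (dom_rank_lt pnu pmu d ne) => ->; rewrite -leqNgt ltnW //.
exact: dom_rank_lt.
Qed.

End MacdonaldFamily.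

(** Eigenvectors of a self-adjoint operator for distinct eigenvalues are orthogonal, and
    triangularity makes them monic in the monomial functions. *)
Lemma macdonald_exists (E : Lam -> Lam) (ev : seq nat -> F) :
    (forall f g, E (f + g) = E f + E g) -> (forall (c : F) f, E (c *: f) = c *: E f) ->
    (forall la mu, is_partition la -> is_partition mu ->
       coefm (E (msf mu)) la != 0 -> dominated la mu) ->
    (forall mu, is_partition mu -> coefm (E (msf mu)) mu = ev mu) ->
    (forall f g, B (E f) g = B f (E g)) ->
    (forall la mu, is_partition la -> is_partition mu -> la != mu -> ev la != ev mu) ->
  exists P, is_macdonald_P q t P.
Proof.
move=> ED EZ E_tri E_diag E_adj ev_ne.
have ex mu : exists P, is_partition mu -> low mu (P - msf mu) /\ E P = ev mu *: P.
  have [pmu|] := boolP (is_partition mu); last by exists 0.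
  have [|//|P lP EP] := eigenvector_exists ED EZ E_tri E_diag (mu := mu).
    by move=> la pla; exact: ev_ne.
  by exists P.
have [P PP] := boolp.choice ex; exists P; split=> [mu pmu|la mu pla pmu ne].
  have [lP _] := PP mu pmu; exists (fun la => coefm (P mu - msf mu) la).
  by rewrite -(low_expand pmu lP) addrCA subrr addr0.
have [[_ Ela] [_ Emu]] := (PP la pla, PP mu pmu).
have := E_adj (P la) (P mu); rewrite Ela Emu (sprodZl char0) (sprodZr char0) => /eqP.
rewrite -subr_eq0 -mulrBl mulf_eq0 subr_eq0 => /orP[|/eqP//].
by rewrite (negbTE (ev_ne _ _ pla pmu ne)).
Qed.

End TriangularOperators.

(** * Adding a cell to a partition *)

Section Cells.
Implicit Types la mu nu : seq nat.

Definition cell mu (i j : nat) : bool := (j < nth 0 mu i)%N.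

Lemma cell_size mu i j : cell mu i j -> (i < size mu)%N.
Proof. by rewrite /cell; case: (ltnP i (size mu)) => // le; rewrite nth_default. Qed.

Lemma eq_cells la mu : is_partition la -> is_partition mu ->
  (forall i j, cell la i j = cell mu i j) -> la = mu.
Proof.
move=> /andP[_ la0] /andP[_ mu0] E.
have En i : nth 0%N la i = nth 0%N mu i.
  have [lt|gt|//] := ltngtP (nth 0%N la i) (nth 0%N mu i).
    by have := E i (nth 0%N la i); rewrite /cell ltnn lt.
  by have := E i (nth 0%N mu i); rewrite /cell ltnn gt.
have pos (s : seq nat) i : 0%N \notin s -> (i < size s)%N -> (0 < nth 0 s i)%N.
  by move=> s0 lt; rewrite lt0n; apply: contraNneq s0 => <-; exact: mem_nth.
apply: (@eq_from_nth _ 0%N) => //; apply/eqP; rewrite eqn_leq; apply/andP; split; rewrite leqNgt; apply/negP.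
  by move=> lt; have := pos _ _ la0 lt; rewrite En nth_default.
by move=> lt; have := pos _ _ mu0 lt; rewrite -En nth_default.
Qed.

Lemma nth_le_sumn mu i : (nth 0 mu i <= sumn mu)%N.
Proof. by elim: mu i => [|x mu IH] [|i] //=; [exact: leq_addr | exact: leq_trans (IH i) (leq_addl _ _)]. Qed.

(** A common K by K box gives sums and products over different diagrams one index type, in which
    cells can be compared. *)
Lemma big_cells (R : Type) (idx : R) (op : Monoid.com_law idx) K mu (Q : nat -> nat -> bool) (G : nat -> nat -> R) :
    (size mu <= K)%N -> (sumn mu <= K)%N ->
  \big[op/idx]_(i < size mu) \big[op/idx]_(j < nth 0%N mu i | Q i j) G i j =
  \big[op/idx]_(c : 'I_K * 'I_K | cell mu c.1 c.2 && Q c.1 c.2) G c.1 c.2.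
Proof.
move=> sK nK.
rewrite -(pair_big_dep xpredT (fun i j : 'I_K => cell mu i j && Q i j) (fun i j : 'I_K => G i j)) /=.
rewrite (big_ord_widen K (fun i => \big[op/idx]_(j < nth 0%N mu i | Q i j) G i j) sK) big_mkcond /=.
apply: eq_bigr => i _; case: ltnP => [lt|ge].
  rewrite (big_ord_widen_cond K (Q i) (G i)); last exact: leq_trans (nth_le_sumn _ _) nK.
  by apply: eq_bigl => j; rewrite andbC.
by rewrite big_pred0 // => j; rewrite /cell nth_default.
Qed.

End Cells.

(** * Algebraically independent q and t *)

Section GenericParameters.
Variables (F : fieldType) (Phi : {rmorphism {poly {poly rat}} -> F}).
Hypothesis Phi_inj : injective Phi.
Let q := Phi 'X%:P.
Let t := Phi 'X.
Implicit Types la mu nu : seq nat.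

(** B_mu, with explicit parameters because it is also evaluated at 1/q and 1/t. *)
Definition cells_sum (q t : F) mu : F := \sum_(i < size mu) \sum_(j < nth 0%N mu i) q ^+ j * t ^+ i.

Lemma mac_eigenvalueE (a b : F) mu : mac_eigenvalue a b mu = 1 - (1 - a) * (1 - b) * cells_sum a b mu.
Proof.
rewrite /mac_eigenvalue /cells_sum !mulr_sumr -sumrN; congr (_ + _); apply: eq_bigr => i _.
rewrite subrX1 -mulr_suml; ring.
Qed.

Lemma Phi_monomial i j (n : rat) : Phi ((n *: 'X^j)%:P * 'X^i) = Phi n%:P%:P * (q ^+ j * t ^+ i).
Proof. by rewrite -mul_polyC polyCM !rmorphM !rmorphXn /= mulrA. Qed.

Lemma coef_monomials (I : finType) (c : I -> rat) (a b : I -> nat) i j :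
  ((\sum_x (c x *: 'X^(b x))%:P * 'X^(a x) : {poly {poly rat}})`_i)`_j =
  \sum_x c x * ((i == a x) && (j == b x))%:R.
Proof.
rewrite !coef_sum; apply: eq_bigr => x _; rewrite coefCM coefXn.
case: eqP => _ /=; last by rewrite mulr0 coef0 mulr0.
by rewrite mulr1 coefZ coefXn.
Qed.

Let sumPhi (I : finType) (c : I -> bool) (a b : I -> nat) :
  Phi (\sum_x ((c x)%:R *: 'X^(b x))%:P * 'X^(a x)) = \sum_(x | c x) q ^+ b x * t ^+ a x.
Proof.
rewrite rmorph_sum [RHS]big_mkcond; apply: eq_bigr => x _; rewrite Phi_monomial.
by case: (c x); rewrite ?polyC1 ?polyC0 ?rmorph1 ?rmorph0 ?mul1r ?mul0r.
Qed.

Lemma cells_sum_inj la mu : is_partition la -> is_partition mu ->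
  cells_sum q t la = cells_sum q t mu -> la = mu.
Proof.
move=> pla pmu; pose K := (size la + size mu + sumn la + sumn mu)%N.
have big nu : (size nu <= K)%N -> (sumn nu <= K)%N -> cells_sum q t nu =
    Phi (\sum_(c : 'I_K * 'I_K) ((cell nu c.1 c.2)%:R *: 'X^(c.2))%:P * 'X^(c.1)).
  move=> sK nK; rewrite sumPhi /cells_sum.
  rewrite (big_cells _ (fun _ _ => true) (fun i j => q ^+ j * t ^+ i) sK nK).
  by apply: eq_bigl => c; rewrite andbT.
rewrite !big ?/K; try lia; move=> /Phi_inj E; apply: eq_cells => // i j.
have [iK|] := ltnP i K; last first.
  move=> le; have := @cell_size la i j; have := @cell_size mu i j.
  by case: (cell la i j); case: (cell mu i j) => // H1 H2; [have := H2 isT | have := H1 isT]; rewrite /K in le; lia.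
have [jK|] := ltnP j K; last first.
  move=> le; rewrite /cell !ltnNge !(leq_trans _ le) //; apply: leq_trans (nth_le_sumn _ _) _; rewrite /K; lia.
have /(congr1 (fun A : {poly {poly rat}} => (A`_i)`_j)) := E.
rewrite !coef_monomials.
have one nu : \sum_(c : 'I_K * 'I_K) (cell nu c.1 c.2)%:R * ((i == c.1) && (j == c.2))%:R = (cell nu i j)%:R :> rat.
  rewrite (bigD1 (Ordinal iK, Ordinal jK)) //= !eqxx mulr1 big1 ?addr0 // => -[i' j'] ne.
  case: (_ && _) / andP => [[/eqP Ei /eqP Ej]|_]; last by rewrite mulr0.
  by case/eqP: ne; congr pair; apply: val_inj.
by rewrite !one => /eqP; rewrite Num.Theory.eqr_nat; case: cell; case: cell.
Qed.

Lemma q_t_monomial_neq i j i' j' : (i, j) != (i', j') -> q ^+ i * t ^+ j != q ^+ i' * t ^+ j'.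
Proof.
apply: contraNneq => E.
have : Phi ((1 *: 'X^i)%:P * 'X^j) = Phi ((1 *: 'X^i')%:P * 'X^j') by rewrite !Phi_monomial E.
move/Phi_inj/(congr1 (fun A : {poly {poly rat}} => (A`_j)`_i)); rewrite !coefCM !coefXn eqxx mulr1.
rewrite coefZ coefXn eqxx mulr1; case: (j =P j') => [->|_]; last by rewrite mulr0 coef0 => /eqP; rewrite oner_eq0.
rewrite mulr1 coefZ coefXn mul1r; case: (i =P i') => [->//|_] /eqP.
by rewrite oner_eq0.
Qed.

Lemma generic_q0 : q != 0.
Proof. by rewrite -(rmorph0 Phi) (inj_eq Phi_inj) polyC_eq0 polyX_eq0. Qed.
Lemma generic_t0 : t != 0.
Proof. by rewrite -(rmorph0 Phi) (inj_eq Phi_inj) polyX_eq0. Qed.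

Lemma generic_1B i j : (0 < i + j)%N -> 1 - q ^+ i * t ^+ j != 0.
Proof.
move=> ij; rewrite subr_eq0 -[1]mulr1 -{1}(expr0 q) -(expr0 t); apply: q_t_monomial_neq.
by rewrite xpair_eqE; lia.
Qed.

(* The coefficient of q^0 t^0 in (\sum_c d_c x_c) (\sum_c d_c / x_c) is
   \sum_c d_c^2, with d_c = [c in nu] - [c in mu], so it forces nu and mu to
   differ in a single cell. *)
Lemma one_cell mu nu : is_partition mu -> is_partition nu -> sumn nu = (sumn mu).+1 ->
    (cells_sum q t nu - cells_sum q t mu) * (cells_sum q^-1 t^-1 nu - cells_sum q^-1 t^-1 mu) = 1 ->
  exists K (c0 : 'I_K * 'I_K), [/\ (size mu <= K)%N, (sumn mu <= K)%N, (size nu <= K)%N, (sumn nu <= K)%N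
    & [/\ cell nu c0.1 c0.2, ~~ cell mu c0.1 c0.2
    & forall c : 'I_K * 'I_K, c != c0 -> cell nu c.1 c.2 = cell mu c.1 c.2]].
Proof.
move=> pmu pnu sE prod1; pose K := (size mu + size nu + sumn mu + sumn nu)%N.
have [sm nm sn nn] : [/\ (size mu <= K)%N, (sumn mu <= K)%N, (size nu <= K)%N & (sumn nu <= K)%N].
  by rewrite /K; split; lia.
pose d (c : 'I_K * 'I_K) : rat := (cell nu c.1 c.2)%:R - (cell mu c.1 c.2)%:R.
have big la (a b : F) : (size la <= K)%N -> (sumn la <= K)%N ->
    cells_sum a b la = \sum_(c : 'I_K * 'I_K) (cell la c.1 c.2)%:R * (a ^+ c.2 * b ^+ c.1).
  move=> sK nK; rewrite /cells_sum.
  rewrite (big_cells _ (fun _ _ => true) (fun i j => a ^+ j * b ^+ i) sK nK) big_mkcond.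
  by apply: eq_bigr => c _; rewrite andbT; case: cell; rewrite ?mul1r ?mul0r.
have dif (a b : F) : cells_sum a b nu - cells_sum a b mu = \sum_c Phi (d c)%:P%:P * (a ^+ c.2 * b ^+ c.1).
  rewrite !big // -sumrB; apply: eq_bigr => c _.
  by rewrite /d !polyCB rmorphB mulrBl !polyC_natr !rmorph_nat.
have sq : \sum_c d c ^+ 2 = 1.
  (* Multiplying by (qt)^K clears the negative powers, and the coefficient of q^0 t^0 becomes that
     of q^K t^K. *)
  have E : (\sum_c (d c *: 'X^(c.2))%:P * 'X^(c.1)) * (\sum_c (d c *: 'X^(K - c.2))%:P * 'X^(K - c.1))
      = (1 *: 'X^K)%:P * 'X^K :> {poly {poly rat}}.
    apply: Phi_inj; rewrite rmorphM !rmorph_sum Phi_monomial rmorph1 mul1r.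
    rewrite (eq_bigr (fun c : 'I_K * 'I_K => Phi (d c)%:P%:P * (q ^+ c.2 * t ^+ c.1))); last first.
      by move=> c _; exact: Phi_monomial.
    rewrite -dif [X in _ * X](eq_bigr (fun c : 'I_K * 'I_K =>
       (q ^+ K * t ^+ K) * (Phi (d c)%:P%:P * (q^-1 ^+ c.2 * t^-1 ^+ c.1)))); last first.
      move=> c _; rewrite [LHS]Phi_monomial !exprVn.
      have l1 := ltn_ord c.1; have l2 := ltn_ord c.2.
      have EB (x : F) n : x != 0 -> (n < K)%N -> x ^+ (K - n) = x ^+ K / x ^+ n.
        by move=> x0 lt; rewrite -[in RHS](subnK (ltnW lt)) exprD mulfK // expf_neq0.
      rewrite (EB q _ generic_q0 l2) (EB t _ generic_t0 l1).
      by rewrite [RHS]mulrCA; congr (_ * _); rewrite mulrACA.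
    by rewrite -mulr_sumr -dif mulrCA prod1 mulr1.
  have /(congr1 (fun A : {poly {poly rat}} => (A`_K)`_K)) := E.
  rewrite coefCM coefXn eqxx mulr1 coefZ coefXn eqxx mulr1 => <-.
  rewrite mulr_sumr (eq_bigr (fun y : 'I_K * 'I_K => \sum_(x : 'I_K * 'I_K)
     ((d x * d y) *: 'X^(x.2 + (K - y.2)))%:P * 'X^(x.1 + (K - y.1)))); last first.
    move=> y _; rewrite mulr_suml; apply: eq_bigr => x _.
    by rewrite mulrACA -polyCM -scalerAl -scalerAr scalerA -!exprD.
  rewrite !coef_sum; apply: eq_bigr => y _; rewrite coef_monomials.
  rewrite (bigD1 y) //= big1 ?addr0 => [|x ne].
    have l1 := ltn_ord y.1; have l2 := ltn_ord y.2.
    by rewrite !subnKC ?(ltnW l1) ?(ltnW l2) // !eqxx mulr1.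
  have l1 := ltn_ord y.1; have l2 := ltn_ord y.2; have k1 := ltn_ord x.1; have k2 := ltn_ord x.2.
  case: andP => [[/eqP E1 /eqP E2]|_]; last by rewrite mulr0.
  case/eqP: ne; rewrite [x]surjective_pairing [y]surjective_pairing.
  have eqv (a b : 'I_K) : K = (a + (K - b))%N -> a = b.
    by move=> Eab; apply: ord_inj; have := ltn_ord b; lia.
  by congr pair; [exact: eqv E1 | exact: eqv E2].
(* d_c^2 is 1 on the symmetric difference of the two diagrams and 0 elsewhere, so this difference is
   a single cell. *)
have sqn : (\sum_(c : 'I_K * 'I_K) (cell nu c.1 c.2 (+) cell mu c.1 c.2))%N = 1%N.
  apply/eqP; rewrite -(Num.Theory.eqr_nat rat) natr_sum -sq; apply/eqP; apply: eq_bigr => c _.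
  by rewrite /d; case: cell; case: cell; rewrite /= ?subrr ?subr0 ?sub0r ?sqrrN ?expr1n ?expr0n.
have sumE la : (size la <= K)%N -> (sumn la <= K)%N ->
    sumn la = (\sum_(c : 'I_K * 'I_K) cell la c.1 c.2)%N.
  move=> sK nK; have := big_cells addn (fun _ _ => true) (fun _ _ => 1%N) sK nK.
  rewrite sumnE (big_nth 0%N) big_mkord [in X in _ = X -> _]big_mkcond => H.
  rewrite (eq_bigr (fun i : 'I_(size la) => \sum_(j < nth 0 la i) 1)%N) ?H; last first.
    by move=> i _; rewrite sum1_card card_ord.
  by apply: eq_bigr => c _; rewrite andbT; case: cell.
have [c0 x0] : exists c0 : 'I_K * 'I_K, cell nu c0.1 c0.2 (+) cell mu c0.1 c0.2.
  apply/existsP; rewrite -[X in is_true X]negbK negb_exists; apply/negP => /forallP H.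
  by move: sqn; rewrite big1 // => c _; rewrite (negbTE (H c)).
have oth (c : 'I_K * 'I_K) : c != c0 -> cell nu c.1 c.2 = cell mu c.1 c.2.
  move=> ne; move: sqn; rewrite (bigD1 c0) //= x0 (bigD1 c) //=.
  by case: cell; case: cell.
exists K, c0; split=> //.
(* The sizes decide that this cell belongs to nu. *)
have := sumE nu sn nn; rewrite sE (sumE mu sm nm) (bigD1 c0) //= [in RHS](bigD1 c0) //=.
rewrite (eq_bigr (fun c : 'I_K * 'I_K => nat_of_bool (cell nu c.1 c.2))) => [E|c ne]; last by rewrite oth.
by move: x0 E; case: (cell nu c0.1 c0.2); case: (cell mu c0.1 c0.2) => //=; lia.
Qed.

(** [mu != [::]] keeps the added cell away from the corner, whose factor Pi omits. *)
Lemma Pi_coeff_cell mu nu : is_partition mu -> is_partition nu -> mu != [::] -> sumn nu = (sumn mu).+1 ->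
    (cells_sum q t nu - cells_sum q t mu) * (cells_sum q^-1 t^-1 nu - cells_sum q^-1 t^-1 mu) = 1 ->
  Pi_coeff q t nu = Pi_coeff q t mu * (1 - (cells_sum q t nu - cells_sum q t mu)).
Proof.
move=> pmu pnu mu0 sE prod1.
have [K [c0 [sm nm sn nn [nu0 mu0' oth]]]] := one_cell pmu pnu sE prod1.
have c0_pos : (0 < c0.1 + c0.2)%N.
  rewrite lt0n; apply: contra mu0'; rewrite addn_eq0 => /andP[/eqP-> /eqP->].
  case: mu pmu mu0 {sE prod1 sm nm oth} => // x mu /andP[_]; rewrite inE negb_or eq_sym -lt0n.
  by case/andP.
have -> : cells_sum q t nu - cells_sum q t mu = q ^+ c0.2 * t ^+ c0.1.
  rewrite /cells_sum (big_cells _ (fun _ _ => true) (fun i j => q ^+ j * t ^+ i) sn nn).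
  rewrite (big_cells _ (fun _ _ => true) (fun i j => q ^+ j * t ^+ i) sm nm).
  rewrite (bigD1 c0) /= ?nu0 // (eq_bigl (fun c : 'I_K * 'I_K => cell mu c.1 c.2 && true)) ?addrK // => c.
  by case: (eqVneq c c0) => [->|ne]; rewrite ?(negbTE mu0') ?andbF //= oth // !andbT.
rewrite /Pi_coeff (big_cells _ (fun i j => (0 < i + j)%N) (fun i j => 1 - q ^+ j * t ^+ i) sn nn).
rewrite (big_cells _ (fun i j => (0 < i + j)%N) (fun i j => 1 - q ^+ j * t ^+ i) sm nm).
rewrite (bigD1 c0) /= ?nu0 ?c0_pos // mulrC; congr (_ * _); apply: eq_bigl => c.
by case: (eqVneq c c0) => [->|ne]; rewrite ?(negbTE mu0') ?andbF //= oth // !andbT.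
Qed.

Lemma Pi_coeff_neq0 mu : Pi_coeff q t mu != 0.
Proof.
apply/prodf_neq0 => i _; apply/prodf_neq0 => j ij; apply: generic_1B.
by rewrite addnC.
Qed.

End GenericParameters.

(** * Homogeneous symmetric functions and Schur functions *)

Section Rearrangement.

(** The sum of the truncated differences m - i over all i is unchanged by s. Adding it gives exactly
    c m on one side and, since x + (m - x) >= m, at least c m on the other. *)
Lemma sum_perm_initial n (s : 'S_n) m : (\sum_(i < n | (i < m)%N) i <= \sum_(i < n | (i < m)%N) s i)%N.
Proof.
pose c := #|[pred i : 'I_n | (i < m)%N]|.
have S1 : (\sum_(i < n | (i < m)%N) i + \sum_(i < n) (m - i) = c * m)%N.
  rewrite [X in (_ + X)%N](bigID (fun i : 'I_n => (i < m)%N)) /= [X in (_ + (_ + X))%N]big1 ?addn0 => [|i]; last first.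
    by rewrite -leqNgt => /eqP.
  rewrite -big_split /= -sum_nat_const; apply: eq_bigr => i lt; exact: subnKC (ltnW lt).
have S2 : (c * m <= \sum_(i < n | (i < m)%N) s i + \sum_(i < n) (m - i))%N.
  have -> : (\sum_(i < n) (m - i) = \sum_(i < n) (m - s i))%N by rewrite (reindex_inj (@perm_inj _ s)).
  rewrite [X in (_ <= _ + X)%N](bigID (fun i : 'I_n => (i < m)%N)) /= addnA -big_split /=.
  apply: leq_trans (leq_addr _ _); rewrite -sum_nat_const.
  by apply: leq_sum => i _; apply: leq_trans (leq_maxr (s i) m) _; rewrite maxnE.
by rewrite -(leq_add2r (\sum_(i < n) (m - i))) S1.
Qed.

(** Cut l into layers: for fixed k, the indices with k < l i form an initial segment, to which
    [sum_perm_initial] applies. *)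
Lemma rearrangement n (s : 'S_n) (l : nat -> nat) : (forall i j, (i <= j)%N -> (l j <= l i)%N) ->
  (\sum_(i < n) l i * i <= \sum_(i < n) l i * s i)%N.
Proof.
move=> dec; pose K := l 0%N.
have layer (x : 'I_n -> nat) : (\sum_(i < n) l i * x i = \sum_(k < K) \sum_(i < n | (k < l i)%N) x i)%N.
  under [RHS]eq_bigr => k _ do rewrite big_mkcond.
  rewrite exchange_big /=; apply: eq_bigr => i _.
  rewrite -big_mkcond /= sum_nat_const; congr (_ * _)%N.
  rewrite -sum1_card -(big_ord_widen_cond K (fun=> true) (fun=> 1%N)); last exact: dec.
  by rewrite sum1_card card_ord.
rewrite !layer; apply: leq_sum => k _.
have [m Em] : exists m, forall i : 'I_n, (k < l i)%N = (i < m)%N.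
  have [ex|none] := boolp.EM (exists j, l j <= k)%N.
    exists (ex_minn ex) => i; case: ex_minnP => m lm min.
    rewrite ltnNge (ltnNge i); congr (~~ _); apply/idP/idP; first exact: min.
    by move=> mi; apply: leq_trans (dec _ _ mi) lm.
  exists n => i; rewrite ltn_ord ltnNge; apply/negP => le.
  by apply: none; exists (nat_of_ord i).
rewrite !(eq_bigl _ _ Em); exact: sum_perm_initial.
Qed.

Lemma sum_sqr_shift n (s : 'S_n) (l : nat -> nat) : (forall i j, (i <= j)%N -> (l j <= l i)%N) ->
    (forall i : 'I_n, (i <= l i + s i)%N) -> s != 1%g ->
  (\sum_(i < n) l i ^ 2 < \sum_(i < n) (l i + s i - i) ^ 2)%N.
Proof.
move=> dec pos s1; have re := rearrangement s dec.
(* Expand the squares. Subtraction is truncated, so (s i - i)^2 is split into two terms, at least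
   one of which vanishes. *)
have E : (\sum_(i < n) (l i + s i - i) ^ 2 + 2 * (\sum_(i < n) l i * i) =
   \sum_(i < n) l i ^ 2 + 2 * (\sum_(i < n) l i * s i) + \sum_(i < n) ((s i - i) ^ 2 + (i - s i) ^ 2))%N.
  rewrite !big_distrr /= -!big_split /=; apply: eq_bigr => i _; have := pos i.
  move: (nat_of_ord i) (nat_of_ord (s i)) (l i) => c b a le.
  case: (leqP b c) => bc.
    have [d Ed] : exists d, c = (b + d)%N by exists (c - b)%N; rewrite subnKC.
    subst c; have [e Ee] : exists e, a = (d + e)%N by exists (a - d)%N; rewrite subnKC //; lia.
    subst a; rewrite (_ : d + e + b - (b + d) = e)%N; last by lia.
    have h1 : (b - (b + d) = 0)%N by lia.
    have h2 : (b + d - b = d)%N by lia.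
    by rewrite h1 h2; ring.
  have [d Ed] : exists d, b = (c + d)%N by exists (b - c)%N; rewrite subnKC // ltnW.
  subst b; rewrite (_ : a + (c + d) - c = a + d)%N; last by lia.
  have h1 : (c - (c + d) = 0)%N by lia.
  have h2 : (c + d - c = d)%N by lia.
  by rewrite h1 h2; ring.
have [i ne] : exists i, s i != i.
  apply/existsP; rewrite -[X in is_true X]negbK negb_exists; apply: contra s1 => /forallP H.
  by apply/eqP/permP => i; rewrite perm1; apply/eqP; rewrite -[X in is_true X]negbK.
have pos' : (0 < \sum_(i < n) ((s i - i) ^ 2 + (i - s i) ^ 2))%N.
  rewrite (bigD1 i) //= addn_gt0; apply/orP; left.
  by rewrite addn_gt0 !expn_gt0 !subn_gt0 /= !orbF -neq_ltn eq_sym.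
lia.
Qed.

End Rearrangement.

(** * Degree, and Schur functions as a spanning set *)

Section Homogeneous.
Variable F : fieldType.
Hypothesis char0 : forall n, n.+1%:R != 0 :> F.
Local Notation Lam := (symfun F).
Local Notation p := (power_sum F).
Implicit Types (f g : Lam) (la mu : seq nat).

Definition of_degree n f := forall la, is_partition la -> coefm f la != 0 -> sumn la = n.

(** Reading the degree as an eigenvalue of a ring morphism makes its additivity under products
    immediate. *)
Lemma of_degreeP n f : of_degree n f <-> scale_power_sums (fun k => 2%:R ^+ k) f = 2%:R ^+ n *: f.
Proof.
split=> [hf|E la pla nz].
  apply: symfun_coefm_ext => la pla; rewrite coefm_grading // coefmZ.
  by have [->|/hf->//] := eqVneq (coefm f la) 0; rewrite !mulr0.
have /(congr1 (fun f : Lam => coefm f la)) := E; rewrite coefm_grading // coefmZ => /(mulIf nz).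
by rewrite -!natrX => /(natr_inj char0) /eqP; rewrite eqn_exp2l // => /eqP.
Qed.

Lemma of_degreeM n m f g : of_degree n f -> of_degree m g -> of_degree (n + m) (f * g).
Proof.
move=> /of_degreeP hf /of_degreeP hg; apply/of_degreeP.
by rewrite rmorphM /= hf hg -scalerAl -scalerAr scalerA exprD.
Qed.

Lemma of_degree_scale n c f : of_degree n f -> of_degree n (scale_power_sums c f).
Proof.
move=> /of_degreeP hf; apply/of_degreeP; rewrite scale_power_sums_comp //.
rewrite (_ : _ *: scale_power_sums c f = scale_power_sums c (2%:R ^+ n *: f)); last by rewrite linearZ.
rewrite -hf scale_power_sums_comp //.
have : (fun k => 2%:R ^+ k * c k) = (fun k => c k * 2%:R ^+ k) by apply/funext => k; rewrite mulrC.
by move=> ->.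
Qed.

Lemma of_degreeZ n (c : F) f : of_degree n f -> of_degree n (c *: f).
Proof. by move=> hf la pla; rewrite coefmZ mulf_eq0 negb_or => /andP[_]; exact: hf. Qed.

Lemma of_degree_power_sum k : (0 < k)%N -> of_degree k (p k).
Proof. by move=> k0; apply/of_degreeP; rewrite scale_power_sumsE. Qed.

Lemma of_degree_triangular rho b la : triangular rho b -> is_partition la -> of_degree (sumn la) (b la).
Proof.
move=> [_ tr] pla mu pmu nz; have [->//|ne] := eqVneq mu la.
by have [] := tr mu la pmu pla nz ne.
Qed.

Inductive hspan : nat -> Lam -> Prop :=
| hspan0 n : hspan n 0
| hspanD n f g : hspan n f -> hspan n g -> hspan n (f + g)
| hspanZ n (c : F) f : hspan n f -> hspan n (c *: f)
| hspanX al : hspan (sumn al) (\prod_(k <- al) complete F k).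

Lemma hspanM n m f g : hspan n f -> hspan m g -> hspan (n + m) (f * g).
Proof.
elim=> [n'|n' f1 f2 _ IH1 _ IH2|n' c f1 _ IH|al] hg; first by rewrite mul0r; exact: hspan0.
- by rewrite mulrDl; apply: hspanD; [exact: IH1 | exact: IH2].
- by rewrite -scalerAl; apply: hspanZ; exact: IH.
elim: hg => [n'|n' f1 f2 _ IH1 _ IH2|n' c f1 _ IH|be]; first by rewrite mulr0; exact: hspan0.
- by rewrite mulrDr; apply: hspanD; [exact: IH1 | exact: IH2].
- by rewrite -scalerAr; apply: hspanZ; exact: IH.
by rewrite -big_cat -sumn_cat; exact: hspanX.
Qed.

Lemma hspan_complete k : hspan k (complete F k).
Proof. by have := hspanX [:: k]; rewrite big_seq1 /= addn0. Qed.

Lemma hspan_sum n I (r : seq I) (Q : pred I) (G : I -> Lam) :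
  (forall i, Q i -> hspan n (G i)) -> hspan n (\sum_(i <- r | Q i) G i).
Proof. by move=> H; elim/big_ind: _ => //; [exact: hspan0 | exact: hspanD]. Qed.

Lemma hspan_power_sum k : hspan k (p k).
Proof.
have [n] := ubnP k; elim: n k => // n IH [|k] lt; first by rewrite power_sum0; exact: hspan0.
have [_ /(congr1 (fun f : series Lam => f k.+1))] := newton_complete F.
rewrite seriesME big_ord_recr /= subnn => E.
have h0 : complete F 0 = 1 by case: (newton_complete F).
have -> : p k.+1 = k.+1%:R *: complete F k.+1 + (-1) *: \sum_(i < k.+1) p i * complete F (k.+1 - i).
  rewrite scaleN1r scaler_nat -[_ *+ _]/(sdelta (complete F) k.+1) E.
  by rewrite addrAC subrr add0r h0 mulr1.
apply: hspanD; first by apply: hspanZ; exact: hspan_complete.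
apply: hspanZ; apply: hspan_sum => i _; have lti := ltn_ord i.
rewrite -[X in hspan X](subnKC (ltnW lti)); apply: hspanM; last exact: hspan_complete.
by apply: IH; exact: leq_trans lti lt.
Qed.

Lemma of_degree_hspan n f : of_degree n f -> hspan n f.
Proof.
move=> hf; have [c ->] := triangular_span (power_sum_triangular char0) hf.
rewrite big_seq; apply: hspan_sum => la; rewrite mem_partitions => /andP[_ /eqP <-].
apply: hspanZ; rewrite /power_sum_prod; elim: la => [|k la IH] /=.
  by have := hspanX [::]; rewrite !big_nil.
by rewrite big_cons; apply: hspanM => //; exact: hspan_power_sum.
Qed.

Definition sspan n f := exists c, f = \sum_(la <- partitions n) c la *: schur F la.

Lemma sspan_sum n I (r : seq I) (Q : pred I) (G : I -> Lam) :
  (forall i, Q i -> sspan n (G i)) -> sspan n (\sum_(i <- r | Q i) G i).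
Proof.
move=> H; elim/big_ind: _ => //.
  by exists (fun=> 0); rewrite big1 // => la _; rewrite scale0r.
move=> _ _ [c ->] [c' ->]; exists (fun la => c la + c' la).
by rewrite -big_split; apply: eq_bigr => la _; rewrite scalerDl.
Qed.

Lemma sspanZ n (x : F) f : sspan n f -> sspan n (x *: f).
Proof.
move=> [c ->]; exists (fun la => x * c la).
by rewrite scaler_sumr; apply: eq_bigr => la _; rewrite scalerA.
Qed.

Lemma sumn_sqr_le (al : seq nat) : (\sum_(k <- al) k ^ 2 <= sumn al ^ 2)%N.
Proof.
elim: al => [|k al IH]; first by rewrite big_nil.
by rewrite big_cons /= sqrnD; apply: leq_trans (leq_addr _ _); rewrite leq_add2l.
Qed.

(* Expanding the Jacobi-Trudi determinant, every product of h's other than h_la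
   has a larger sum of squares of parts. *)
Lemma sspan_complete al : sspan (sumn al) (\prod_(k <- al) complete F k).
Proof.
(* By [sumn_sqr_le] this difference is an honest, untruncated one; it drops as the sum of squares
   grows at fixed degree. *)
have [n] := ubnP (sumn al ^ 2 - \sum_(k <- al) k ^ 2)%N; elim: n al => // n IH al lt.
have h0 : complete F 0 = 1 by case: (newton_complete F).
pose la := sort geq [seq k <- al | k != 0%N].
have pla : is_partition la := partition_geq_sort al.
have pm : perm_eq la [seq k <- al | k != 0%N] by rewrite /la perm_sort.
have filt (R : Type) (idx : R) (op : Monoid.com_law idx) (G : nat -> R) : G 0%N = idx ->
    \big[op/idx]_(k <- al) G k = \big[op/idx]_(k <- la) G k.
  move=> G0; rewrite (perm_big _ pm) big_filter [LHS](bigID (fun k => k != 0%N)) /=.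
  rewrite [X in op _ X]big1 ?Monoid.mulm1 // => k; rewrite negbK => /eqP->.
  exact: G0.
have sE : sumn al = sumn la by rewrite !sumnE; exact: filt.
rewrite (filt _ _ _ (complete F) h0); rewrite (filt _ _ _ (fun k => k ^ 2)%N (erefl 0%N)) in lt.
rewrite sE in lt *.
pose N := size la; pose term (s : 'S_N) : Lam := \prod_(i < N) (if (i <= nth 0 la i + s i)%N then complete F (nth 0 la i + s i - i) else 0).
have schurE : schur F la = \sum_(s : 'S_N) (-1) ^+ s * term s.
  rewrite /schur /determinant; apply: eq_bigr => s _; congr (_ * _).
  by apply: eq_bigr => i _; rewrite mxE.
have term1 : term 1%g = \prod_(k <- la) complete F k.
  rewrite [RHS](big_nth 0%N) big_mkord; apply: eq_bigr => i _.
  by rewrite perm1 leq_addl addnK.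
(* Jacobi-Trudi solved for the term of the identity permutation, which is h_la. *)
have -> : \prod_(k <- la) complete F k = \sum_(s : 'S_N | s != 1%g) (- (-1) ^+ s) *: term s + schur F la.
  rewrite schurE [X in _ = _ + X](bigD1 (1%g : 'S_N)) //= odd_perm1 mul1r term1 addrCA -big_split /= [X in _ = _ + X]big1 ?addr0 // => s _.
  by case: (odd_perm s); rewrite ?expr1 ?expr0 ?opprK ?scale1r ?scaleN1r ?mulN1r ?mul1r ?subrr ?addNr.
have [c Es] : sspan (sumn la) (\sum_(s : 'S_N | s != 1%g) (- (-1) ^+ s) *: term s).
  apply: sspan_sum => s s1; apply: sspanZ.
  have [/forallP pos|] := boolP [forall i : 'I_N, (i <= nth 0 la i + s i)%N]; last first.
    rewrite negb_forall => /existsP[i neg].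
    exists (fun=> 0); rewrite [RHS]big1 => [|mu _]; last by rewrite scale0r.
    by rewrite /term (bigD1 i) //= (negbTE neg) mul0r.
  pose be := [seq (nth 0 la i + s i - i)%N | i : 'I_N].
  have termE : term s = \prod_(k <- be) complete F k.
    rewrite big_map big_enum /=; apply: eq_bigr => i _.
    by rewrite pos.
  have sbe : sumn be = sumn la.
    apply: (@addIn (\sum_(i < N) i)%N); rewrite !sumnE big_map big_enum /= -big_split /=.
    rewrite (eq_bigr (fun i : 'I_N => nth 0 la i + s i)%N); last by move=> i _; rewrite subnK.
    by rewrite big_split /= (big_nth 0%N) big_mkord [X in _ = (_ + X)%N](reindex_inj (@perm_inj _ s)).
  rewrite termE -sbe; apply: IH; rewrite sbe.
  have := sum_sqr_shift (l := fun i => nth 0%N la i) (fun i j => @partition_sorted_ge la i j pla) pos s1.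
  have : (\sum_(k <- be) k ^ 2 <= sumn be ^ 2)%N := sumn_sqr_le be.
  rewrite sbe big_map big_enum /= => H1 H2.
  rewrite ltnS in lt; apply: leq_trans lt; rewrite (big_nth 0%N) big_mkord ltn_sub2l //.
  exact: leq_trans H2 H1.
exists (fun mu => c mu + (mu == la)%:R); rewrite Es.
rewrite [RHS](eq_bigr (fun mu => c mu *: schur F mu + (mu == la)%:R *: schur F mu)); last first.
  by move=> mu _; rewrite scalerDl.
rewrite big_split /=; congr (_ + _).
rewrite (@bigD1_partitions _ (sumn la) la) // eqxx scale1r big1 ?addr0 // => mu /negbTE->.
by rewrite scale0r.
Qed.

Lemma of_degree_sspan n f : of_degree n f -> sspan n f.
Proof.
move=> /of_degree_hspan; elim=> [m|m f1 f2 _ [c ->] _ [c' ->]|m c f1 _|al].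
- by exists (fun=> 0); rewrite big1 // => la _; rewrite scale0r.
- exists (fun la => c la + c' la).
  by rewrite -big_split; apply: eq_bigr => la _; rewrite scalerDl.
- exact: sspanZ.
- exact: sspan_complete.
Qed.

End Homogeneous.

(** * The operator Pi and Theta operators *)

Section BasisTransport.
Variable F : fieldType.
Local Notation Lam := (symfun F).

Lemma sf_basis_image (b b' : seq nat -> Lam) (h : seq nat -> F) (phi psi : {linear Lam -> Lam}) :
    sf_basis b -> cancel phi psi -> cancel psi phi ->
    (forall la, is_partition la -> h la != 0) ->
    (forall la, is_partition la -> b' la = h la *: phi (b la)) ->
  sf_basis b'.
Proof.
move=> [span indep] phiK psiK h0 Eb'.
have E d (c : seq nat -> F) : \sum_(la <- parts d) c la *: b' la = phi (\sum_(la <- parts d) (c la * h la) *: b la).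
  rewrite linear_sum big_seq [RHS]big_seq; apply: eq_bigr => la; rewrite mem_parts => /andP[pla _].
  by rewrite linearZ Eb' //= scalerA.
split=> [f|d c].
  have [d [c Ef]] := span (psi f); exists d, (fun la => c la / h la).
  rewrite E -[LHS]psiK Ef; congr (phi _); rewrite big_seq [RHS]big_seq.
  by apply: eq_bigr => la; rewrite mem_parts => /andP[pla _]; rewrite divfK ?h0.
rewrite E => /(congr1 psi); rewrite phiK linear0 => /indep Z la lad.
have /eqP := Z la lad; rewrite mulf_eq0 => /orP[/eqP//|].
by move: lad; rewrite mem_parts => /andP[/h0/negbTE->].
Qed.

Lemma basis_partitions_free (b : seq nat -> Lam) n (c : seq nat -> F) : sf_basis b ->
  \sum_(la <- partitions n) c la *: b la = 0 -> forall la, la \in partitions n -> c la = 0.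
Proof.
move=> [_ indep] E la lan; have /andP[pla /eqP sla] : is_partition la && (sumn la == n) by rewrite -mem_partitions.
have := indep n.+1 (fun la => if sumn la == n then c la else 0) _ la; rewrite sla eqxx; apply; last first.
  by rewrite mem_parts pla sla /=.
rewrite sum_parts_recr big_seq big1 ?add0r => [|mu]; last first.
  rewrite mem_parts => /andP[_ lt]; case: eqP lt => [->|_ _]; last by rewrite scale0r.
  by rewrite ltnn.
rewrite -[RHS]E big_seq [RHS]big_seq; apply: eq_bigr => mu; rewrite mem_partitions => /andP[_ ->] //.
Qed.

Lemma basis_operator (b : seq nat -> Lam) (ev : seq nat -> F) : sf_basis b ->
  exists L : {linear Lam -> Lam}, forall mu, is_partition mu -> L (b mu) = ev mu *: b mu.
Proof.
move=> bas; have [phi [phiD phiZ phib]] := basis_extension (in_alg Lam) (fun mu => ev mu *: b mu) bas.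
have phi_lin : linear phi by move=> c f g; rewrite phiD phiZ mulr_algl.
pose phiL := GRing.isLinear.Build F Lam Lam _ phi phi_lin.
by exists (HB.pack phi phiL : {linear Lam -> Lam}).
Qed.

Lemma scale_inj (c : F) (f g : Lam) : c != 0 -> c *: f = c *: g -> f = g.
Proof. by move=> c0 E; rewrite -[f]scale1r -[g]scale1r -(mulVf c0) -!scalerA E. Qed.

End BasisTransport.

Section ModifiedMacdonald.
Variables (F : fieldType) (Phi : {rmorphism {poly {poly rat}} -> F}).
Hypothesis Phi_inj : injective Phi.
Hypothesis char0 : forall n, n.+1%:R != 0 :> F.
Local Notation Lam := (symfun F).
Local Notation p := (power_sum F).
Let q := Phi 'X%:P.
Let t := Phi 'X.
Implicit Types (f g : Lam) (la mu nu : seq nat).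

Let q0 : q != 0. Proof. exact: generic_q0. Qed.
Let t0 : t != 0. Proof. exact: generic_t0. Qed.
Let q1 k : (0 < k)%N -> 1 - q ^+ k != 0.
Proof. by move=> k0; rewrite -[q ^+ k]mulr1 -(expr0 t) (generic_1B Phi_inj) ?addn0. Qed.
Let t1 k : (0 < k)%N -> 1 - t ^+ k != 0.
Proof. by move=> k0; rewrite -[t ^+ k]mul1r -(expr0 q) (generic_1B Phi_inj). Qed.
Let invB (x : F) k : x != 0 -> 1 - x^-1 ^+ k = (x ^+ k - 1) / x ^+ k.
Proof. by move=> x0; rewrite exprVn mulrBl mul1r mulfV ?expf_neq0. Qed.
Let tV1 k : (0 < k)%N -> 1 - t^-1 ^+ k != 0.
Proof. by move=> k0; rewrite invB // mulf_neq0 ?invr_eq0 ?expf_neq0 // -opprB oppr_eq0 t1. Qed.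
Let tX0 k : t ^+ k != 0. Proof. exact: expf_neq0. Qed.
Let qX0 k : q ^+ k != 0. Proof. exact: expf_neq0. Qed.

Local Notation P := (macdonald_P q t^-1).
Let ev mu := mac_eigenvalue q t mu.
Let evS mu := mac_eigenvalue q^-1 t^-1 mu.
Let E := vop (aE q) (bE t) 0.
Let ES := vop (aE q^-1) (bE t^-1) 0.
Local Notation B := (qt_scalar_product q t^-1).

Let E_adj f g : B (E f) g = B f (E g).
Proof.
apply: (@vop_self_adjoint F char0 q t^-1 (aE q) (bE t) t) => k k0.
rewrite /aE /bE invB // invfM invrK; field.
by rewrite -opprB oppr_eq0 t1.
Qed.

(** The scalar product is still the one for q, 1/t although the operator is taken at 1/q, 1/t; hence
    both operators share the eigenvectors P_mu. *)
Let ES_adj f g : B (ES f) g = B f (ES g).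
Proof.
apply: (@vop_self_adjoint F char0 q t^-1 (aE q^-1) (bE t^-1) q) => k k0.
rewrite /aE /bE mulfVK ?tV1 // exprVn mulrBr mulfV ?mulr1 //.
Qed.

Let E_tri la mu : is_partition la -> is_partition mu ->
  coefm (E (monomial_sf F mu)) la != 0 -> dominated la mu.
Proof. exact: vop_dominated. Qed.

Let ES_tri la mu : is_partition la -> is_partition mu ->
  coefm (ES (monomial_sf F mu)) la != 0 -> dominated la mu.
Proof. by apply: vop_dominated => //; rewrite invr_eq0. Qed.

Let E_diag mu : is_partition mu -> coefm (E (monomial_sf F mu)) mu = ev mu.
Proof. exact: vop_diag. Qed.

Let ES_diag mu : is_partition mu -> coefm (ES (monomial_sf F mu)) mu = evS mu.
Proof. by apply: vop_diag => //; rewrite invr_eq0. Qed.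

Lemma macdonald_PP : is_macdonald_P q t^-1 P.
Proof.
apply: epsilon_spec; apply: (@macdonald_exists F char0 q t^-1 E ev) => //.
- exact: vopD.
- exact: vopZ.
move=> la mu pla pmu; apply: contra_neq; rewrite /ev !mac_eigenvalueE => /addrI/oppr_inj.
have M0 : (1 - q) * (1 - t) != 0 by rewrite mulf_neq0 ?(q1 (k := 1)) ?(t1 (k := 1)).
by move=> /(mulfI M0); apply: (cells_sum_inj Phi_inj).
Qed.

Lemma macdonald_P_basis : sf_basis P.
Proof. exact: triangular_basis (macdonald_triangular macdonald_PP). Qed.

Let E_P mu : is_partition mu -> E (P mu) = ev mu *: P mu.
Proof.
apply: (@macdonald_eigenvector F char0 q t^-1 q1 tV1 P macdonald_PP E ev) => //.
- exact: vopD.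
- exact: vopZ.
Qed.

Let ES_P mu : is_partition mu -> ES (P mu) = evS mu *: P mu.
Proof.
apply: (@macdonald_eigenvector F char0 q t^-1 q1 tV1 P macdonald_PP ES evS) => //.
- exact: vopD.
- exact: vopZ.
Qed.

(** The plethysm f[X/(1 - 1/t)], which sends S_la(x; 1/t) to s_la and therefore J_mu to the sum of
    the K_(la mu) s_la. *)
Let psi : {lrmorphism Lam -> Lam} := scale_power_sums (fun k => (1 - t^-1 ^+ k)^-1).
Let psiV : {lrmorphism Lam -> Lam} := scale_power_sums (fun k => 1 - t^-1 ^+ k).

Let psiK : cancel psi psiV.
Proof.
move=> f; rewrite /psi /psiV scale_power_sums_comp // scale_power_sums_id // => k k0.
by rewrite mulfV ?tV1.
Qed.

Let psiVK : cancel psiV psi.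
Proof.
move=> f; rewrite /psi /psiV scale_power_sums_comp // scale_power_sums_id // => k k0.
by rewrite mulVf ?tV1.
Qed.

(* macdonald_H up to a nonzero scalar *)
Definition hbar mu : Lam := psi (P mu).

Lemma of_degree_hbar mu : is_partition mu -> of_degree (sumn mu) (hbar mu).
Proof.
move=> pmu; apply: (of_degree_scale char0).
exact: of_degree_triangular (macdonald_triangular macdonald_PP) pmu.
Qed.

Lemma hbar_span n f : of_degree n f -> exists c, f = \sum_(la <- partitions n) c la *: hbar la.
Proof.
move=> hf; have hf' : of_degree n (psiV f) by exact: of_degree_scale.
have [c Ec] := triangular_span (macdonald_triangular macdonald_PP) hf'.
exists c; rewrite -[LHS]psiVK Ec linear_sum; apply: eq_bigr => la _.
by rewrite linearZ.
Qed.

Lemma hbar_basis : sf_basis hbar.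
Proof.
apply: (sf_basis_image (h := fun=> 1) macdonald_P_basis psiK psiVK) => la _; first exact: oner_neq0.
by rewrite scale1r.
Qed.

Local Notation D := (vop (aD q t) (bD F)).
Local Notation S := (vop (aS q t) (bS F)).

(** [psi] conjugates Macdonald's operator into D_0; the rescaling of y is by t, which has no effect
    on the coefficient of y^0. *)
Lemma D_hbar mu : is_partition mu -> D 0 (hbar mu) = ev mu *: hbar mu.
Proof.
move=> pmu; rewrite /hbar -[RHS]linearZ -E_P //.
rewrite [RHS](@vop_scale F char0 (aE q) (bE t) (aD q t) (bD F) _ t) ?expr0 ?scale1r // => k k0.
  by rewrite /aD /aE invB // invfM invrK; field; rewrite -opprB oppr_eq0 t1.
by rewrite /bE /bD invB // invfM invrK; field; rewrite -opprB oppr_eq0 t1.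
Qed.

Lemma S_hbar mu : is_partition mu -> S 0 (hbar mu) = evS mu *: hbar mu.
Proof.
move=> pmu; rewrite /hbar -[RHS]linearZ -ES_P //.
rewrite [RHS](@vop_scale F char0 (aE q^-1) (bE t^-1) (aS q t) (bS F) _ 1) ?expr0 ?scale1r // => k k0.
  by rewrite /aS /aE expr1n mulr1 -!exprVn mulrN mulrCA mulVf ?tV1 // mulr1 opprB.
by rewrite /bE /bS mulVf ?tV1 // expr1n mulr1.
Qed.

Let hcoef mu : F := t ^+ npart mu *
  \prod_(i < size mu) \prod_(j < nth 0%N mu i) (1 - q ^+ arm mu i j * t^-1 ^+ (leg mu i j).+1).

Let hcoef_neq0 mu : hcoef mu != 0.
Proof.
rewrite mulf_neq0 //; apply/prodf_neq0 => i _; apply/prodf_neq0 => j _.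
rewrite exprVn -(mulfV (tX0 (leg mu i j).+1)) -mulrBl mulf_neq0 ?invr_eq0 // subr_eq0.
rewrite -[X in X != _]mul1r -(expr0 q) -[X in _ != X]mulr1 -(expr0 t).
by apply: (q_t_monomial_neq Phi_inj); rewrite xpair_eqE andbF.
Qed.

Lemma macdonald_HE mu : is_partition mu -> macdonald_H q t mu = hcoef mu *: hbar mu.
Proof.
(* The choice of [qt_kostka] has a witness: [psi] applied to J_mu is homogeneous, hence a
   combination of Schur functions. *)
have KP : forall mu, is_partition mu -> macdonald_J q t^-1 mu =
    \sum_(la <- partitions (sumn mu)) qt_kostka q t^-1 la mu *: big_schur t^-1 la.
  apply: (@epsilon_spec _ (inhabits (fun _ _ => 0)) (fun K : seq nat -> seq nat -> F => forall mu, is_partition mu ->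
    macdonald_J q t^-1 mu = \sum_(la <- partitions (sumn mu)) K la mu *: big_schur t^-1 la)).
  have ex nu : exists c : seq nat -> F, is_partition nu ->
      macdonald_J q t^-1 nu = \sum_(la <- partitions (sumn nu)) c la *: big_schur t^-1 la.
    have [pnu|] := boolP (is_partition nu); last by exists (fun=> 0).
    have hJ : of_degree (sumn nu) (macdonald_J q t^-1 nu).
      by apply: of_degreeZ; apply: of_degree_triangular (macdonald_triangular macdonald_PP) pnu.
    have [c Ec] := of_degree_sspan char0 (of_degree_scale (c := fun k => (1 - t^-1 ^+ k)^-1) char0 hJ).
    exists c => _; rewrite -[LHS]psiK Ec linear_sum; apply: eq_bigr => la _.
    by rewrite linearZ.
  have [K KP] := boolp.choice ex; exists (fun la nu => K nu la) => nu; exact: KP.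
move=> pmu; have /(congr1 psi) := KP mu pmu.
rewrite /macdonald_J linearZ /= -/(hbar mu) => EJ.
rewrite /hcoef -scalerA EJ linear_sum scaler_sumr; apply: eq_bigr => la _.
by rewrite linearZ /= psiVK scalerA mulrC.
Qed.

Lemma macdonald_H_basis : sf_basis (macdonald_H q t).
Proof.
apply: (sf_basis_image (h := hcoef) (phi := idfun) (psi := idfun) hbar_basis) => // la pla.
by rewrite macdonald_HE.
Qed.

Local Notation Pi := (Pi_op q t).
Local Notation PiV := (Pi_inv q t).

Lemma Pi_hbar mu : is_partition mu -> Pi (hbar mu) = Pi_coeff q t mu *: hbar mu.
Proof.
have spec : forall mu, is_partition mu -> Pi (macdonald_H q t mu) = Pi_coeff q t mu *: macdonald_H q t mu.
  exact: (epsilon_spec _ _ (basis_operator (Pi_coeff q t) macdonald_H_basis)).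
move=> pmu; have := spec mu pmu; rewrite macdonald_HE // linearZ /= => H.
apply: (scale_inj (hcoef_neq0 mu)); rewrite H !scalerA; congr (_ *: _); exact: mulrC.
Qed.

Lemma Pi_invP : cancel Pi PiV /\ cancel PiV Pi.
Proof.
apply: (@epsilon_spec _ _ (fun L : {linear Lam -> Lam} => cancel Pi L /\ cancel L Pi)).
have [L EL] := basis_operator (fun mu => (Pi_coeff q t mu)^-1) hbar_basis.
have nz := Pi_coeff_neq0 Phi_inj; exists L; split; apply: (basis_ind hbar_basis).
- by rewrite !linear0.
- by move=> f g Ef Eg; rewrite !linearD /= Ef Eg.
- by move=> c f Ef; rewrite !linearZ /= Ef.
- move=> mu pmu; rewrite Pi_hbar // linearZ /= EL // scalerA mulfV ?scale1r //; exact: nz.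
- by rewrite !linear0.
- by move=> f g Ef Eg; rewrite !linearD /= Ef Eg.
- by move=> c f Ef; rewrite !linearZ /= Ef.
- move=> mu pmu; rewrite EL // linearZ /= Pi_hbar // scalerA mulVf ?scale1r //; exact: nz.
Qed.

Lemma homogeneous_of_degree n f : homogeneous_sf n f -> of_degree n f.
Proof.
move=> hf la pla; apply: contraNeq => ne; rewrite /coefm.
apply/eqP; apply: (dhomog_nemf_coeff (hf (size la))).
by move: ne; rewrite -[sumn la]/(sumn (Multinom (in_tuple la))) -mdeg_sumn.
Qed.

Let cst f : F := coefm f [::].

Let of_degree_pos_cst n f : (0 < n)%N -> of_degree n f -> cst f = 0.
Proof.
move=> n0 hf; apply/eqP/negPn/negP => nz.
by have := hf [::] isT nz => /= E0; rewrite -E0 in n0.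
Qed.

Let of_degree0_cst f : of_degree 0 f -> f = (cst f)%:A.
Proof.
move=> hf; apply: symfun_coefm_ext => la pla; rewrite coefmZ -[1]/(1 : Lam).
have c1 mu : is_partition mu -> coefm (1 : Lam) mu = (mu == [::])%:R.
  move=> pmu; rewrite /coefm -[(1 : Lam) _]/(1 : {mpoly F[_]}) mcoeff1; congr (_%:R).
  congr nat_of_bool; apply/eqP/eqP => [E0|->]; last by apply/mnmP; case.
  case: mu pmu E0 => // x mu /andP[_]; rewrite inE negb_or => /andP[x0 _].
  by move=> /mnmP/(_ ord0); rewrite mnm0E (mnm_nth 0%N) /= => E0; rewrite E0 in x0.
rewrite c1 //; have [->|ne] := eqVneq la [::]; first by rewrite mulr1.
rewrite mulr0; apply/eqP/negPn/negP => /(hf la pla).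
case: la pla ne => // x la /andP[_]; rewrite inE negb_or eq_sym -lt0n /=.
by case/andP; case: x.
Qed.

Lemma is_theta_Theta : is_theta q t (Theta q t).
Proof.
apply: epsilon_spec.
(* Splitting off the constant term of G merges the cases of the definition into one bilinear
   formula: this term only meets the constant term of f. *)
exists (fun f G => Pi (plethysm_over_M q t f * PiV (G - (cst G)%:A)) + cst f *: (cst G)%:A); split.
- move=> f c G G'; rewrite /cst coefmD coefmZ -!/(cst _).
  have -> : c *: G + G' - (c * cst G + cst G')%:A = c *: (G - (cst G)%:A) + (G' - (cst G')%:A).
    by rewrite scalerBr scalerDl scalerA opprD addrACA.
  rewrite linearP /= mulrDr -scalerAr linearP /= scalerDr addrACA; congr (_ + _).
  by rewrite !scalerA -scalerDl mulrDr mulrCA mulrA.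
- move=> G c f f'; rewrite linearP mulrDl -scalerAl linearP /= /cst coefmD coefmZ -!/(cst _).
  rewrite [(c * _ + _) *: _]scalerDl -[(c * _) *: _]scalerA [in RHS]scalerDr; exact: addrACA.
move=> n m f G /homogeneous_of_degree hf /homogeneous_of_degree hG.
case: m hG => [|m] hG; last first.
  by rewrite (of_degree_pos_cst (ltn0Sn m) hG) scale0r subr0 scaler0 addr0 !andbF.
rewrite -(of_degree0_cst hG) subrr linear0 mulr0 linear0 add0r eqxx !andbT.
case: n hf => [|n] hf; first by rewrite eqxx {2}(of_degree0_cst hf) mulr_algl.
by rewrite (of_degree_pos_cst (ltn0Sn n) hf) scale0r.
Qed.

Let M := (1 - q) * (1 - t).

(** The expansion of p_1 hbar_mu exists by degree alone. [D_0, p_1] = M D_1 gives that of D_1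
    hbar_mu, and comparing coefficients of hbar_nu in [D_1, D*_0] = - (M / (qt)) p_1 gives the
    condition on the nu with [d nu != 0]. *)
Lemma pieri mu : is_partition mu -> exists d : seq nat -> F,
  [/\ p 1 * hbar mu = \sum_(nu <- partitions (sumn mu).+1) d nu *: hbar nu,
      D 1 (hbar mu) = \sum_(nu <- partitions (sumn mu).+1)
          (cells_sum q t mu - cells_sum q t nu) *: (d nu *: hbar nu)
    & forall nu, nu \in partitions (sumn mu).+1 -> d nu != 0 ->
      (cells_sum q t nu - cells_sum q t mu) * (cells_sum q^-1 t^-1 nu - cells_sum q^-1 t^-1 mu) = 1].
Proof.
move=> pmu; have M0 : M != 0 by rewrite mulf_neq0 ?(q1 (k := 1)) ?(t1 (k := 1)).
have hp : of_degree (sumn mu).+1 (p 1 * hbar mu).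
  by rewrite -add1n; apply: of_degreeM => //; [exact: of_degree_power_sum | exact: of_degree_hbar].
have [d Ed] := hbar_span hp.
have evB la nu : ev la - ev nu = M * (cells_sum q t nu - cells_sum q t la).
  by rewrite /ev !mac_eigenvalueE /M; ring.
have evSB la nu : evS la - evS nu = (1 - q^-1) * (1 - t^-1) * (cells_sum q^-1 t^-1 nu - cells_sum q^-1 t^-1 la).
  by rewrite /evS !mac_eigenvalueE; ring.
have ED1 : D 1 (hbar mu) = \sum_(nu <- partitions (sumn mu).+1)
    (cells_sum q t mu - cells_sum q t nu) *: (d nu *: hbar nu).
  apply: (scale_inj M0).
  rewrite -[M *: _]/(aD q t 1 *: D 1 (hbar mu)) -(vop_commutator char0) D_hbar // -scalerAr Ed.
  rewrite (linear_sum (D 0)) [ev mu *: _]scaler_sumr -sumrB [M *: _]scaler_sumr big_seq [RHS]big_seq; apply: eq_bigr => nu.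
  rewrite mem_partitions => /andP[pnu _]; rewrite linearZ /= D_hbar // !scalerA -scalerBl; congr (_ *: _).
  by transitivity (d nu * (ev nu - ev mu)); [ring | rewrite evB; ring].
exists d; split=> // nu0 nu0P dnu0.
have qt1 : 1 - q * t != 0 by rewrite -[q]expr1 -[t]expr1 (generic_1B Phi_inj).
have := DS_commutator char0 q0 t0 qt1 1 0 (hbar mu); rewrite S_hbar // linearZ /= ED1.
have -> : ((1 - q) * (1 - t) / (1 - q * t)) *:
    (0 - (q * t) ^- 1 *: hexp (fun k : nat => 1 - (q * t) ^+ k) (1 + 0)) = (- M / (q * t)) *: p 1.
  rewrite [hexp _ _](hexp1 char0) sub0r scalerN !scalerA -scaleNr; congr (_ *: _); rewrite /M !expr1; field.
  by rewrite q0 t0 qt1.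
rewrite -scalerAl Ed (linear_sum (S 0)) [evS mu *: _]scaler_sumr -sumrB [X in _ = X]scaler_sumr => /eqP.
rewrite -subr_eq0 -sumrB => /eqP Z.
have := basis_partitions_free (c := fun nu => (- M / (q * t)) *
   ((cells_sum q t nu - cells_sum q t mu) * (cells_sum q^-1 t^-1 nu - cells_sum q^-1 t^-1 mu) - 1) * d nu) hbar_basis _ nu0P.
move=> H; have /eqP : - M / (q * t) * ((cells_sum q t nu0 - cells_sum q t mu) * (cells_sum q^-1 t^-1 nu0 - cells_sum q^-1 t^-1 mu) - 1) * d nu0 = 0.
  apply: H; rewrite -[RHS]Z big_seq [RHS]big_seq; apply: eq_bigr => nu.
  rewrite mem_partitions => /andP[pnu _]; rewrite -[X in _ = _ - X - _]/(S 0 ((cells_sum q t mu - cells_sum q t nu) *: (d nu *: hbar nu))).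
  rewrite !(vopZ char0) S_hbar // !scalerA -!scalerBl; congr (_ *: _).
  have -> : evS nu = evS mu - (1 - q^-1) * (1 - t^-1) * (cells_sum q^-1 t^-1 nu - cells_sum q^-1 t^-1 mu).
    by rewrite -evSB; ring.
  rewrite /M; move: (cells_sum _ _ _) (cells_sum _ _ _) (cells_sum _ _ _) (cells_sum _ _ _) => x1 x2 x3 x4.
  by field; rewrite q0 t0.
rewrite mulf_eq0 (negbTE dnu0) orbF mulf_eq0 mulf_eq0 oppr_eq0 (negbTE M0) invr_eq0 mulf_eq0.
by rewrite (negbTE q0) (negbTE t0) /= subr_eq0 => /eqP.
Qed.

Lemma Pi_p1_hbar mu : is_partition mu -> mu != [::] ->
  Pi (p 1 * hbar mu) = p 1 * Pi (hbar mu) + D 1 (Pi (hbar mu)).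
Proof.
move=> pmu mu0; have [d [Ed ED box]] := pieri pmu.
rewrite Pi_hbar // linearZ /= -scalerAr ED Ed linear_sum -scalerDr -big_split scaler_sumr /=.
rewrite big_seq [RHS]big_seq; apply: eq_bigr => nu nuP.
have /andP[pnu /eqP snu] : is_partition nu && (sumn nu == (sumn mu).+1) by rewrite -mem_partitions.
rewrite linearZ /= Pi_hbar //; have [->|dnu] := eqVneq (d nu) 0; first by rewrite !scale0r !scaler0 addr0 scaler0.
rewrite (Pi_coeff_cell Phi_inj pmu pnu mu0 snu (box nu nuP dnu)).
rewrite -/q -/t scalerDr !scalerA -scalerDl; congr (_ *: _); ring.
Qed.

(* Multiplication by p_1 is conjugate, under Pi, to p_1 + D_1. *)
Lemma Pi_p1 n f : of_degree n.+1 f -> Pi (p 1 * f) = p 1 * Pi f + D 1 (Pi f).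
Proof.
move=> /hbar_span[c ->]; rewrite (mulr_sumr _ _ _ (p 1)) (linear_sum Pi) (linear_sum Pi) (linear_sum (D 1)).
rewrite (mulr_sumr _ _ _ (p 1)) -big_split big_seq [RHS]big_seq; apply: eq_bigr => mu.
rewrite mem_partitions => /andP[pmu /eqP smu]; rewrite -scalerAr !linearZ /= Pi_p1_hbar //.
  by rewrite scalerDr -scalerAr.
by apply: contra_eq_neq smu => ->.
Qed.

Lemma Pi_power_sum1 : Pi (p 1) = p 1.
Proof.
have [c ->] := hbar_span (of_degree_power_sum char0 (ltn0Sn 0)).
rewrite linear_sum big_seq [RHS]big_seq; apply: eq_bigr => mu; rewrite mem_partitions => /andP[pmu /eqP smu].
rewrite linearZ /= Pi_hbar //.
have -> : mu = [:: 1%N].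
  case: mu pmu smu => [|x [|y mu]] //=; first by rewrite addn0 => _ ->.
  by rewrite /is_partition !inE !negb_or => /andP[_ /and3P[]]; lia.
by rewrite /Pi_coeff big_ord1 big1 ?scale1r // => j; case: j => -[|[|j]].
Qed.

Lemma elementary1 : elementary F 1 = p 1.
Proof.
apply: symfun_ext => N; rewrite -[RHS]/(at_vars N (p 1)) at_vars_power_sum // -[LHS]/(mesym N F 1).
by rewrite mesym1E; apply: eq_bigr => i _; rewrite expr1.
Qed.

(** Here e_1^k[X/M] = (p_1 / M)^k and Pi fixes p_1, so Pi is pulled through k multiplications by
    p_1, each time in positive degree. *)
Lemma Theta_elementary1 k :
  Theta q t (elementary_prod F (nseq k 1%N)) (elementary F 1) =
    iter k (fun f => M^-1 *: (p 1 * f + D 1 f)) (p 1).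
Proof.
have h1 N : mesym N F 1 \is 1.-homog by exact: dhomog_mesym.
have [_ _ ThetaE] := is_theta_Theta.
have hk : homogeneous_sf k (elementary_prod F (nseq k 1%N)).
  move=> N; rewrite -[X in X \is _]/(at_vars N (elementary_prod F (nseq k 1%N))).
  elim: k => [|k IH]; first by rewrite /elementary_prod big_nil -[at_vars N 1]/(1 : {mpoly F[N]}) dhomog1.
  rewrite /elementary_prod big_cons at_varsM -[k.+1]add1n; apply: dhomogM; [exact: h1 | exact: IH].
rewrite (ThetaE k 1%N _ (elementary F 1) hk h1) andbF andbF elementary1.
have -> : PiV (p 1) = p 1 by rewrite -{1}Pi_power_sum1 Pi_invP.1.
have -> : plethysm_over_M q t (elementary_prod F (nseq k 1%N)) = (M^-1 *: p 1) ^+ k.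
  rewrite /elementary_prod rmorph_prod big_nseq iter_mulr_1 elementary1; congr (_ ^+ k).
  by apply: etrans (scale_power_sumsE char0 _ (ltn0Sn 0)) _; rewrite !expr1.
have hM j : of_degree j.+1 ((M^-1 *: p 1) ^+ j * p 1).
  elim: j => [|j IH]; first by rewrite mul1r; exact: of_degree_power_sum.
  rewrite exprS -mulrA -[j.+2]add1n; apply: of_degreeM => //.
  by apply: of_degreeZ; exact: of_degree_power_sum.
elim: k {hk} => [|k IH]; first by rewrite mul1r Pi_power_sum1.
by rewrite iterS -IH exprS -mulrA -scalerAl linearZ /= (Pi_p1 (hM k)).
Qed.

End ModifiedMacdonald.

(** * Specialization at t = 1 *)

Section Specialization.
Implicit Types (c d : Qqt) (v w : Qq).

Lemma value_frac (a : {poly {poly rat}}) : value_at_t1 a%:F a.[1]%:F.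
Proof. by exists a, 1; rewrite hornerC oner_neq0 !rmorph1 !divr1. Qed.

Lemma value_add c d v w : value_at_t1 c v -> value_at_t1 d w -> value_at_t1 (c + d) (v + w).
Proof.
move=> [a [b [b0 -> ->]]] [a' [b' [b'0 -> ->]]].
exists (a * b' + a' * b), (b * b'); split; first by rewrite hornerM mulf_neq0.
  have nz (x : {poly {poly rat}}) : x.[1] != 0 -> x%:F != 0 :> Qqt.
    by move=> x0; rewrite tofrac_eq0; apply: contraNneq x0 => ->; rewrite horner0.
  by rewrite addf_div ?nz // -!tofracM -tofracD.
by rewrite addf_div ?tofrac_eq0 // -!tofracM -tofracD -!hornerM -hornerD.
Qed.

Lemma value_mul c d v w : value_at_t1 c v -> value_at_t1 d w -> value_at_t1 (c * d) (v * w).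
Proof.
move=> [a [b [b0 -> ->]]] [a' [b' [b'0 -> ->]]].
exists (a * a'), (b * b'); split; first by rewrite hornerM mulf_neq0.
  by rewrite mulf_div -!tofracM.
by rewrite mulf_div -!tofracM -!hornerM.
Qed.

Lemma value_1 : value_at_t1 1 1.
Proof. by have := value_frac 1; rewrite hornerC !rmorph1. Qed.

Lemma value_0 : value_at_t1 0 0.
Proof. by have := value_frac 0; rewrite horner0 !rmorph0. Qed.

Lemma value_N1 : value_at_t1 (-1) (-1).
Proof. by have := value_frac (-1); rewrite hornerN hornerC !rmorphN !rmorph1. Qed.

Lemma value_sum I (r : seq I) (Q : pred I) (c : I -> Qqt) (v : I -> Qq) :
  (forall i, Q i -> value_at_t1 (c i) (v i)) ->
  value_at_t1 (\sum_(i <- r | Q i) c i) (\sum_(i <- r | Q i) v i).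
Proof.
move=> H; elim/big_rec2: _ => [|i x y Qi E]; first exact: value_0.
by apply: value_add => //; exact: H.
Qed.

Let horner_nat (R : nzRingType) n (x : R) : (n%:R : {poly R}).[x] = n%:R.
Proof. by rewrite -polyC_natr hornerC. Qed.

Lemma value_nat n : value_at_t1 n%:R n%:R.
Proof. by have := value_frac n%:R; rewrite horner_nat !rmorph_nat. Qed.

Lemma value_natV n : value_at_t1 n.+1%:R^-1 n.+1%:R^-1.
Proof.
exists 1, n.+1%:R; rewrite hornerC horner_nat !tofrac1 !rmorph_nat !div1r; split=> //.
by rewrite -polyC_natr polyC_eq0 Num.Theory.pnatr_eq0.
Qed.

Lemma value_expr c v n : value_at_t1 c v -> value_at_t1 (c ^+ n) (v ^+ n).
Proof.
move=> H; elim: n => [|n IH]; first exact: value_1.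
by rewrite !exprS; apply: value_mul.
Qed.

Lemma value_q : value_at_t1 q_Qqt q_Qq.
Proof. by have := value_frac 'X%:P; rewrite hornerC. Qed.

Lemma value_t : value_at_t1 t_Qqt 1.
Proof. by have := value_frac 'X; rewrite hornerX rmorph1. Qed.

Lemma char0_Qqt n : n.+1%:R != 0 :> Qqt.
Proof.
rewrite -(rmorph_nat (@FracField.tofrac {poly {poly rat}})) tofrac_eq0 -polyC_natr polyC_eq0.
by rewrite -polyC_natr polyC_eq0 Num.Theory.pnatr_eq0.
Qed.

Lemma char0_Qq n : n.+1%:R != 0 :> Qq.
Proof.
rewrite -(rmorph_nat (@FracField.tofrac {poly rat})) tofrac_eq0 -polyC_natr polyC_eq0.
by rewrite Num.Theory.pnatr_eq0.
Qed.

(* Specialization at t = 1 along a construction from the p_k, so that it can be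
   followed through D, which is computed by recursion on that construction. *)
Inductive at1 : symfun Qqt -> symfun Qq -> Prop :=
| at1_one : at1 1 1
| at1D f f' g g' : at1 f g -> at1 f' g' -> at1 (f + f') (g + g')
| at1Z c v f g : value_at_t1 c v -> at1 f g -> at1 (c *: f) (v *: g)
| at1_pM k f g : (0 < k)%N -> at1 f g -> at1 (power_sum Qqt k * f) (power_sum Qq k * g).

Lemma at1_0 : at1 0 0.
Proof. by have := at1Z value_0 at1_one; rewrite !scale0r. Qed.

Lemma at1_sum I (r : seq I) (Q : pred I) (f : I -> symfun Qqt) (g : I -> symfun Qq) :
  (forall i, Q i -> at1 (f i) (g i)) ->
  at1 (\sum_(i <- r | Q i) f i) (\sum_(i <- r | Q i) g i).
Proof.
move=> H; elim/big_rec2: _ => [|i x y Qi E]; first exact: at1_0.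
by apply: at1D => //; exact: H.
Qed.

Lemma at1_symfun f g : at1 f g -> symfun_at_t1 f g.
Proof.
elim=> {f g} [|f f' g g' _ H _ H'|c v f g cv _ H|k f g k0 _ H] N m.
- by rewrite -[(1 : symfun Qqt) N]/(1 : {mpoly Qqt[N]}) -[(1 : symfun Qq) N]/(1 : {mpoly Qq[N]}) !mcoeff1;
    exact: value_nat.
- rewrite -[(f + f') N]/(f N + f' N) -[(g + g') N]/(g N + g' N) !mcoeffD.
  exact: value_add (H N m) (H' N m).
- rewrite -[(c *: f) N]/(c *: f N) -[(v *: g) N]/(v *: g N) !mcoeffZ.
  exact: value_mul cv (H N m).
- rewrite -[(_ * f) N]/(at_vars N (power_sum Qqt k) * f N) -[(_ * g) N]/(at_vars N (power_sum Qq k) * g N).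
  rewrite !at_vars_power_sum // !mcoeffM; apply: value_sum => x _; apply: value_mul => //.
  rewrite !raddf_sum; apply: value_sum => i _.
  have cX (R : comNzRingType) : ('X_i ^+ k : {mpoly R[N]})@_(x.1) = ((U_(i) *+ k)%MM == x.1 :> 'X_{1..N})%:R.
    by rewrite mpolyXn mcoeffX.
  by have := value_nat ((U_(i) *+ k)%MM == x.1 :> 'X_{1..N}); rewrite -(cX Qqt) -(cX Qq).
Qed.

(** The Newton recursion has rational coefficients, on which the specialization acts trivially. *)
Lemma at1_hexpN m : at1 (hexp (bD Qqt) m) (hexp (bD Qq) m).
Proof.
have [n] := ubnP m; elim: n m => // n IH [|m] lt; first by rewrite !hexp0 //; [exact: at1_one|exact: char0_Qq|exact: char0_Qqt].
have rec (F : fieldType) (ch : forall n, n.+1%:R != 0 :> F) : hexp (bD F) m.+1 =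
    m.+1%:R^-1 *: \sum_(i < m.+1) (-1) *: (power_sum F i.+1 * hexp (bD F) (m - i)).
  have [_ /(congr1 (fun f : series (symfun F) => f m.+1))] := newton_hexp ch (bD F).
  rewrite seriesME big_ord_recl /= {1}/pseries power_sum0 scaler0 mul0r add0r.
  rewrite (eq_bigr (fun i : 'I_m.+1 => (-1) *: (power_sum F i.+1 * hexp (bD F) (m - i)))) => [<-|i _]; last first.
    by rewrite /pseries /bD -scalerAl.
  by rewrite /sdelta -scaler_nat scalerA mulVf ?scale1r.
rewrite (rec Qqt char0_Qqt) (rec Qq char0_Qq); apply: at1Z; first exact: value_natV.
apply: at1_sum => i _; apply: at1Z; first exact: value_N1.
by apply: at1_pM => //; apply: IH; apply: leq_ltn_trans (leq_subr _ _) _.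
Qed.

Local Notation D := (vop (aD q_Qqt t_Qqt) (bD Qqt)).

Let q_int k : Qq := \sum_(i < k) q_Qq ^+ i.

Lemma value_aD k : value_at_t1 (aD q_Qqt t_Qqt k) 0.
Proof.
have := value_mul (value_add value_1 (value_mul value_N1 (value_expr k value_q)))
  (value_add value_1 (value_mul value_N1 (value_expr k value_t))).
by rewrite expr1n !mulN1r subrr mulr0.
Qed.

(** At t = 1 the shift parameters [aD] vanish, so only multiplication by the exponential
    survives. *)
Lemma at1_D f g m : at1 f g -> at1 (D m f) (hexp (bD Qq) m * g).
Proof.
move=> H; elim: H m => {f g} [|f f' g g' _ H _ H'|c v f g cv _ H|k f g k0 _ H] m.
- by rewrite vop1 mulr1; exact: at1_hexpN.
- by rewrite vopD mulrDr; exact: at1D.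
- by rewrite (vopZ char0_Qqt) -scalerAr; exact: at1Z.
rewrite (vop_pM char0_Qqt) // mulrCA -[X in at1 _ X]addr0 -[X in at1 _ (_ + X)](scale0r (hexp (bD Qq) (m + k) * g)).
apply: at1D; first exact: at1_pM.
by apply: at1Z => //; exact: value_aD.
Qed.

Let M := (1 - q_Qqt) * (1 - t_Qqt).

Lemma M_neq0 : M != 0.
Proof.
rewrite mulf_neq0 // subr_eq0 -(tofrac1 {poly {poly rat}}) tofrac_eq.
  by apply/eqP => /polyC_inj/(congr1 (horner^~ 0)); rewrite hornerX hornerC => /eqP; rewrite oner_eq0.
by apply/eqP => /(congr1 (horner^~ 0)); rewrite hornerX hornerC => /eqP; rewrite oner_eq0.
Qed.

(** The quotient is (1 + t + ... + t^(k-1)) (1 + q + ... + q^(k-1)), the origin of the coefficient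
    in theta p_k. *)
Lemma value_aD_M k : value_at_t1 (M^-1 * aD q_Qqt t_Qqt k) (k%:R * q_int k).
Proof.
have -> : M^-1 * aD q_Qqt t_Qqt k = (\sum_(i < k) t_Qqt ^+ i) * (\sum_(i < k) q_Qqt ^+ i).
  apply: (mulfI M_neq0); rewrite mulVKf ?M_neq0 // /aD -opprB subrX1 -[1 - t_Qqt ^+ k]opprB subrX1 /M.
  ring.
apply: value_mul; last by apply: value_sum => i _; apply: value_expr; exact: value_q.
have -> : k%:R = \sum_(i < k) (1 : Qq) ^+ i.
  by rewrite (eq_bigr (fun=> 1)) ?sumr_const ?card_ord // => i _; rewrite expr1n.
by apply: value_sum => i _; apply: value_expr; exact: value_t.
Qed.

(** To first order in M, D_m is multiplication by [hexp bD m] plus M theta_m: on p_k f, [vop_pM]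
    adds [aD k] D_(m+k) f, whose quotient by M specializes to theta_m(p_k) f. *)
Lemma at1_theta_step (theta : nat -> symfun Qq -> symfun Qq) :
    (forall m f g, theta m (f + g) = theta m f + theta m g) ->
    (forall m (x : Qq) f, theta m (x *: f) = x *: theta m f) ->
    (forall m f g, theta m (f * g) = f * theta m g + theta m f * g) ->
    (forall m k, (0 < k)%N -> theta m (power_sum Qq k) = (k%:R * q_int k) *: hexp (bD Qq) (m + k)) ->
  forall f g, at1 f g -> forall m, at1 (M^-1 *: (D m f - hexp (bD Qqt) m * f)) (theta m g).
Proof.
move=> tD tZ tM tp f g; elim=> {f g} [|f f' g g' _ H _ H'|c v f g cv _ H|k f g k0 fg H] m.
- have -> : theta m 1 = 0.
    have := tM m 1 1; rewrite !mul1r mulr1 => /eqP; rewrite -subr_eq0 opprD addrA subrr sub0r oppr_eq0.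
    by move/eqP.
  by rewrite vop1 mulr1 subrr scaler0; exact: at1_0.
- rewrite tD vopD mulrDr opprD addrACA scalerDr; exact: at1D.
- rewrite tZ (vopZ char0_Qqt) -scalerAr -scalerBr scalerA mulrC -scalerA; exact: at1Z cv (H m).
rewrite tM tp // (vop_pM char0_Qqt) // [X in _ - X]mulrCA addrAC -mulrBr scalerDr scalerAr.
apply: at1D; first exact: at1_pM k0 (H m).
rewrite scalerA -scalerAl; apply: at1Z; first exact: value_aD_M.
exact: at1_D.
Qed.

Lemma Theta_at1 k (theta : symfun Qq -> symfun Qq) :
    (forall f g, theta (f + g) = theta f + theta g) ->
    (forall (x : Qq) f, theta (x *: f) = x *: theta f) ->
    (forall f g, theta (f * g) = f * theta g + theta f * g) ->
    (forall k, (0 < k)%N -> theta (power_sum Qq k) = (k%:R * \sum_(i < k) q_Qq ^+ i) *: hexp (bD Qq) k.+1) ->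
  symfun_at_t1 (Theta q_Qqt t_Qqt (elementary_prod Qqt (nseq k 1%N)) (elementary Qqt 1))
     (iter k theta (power_sum Qq 1)).
Proof.
move=> tD tZ tM tp; apply: at1_symfun.
have ex m : exists th : symfun Qq -> symfun Qq,
  [/\ forall f g, th (f + g) = th f + th g,
      forall (x : Qq) f, th (x *: f) = x *: th f,
      forall f g, th (f * g) = f * th g + th f * g
    & forall k, (0 < k)%N -> th (power_sum Qq k) = (k%:R * q_int k) *: hexp (bD Qq) (m + k)].
  exact: (derivation_exists char0_Qq).
have [th thP] := boolp.choice ex.
have Eth g : th 1%N g = theta g.
  have [D1 Z1 M1 p1] := thP 1%N; move: g; apply: (symfun_ind char0_Qq).
  - by move=> f g Ef Eg; rewrite D1 tD Ef Eg.
  - by move=> c f Ef; rewrite Z1 tZ Ef.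
  - have := M1 1 1; have := tM 1 1; rewrite !mul1r !mulr1 => E1 E2.
    by rewrite -[RHS](addrK (theta 1)) -E1 subrr -[LHS](addrK (th 1%N 1)) -E2 subrr.
  - by move=> j f j0 Ef; rewrite M1 tM Ef p1 // tp.
have Phi_inj : injective (@FracField.tofrac {poly {poly rat}}).
  by move=> x y /eqP; rewrite tofrac_eq => /eqP.
rewrite [Theta _ _ _ _](Theta_elementary1 Phi_inj char0_Qqt k).
elim: k => [|k IH]; first by rewrite -[X in at1 X _]mulr1 -[X in at1 _ X]mulr1; apply: at1_pM => //; exact: at1_one.
rewrite !iterS; set f := iter k _ _ in IH *; set g := iter k theta _ in IH *.
have := @at1_theta_step th (fun m => let: And4 a _ _ _ := thP m in a) (fun m => let: And4 _ a _ _ := thP m in a)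
  (fun m => let: And4 _ _ a _ := thP m in a) (fun m => let: And4 _ _ _ a := thP m in a) f g IH 1%N.
(* [hexp bD 1] is - p_1, so for m = 1 the difference in [at1_theta_step] is p_1 f + D_1 f. *)
rewrite Eth hexp1 /bD; last exact: char0_Qqt.
by rewrite scaleN1r mulNr opprK addrC.
Qed.

End Specialization.

(** * Words counted by inversions *)

Section QExponential.
Variable F : fieldType.
Hypothesis char0 : forall n, n.+1%:R != 0 :> F.
Variable q : F.
Hypothesis q1 : forall k, (0 < k)%N -> 1 - q ^+ k != 0.
Local Notation Lam := (symfun F).
Local Notation p := (power_sum F).
Variable theta : Lam -> Lam.
Hypothesis thetaD : forall f g, theta (f + g) = theta f + theta g.
Hypothesis thetaZ : forall (c : F) f, theta (c *: f) = c *: theta f.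
Hypothesis thetaM : forall f g, theta (f * g) = f * theta g + theta f * g.
Hypothesis theta_p : forall k, (0 < k)%N ->
  theta (p k) = (k%:R * \sum_(i < k) q ^+ i) *: hexp (bD F) k.+1.

Let b k : F := (1 - q ^+ k)^-1.
Let w : series Lam := hexp b.
Let eta : series Lam := hexp (bD F).
Let P : series Lam := pseries b.
Let eta_tail : series Lam := fun n => if n is 0 then 0 else eta n.+1.
Let tw : series Lam := fun n => (1 - q) *: theta (w n).

Let theta0 : theta 0 = 0.
Proof. by have := thetaZ 0 0; rewrite !scale0r. Qed.

Let theta_sum I (r : seq I) (f : I -> Lam) : theta (\sum_(i <- r) f i) = \sum_(i <- r) theta (f i).
Proof. by elim: r => [|i r IH]; rewrite ?big_nil ?big_cons ?theta0 ?thetaD ?IH. Qed.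

Let thetaMn f n : theta (f *+ n) = theta f *+ n.
Proof. by rewrite -scaler_nat thetaZ scaler_nat. Qed.

(** The factor 1 + q + ... + q^(k-1) in theta p_k cancels against (1 - q) / (1 - q^k). *)
Let theta_P n : (1 - q) *: theta (P n) = sdelta eta_tail n.
Proof.
case: n => [|n]; first by rewrite /P /pseries power_sum0 scaler0 theta0 scaler0.
rewrite /P /pseries thetaZ theta_p // !scalerA /sdelta -scaler_nat; congr (_ *: _).
have -> : \sum_(i < n.+1) q ^+ i = (1 - q ^+ n.+1) / (1 - q).
  apply: (canRL (mulfK _)); first by have := q1 (ltn0Sn 0); rewrite expr1.
  by rewrite -[1 - q]opprB mulrN mulrC -subrX1 opprB.
rewrite /b; field; rewrite q1 // andbT; by have := q1 (ltn0Sn 0); rewrite expr1.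
Qed.

Let tw_ode : sdelta tw = P * tw + sdelta eta_tail * w.
Proof.
have [_ dw] := newton_hexp char0 b; apply: series_ext => n.
rewrite seriesDE !seriesME -big_split /sdelta /tw -scaler_nat scalerA mulrC -scalerA scaler_nat -thetaMn.
rewrite -[w n *+ n]/(sdelta w n) dw seriesME theta_sum scaler_sumr; apply: eq_bigr => i _.
by rewrite thetaM scalerDr -scalerAr -/P -/w; congr (_ + _); rewrite scalerAl theta_P.
Qed.

(** Applying theta to the Newton equation of w shows that both sides solve the same inhomogeneous
    linear equation, with constant term 0. *)
Lemma theta_qexp n : (1 - q) *: theta (w n) = (eta_tail * w) n.
Proof.
have [w0 dw] := newton_hexp char0 b.
suff /(congr1 (fun f : series Lam => f n)) E : tw - eta_tail * w = 0.
  by apply/eqP; rewrite -subr_eq0; apply/eqP; rewrite -[RHS]E.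
apply: (@linear_ode_uniq _ (@lmod_torsion_free F char0 Lam) P).
- by rewrite /P /pseries power_sum0 scaler0.
- rewrite seriesDE seriesNE seriesM0 mul0r subr0 /tw -/(hexp b 0) [w 0%N]w0.
  have := thetaM 1 1; rewrite !mul1r !mulr1 => /eqP; rewrite -subr_eq0 opprD addrA subrr sub0r oppr_eq0.
  by move/eqP->; rewrite scaler0.
have dN (f : series Lam) : sdelta (- f) = - sdelta f.
  by apply: series_ext => m; rewrite /sdelta seriesNE mulNrn.
have alg (a x c d e : series Lam) : a * x + d * e - (d * e + c * (a * e)) = a * (x - c * e) by ring.
by rewrite sdeltaD dN sdeltaM tw_ode [sdelta w]dw; exact: alg.
Qed.

Definition qfact n : F := \prod_(i < n) (1 - q ^+ i.+1).
Let W n : Lam := qfact n *: w n.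

(** Since -1 + 1/(1 - q^k) = q^k / (1 - q^k), the product eta(z) w(z) is w(qz); the first two terms
    of eta, 1 and - p_1 z, are then split off. *)
Let eta_tail_w n : (eta_tail * w) n = q ^+ n.+1 *: w n.+1 - w n.+1 + p 1 * w n.
Proof.
have -> : q ^+ n.+1 *: w n.+1 = (eta * w) n.+1.
  rewrite /eta /w hexpM // -hexp_sscale //; apply: (hexp_ext char0) => k k0.
  rewrite /bD /b; field; exact: q1.
rewrite !seriesME !big_ord_recl /= subn0 subn1 /=.
rewrite mul0r add0r.
rewrite [eta 0%N](hexp0 char0) mul1r [eta _]hexp1 // scaleN1r mulNr.
set S := \sum_(i < n) _; rewrite -[X in _ = _ + (_ + X) - _ + _]/S.
by move: S (w n.+1) (p 1 * w n) => x y z; ring.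
Qed.

Lemma qexp_rec n : W n.+1 = p 1 * W n + (q - 1) *: theta (W n).
Proof.
rewrite /W thetaZ scalerA [X in X *: theta _]mulrC -scalerA -[q - 1]opprB scaleNr.
rewrite [X in _ *: - X]theta_qexp eta_tail_w.
rewrite /qfact big_ord_recr /= -scalerA -[_ * (_ *: _)]scalerAr -scalerDr; congr (_ *: _).
by rewrite scalerBl scale1r; move: (q ^+ n.+1 *: w n.+1) (w n.+1) (p 1 * w n) => x y z; ring.
Qed.

(** L = p_1 + (q - 1) theta sends W_j to W_(j+1), and by the Leibniz rule T_k W_j to T_(k+1) W_j +
    T_k W_(j+1); iterating gives Pascal's triangle. *)
Lemma qexp_binomial n : W n.+1 =
  \sum_(k < n.+1) (((q - 1) ^+ k *: iter k theta (p 1)) * W (n - k)) *+ 'C(n, k).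
Proof.
pose T k : Lam := (q - 1) ^+ k *: iter k theta (p 1); rewrite -/(T _).
have W0 : W 0 = 1 by rewrite /W /qfact big_ord0 scale1r /w (hexp0 char0).
pose L f := p 1 * f + (q - 1) *: theta f.
have LE k j : L (T k * W j) = T k.+1 * W j + T k * W j.+1.
  rewrite /L thetaM qexp_rec /T thetaZ iterS exprS.
  move: (iter k theta _) (W j) => f g; rewrite mulrDr scalerDr mulrCA -!scalerAl -!scalerAr !scalerA.
  by rewrite [_ ^+ k * (q - 1)]mulrC addrA addrC.
have Lsum I (r : seq I) f : L (\sum_(i <- r) f i) = \sum_(i <- r) L (f i).
  by rewrite /L theta_sum scaler_sumr mulr_sumr -big_split.
have LMn f j : L (f *+ j) = L f *+ j.
  by rewrite /L thetaMn mulrnAr -scalerMnr -mulrnDl.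
elim: n => [|n IH].
  rewrite big_ord1 qexp_rec W0 bin0 mulr1n !mulr1.
  have -> : theta 1 = 0.
    by have := thetaM 1 1; rewrite !mul1r !mulr1 => /eqP; rewrite -subr_eq0 opprD addrA subrr sub0r oppr_eq0 => /eqP.
  by rewrite scaler0 addr0 expr0 scale1r.
rewrite qexp_rec -/(L (W n.+1)) IH Lsum.
rewrite (eq_bigr (fun k : 'I_n.+1 => T k.+1 * W (n - k) *+ 'C(n, k) + T k * W (n.+1 - k) *+ 'C(n, k))); last first.
  by move=> k _; rewrite LMn LE mulrnDl subSn // -ltnS.
rewrite big_split /= [RHS]big_ord_recl /= [in RHS]/bump /=.
rewrite [X in _ = _ + X](eq_bigr (fun i : 'I_n.+1 => T i.+1 * W (n - i) *+ 'C(n, i) + T i.+1 * W (n - i) *+ 'C(n, i.+1))); last first.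
  by move=> i _; rewrite add1n subSS binS mulrnDr addrC.
rewrite big_split /= addrCA; congr (_ + _).
rewrite big_ord_recl [X in _ = _ + X]big_ord_recr /= (@bin_small n n.+1) // mulr0n addr0 !bin0; congr (_ + _).
Qed.

End QExponential.

Section InversionCount.
Variable N : nat.

Lemma card_inversion_graph n (u : n.-tuple 'I_N) :
  #|inversion_graph u| = (\sum_(i < n) \sum_(j < n) (i < j) && (tnth u j < tnth u i))%N.
Proof.
rewrite /inversion_graph card_in_imset => [|[i j] [i' j']]; last first.
  rewrite !inE /= => /andP[ij _] /andP[ij' _] /setP E.
  have := E i; have := E j; have := E i'; have := E j'.
  rewrite !inE !eqxx /= !orbT => /esym E1 /esym E2 E3 E4.
  have {}E1 : (j' = i :> nat \/ j' = j :> nat) by case/orP: (esym E1) => /eqP->; [left|right].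
  have {}E2 : (i' = i :> nat \/ i' = j :> nat) by case/orP: (esym E2) => /eqP->; [left|right].
  have {}E3 : (j = i' :> nat \/ j = j' :> nat) by case/orP: (esym E3) => /eqP->; [left|right].
  have {}E4 : (i = i' :> nat \/ i = j' :> nat) by case/orP: (esym E4) => /eqP->; [left|right].
  by congr pair; apply: ord_inj; lia.
rewrite pair_big /= -sum1dep_card [RHS](bigID (fun ij : 'I_n * 'I_n => (ij.1 < ij.2)%N && (tnth u ij.2 < tnth u ij.1)%N)) /=.
rewrite [X in (_ + X)%N]big1 ?addn0 => [|ij /negbTE->] //.
by apply: eq_bigr => ij ->.
Qed.

Lemma card_inversion_cons n (c : 'I_N) (u : n.-tuple 'I_N) :
  #|inversion_graph [tuple of c :: u]| = (\sum_(i < n) (tnth u i < c) + #|inversion_graph u|)%N.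
Proof.
rewrite !card_inversion_graph big_ord_recl /= big_ord_recl /= add0n; congr (_ + _)%N.
  by apply: eq_bigr => i _; rewrite tnthS tnth0.
apply: eq_bigr => i _; rewrite big_ord_recl /= add0n; apply: eq_bigr => j _.
by rewrite !tnthS.
Qed.

End InversionCount.

Section WordSeries.
Variables (F : fieldType) (q : F) (N : nat).
Hypothesis char0 : forall n, n.+1%:R != 0 :> F.
Hypothesis q1 : forall k, (0 < k)%N -> 1 - q ^+ k != 0.
Local Notation A := {mpoly F[N]}.
Implicit Types (y : 'I_N -> A) (s : series A).

(** The letters carry arbitrary weights [y] because removing the first letter of a word rescales
    some of them. *)
Definition inv_words n y : A :=
  \sum_(u : n.-tuple 'I_N) q ^+ #|inversion_graph u| *: \prod_(i < n) y (tnth u i).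

Definition scale_below (c : nat) y : 'I_N -> A := fun i => if (i < c)%N then q *: y i else y i.

Lemma inv_words0 y : inv_words 0 y = 1.
Proof.
rewrite /inv_words (big_pred1 [tuple]) => [|u]; last by apply/esym/eqP; exact: tuple0.
by rewrite big_ord0 card_inversion_graph big_ord0 scale1r.
Qed.

(** The first letter c forms an inversion with each later letter smaller than c, recorded as a
    factor q on that letter. *)
Lemma inv_words_cons n y : inv_words n.+1 y = \sum_(c < N) y c * inv_words n (scale_below c y).
Proof.
rewrite /inv_words (reindex (fun cu : 'I_N * n.-tuple 'I_N => [tuple of cu.1 :: cu.2])) /=; last first.
  exists (fun u : n.+1.-tuple 'I_N => (thead u, [tuple of behead u])) => [[c u] _|u _] /=.
    by congr pair; apply: val_inj.
  by rewrite [RHS]tuple_eta.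
rewrite -(pair_big xpredT xpredT (fun c (u : n.-tuple 'I_N) => q ^+ #|inversion_graph [tuple of c :: u]| *:
    \prod_(i < n.+1) y (tnth [tuple of c :: u] i))) /=.
apply: eq_bigr => c _; rewrite mulr_sumr; apply: eq_bigr => u _.
rewrite card_inversion_cons big_ord_recl tnth0 addnC exprD -scalerA -scalerAr; congr (_ *: _).
rewrite scalerAr; congr (_ * _).
rewrite [RHS](eq_bigr (fun i => q ^+ (tnth u i < c)%N *: y (tnth u i))) => [|i _]; last first.
  by rewrite /scale_below; case: ifP; rewrite ?scale1r.
rewrite scaler_prod prodrXr; congr (_ *: _); apply: eq_bigr => i _.
by rewrite tnthS.
Qed.

(** z d/dz of the logarithm of prod_i prod_(j >= 0) 1 / (1 - q^j y_i z), expanded in power sums of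
    y. *)
Definition pow_coef y : series A := fun k => if k is 0 then 0 else (1 - q ^+ k)^-1 *: \sum_i y i ^+ k.

(* Scaling y_c by q multiplies s by 1 - y_c z, so that s(z) - s(qz) telescopes
   into the sum of the y_c z s_c(z), where y_0, ..., y_(c-1) are scaled in s_c. *)
Lemma inv_words_series n y s : newton (pow_coef y) s -> qfact q n *: s n = inv_words n y.
Proof.
elim: n y s => [|n IH] y s ns.
  by case: ns => -> _; rewrite /qfact big_ord0 scale1r inv_words0.
pose f c (i : 'I_N) : series A := if (i < c)%N then 1 - seriesC (y i) * seriesX else 1.
pose sc c := s * \prod_i f c i.
(* Since 1/(1 - q^k) - 1 = q^k / (1 - q^k), multiplying by 1 - y_i z amounts to replacing y_i by q
   y_i. *)
have nsc c : newton (pow_coef (scale_below c y)) (sc c).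
  pose g (i : 'I_N) : series A := if (i < c)%N then - powers (y i) else 0.
  have nf i : newton (g i) (f c i) by rewrite /g /f; case: ifP => _; [exact: newton_lin | exact: newton0].
  have := newton_mul ns (newton_prod (index_enum 'I_N) nf).
  congr newton; apply: series_ext => -[|k]; rewrite seriesDE series_sumE /pow_coef.
    by rewrite add0r big1 // => i _; rewrite /g; case: ifP => _ //; rewrite seriesNE oppr0.
  rewrite !scaler_sumr -big_split; apply: eq_bigr => i _; rewrite /g /scale_below /=.
  case: ifP => _; last by rewrite addr0.
  rewrite seriesNE /powers exprZn scalerA -[X in _ - X]scale1r -scalerBl; congr (_ *: _).
  by field; rewrite q1.
have sc0 : sc 0%N = s by rewrite /sc big1 ?mulr1.
have scS c (lt : (c < N)%N) : sc c - sc c.+1 = seriesX * (seriesC (y (Ordinal lt)) * sc c).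
  have -> : sc c.+1 = sc c * (1 - seriesC (y (Ordinal lt)) * seriesX).
    rewrite /sc -mulrA; congr (_ * _); rewrite (bigD1 (Ordinal lt)) // [in RHS](bigD1 (Ordinal lt)) //=.
    rewrite /f /= ltnSn ltnn mul1r mulrC; congr (_ * _); apply: eq_bigr => i ne.
    by rewrite ltnS leq_eqVlt -[(i == c :> nat)%N]/(i == Ordinal lt) (negbTE ne).
  by move: (sc c) (seriesC _) (seriesX) => x1 x2 x3; ring.
have scN : sc N = sscale q%:A s.
  apply: (@newton_uniq A _ (pow_coef (scale_below N y))) => //; last first.
    have := newton_sscale q%:A ns; congr newton; apply: series_ext => -[|k]; rewrite /sscale /pow_coef ?mulr0 //.
    rewrite -scalerAr; congr (_ *: _); rewrite mulr_sumr; apply: eq_bigr => i _.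
    by rewrite /scale_below ltn_ord -exprMn mulr_algl.
  exact: lmod_torsion_free.
have tele : s - sc N = \sum_(c < N) seriesX * (seriesC (y c) * sc c).
  rewrite (eq_bigr (fun c : 'I_N => sc c - sc c.+1)) => [|c _]; last first.
    by rewrite (scS c (ltn_ord c)); congr (_ * (seriesC (y _) * _)); apply: val_inj.
  rewrite -(big_mkord xpredT (fun c => sc c - sc c.+1)) -[in LHS]sc0.
  by rewrite -[LHS]opprB -telescope_sumr // -sumrN; apply: eq_bigr => c _; rewrite opprB.
have /(congr1 (fun f : series A => f n.+1)) := tele.
rewrite scN seriesDE seriesNE /sscale series_sumE => E.
rewrite inv_words_cons /qfact big_ord_recr /= -/(qfact q n) -scalerA scalerBl scale1r.
have -> : s n.+1 - q ^+ n.+1 *: s n.+1 = \sum_(c < N) y c * sc c n.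
  have <- : q%:A ^+ n.+1 * s n.+1 = q ^+ n.+1 *: s n.+1 by rewrite -(rmorphXn (in_alg A)) mulr_algl.
  by rewrite E; apply: eq_bigr => c _; rewrite seriesXM seriesCM.
by rewrite scaler_sumr; apply: eq_bigr => c _; rewrite scalerAr (IH _ _ (nsc c)).
Qed.

End WordSeries.

(** * Connected subgraphs and Tutte polynomials *)

Section Connectivity.
Variable V : finType.
Implicit Types (A B C T E : {set {set V}}) (e f : {set V}) (x y : V).

Lemma adjacent_sym A : ssrbool.symmetric (adjacent A).
Proof. by move=> x y; rewrite /adjacent eq_sym setUC. Qed.

Lemma connect_adjacent_sym A x y : connect (adjacent A) x y = connect (adjacent A) y x.
Proof. exact: (sym_connect_sym (@adjacent_sym A)). Qed.

Lemma connect_subset A B x y : A \subset B -> connect (adjacent A) x y -> connect (adjacent B) x y.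
Proof.
move=> sAB; apply: connect_sub => {}x {}y /andP[ne inA]; apply: connect1.
by rewrite /adjacent ne (subsetP sAB).
Qed.

(** Connectivity of the endpoints stated for the edge as a set, without naming its endpoints. *)
Definition joined A e := [forall x in e, forall y in e, connect (adjacent A) x y].

Lemma joinedP A e : reflect (forall x y, x \in e -> y \in e -> connect (adjacent A) x y) (joined A e).
Proof.
apply: (iffP forall_inP) => [H x y xe ye|H x xe]; first exact: (forall_inP (H x xe)).
by apply/forall_inP => y ye; exact: H.
Qed.

Lemma joined_subset A B e : A \subset B -> joined A e -> joined B e.
Proof. by move=> sAB /joinedP H; apply/joinedP => x y xe ye; apply: connect_subset sAB (H _ _ xe ye). Qed.

Lemma joined_set2 A x y : joined A [set x; y] = connect (adjacent A) x y.
Proof.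
apply/joinedP/idP => [H|xy a b]; first by apply: H; rewrite !inE eqxx ?orbT.
by rewrite !inE => /orP[]/eqP-> /orP[]/eqP->; rewrite ?connect0 // connect_adjacent_sym.
Qed.

Lemma joined_mem A e : #|e| = 2 -> e \in A -> joined A e.
Proof.
move=> /eqP/cards2P[x [y [ne ->]]] eA; rewrite joined_set2; apply: connect1.
by rewrite /adjacent ne.
Qed.

Lemma connect_joined A B x y : (forall e, e \in A -> joined B e) ->
  connect (adjacent A) x y -> connect (adjacent B) x y.
Proof.
move=> H; apply: connect_sub => {}x {}y /andP[_ /H]; rewrite joined_set2.
by [].
Qed.

Lemma joined_trans A B e : (forall f, f \in A -> joined B f) -> joined A e -> joined B e.
Proof. by move=> H /joinedP Ae; apply/joinedP => x y xe ye; apply: connect_joined (Ae x y xe ye). Qed.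

Lemma circuit_subset A B C : A \subset B -> is_circuit A C -> is_circuit B C.
Proof.
move=> sAB /existsP[c /and3P[sc /andP[cyc uc] EC]]; apply/existsP; exists c.
rewrite sc EC /ucycleb uc !andbT; apply: sub_cycle cyc => x y /andP[ne xy].
by rewrite /adjacent ne (subsetP sAB).
Qed.

Lemma circuit_edges A C : is_circuit A C -> C \subset A.
Proof.
move=> /existsP[c /and3P[_ /andP[cyc _] /eqP->]]; apply/subsetP => _ /imsetP[x xc ->].
by have /andP[] := next_cycle cyc xc.
Qed.

Lemma circuit_neq0 A C : is_circuit A C -> C != set0.
Proof.
move=> /existsP[c /and3P[sc _ /eqP->]]; case: {+}c sc => -[|x s] //= _ _.
by apply/set0Pn; exists [set x; next (x :: s) x]; apply: imset_f; rewrite inE eqxx.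
Qed.

Lemma circuit_of_joined A e : #|e| = 2 -> e \notin A -> joined A e ->
  exists2 C, is_circuit (e |: A) C & e \in C.
Proof.
move=> /eqP/cards2P[x [y [ne ->]]] enA; rewrite joined_set2 => /connectP[s0 p0 El].
(* A simple path joining the endpoints, which [e] closes to a circuit. *)
case: (shortenP p0) El => s ps us _ El {s0 p0}.
pose c := x :: s; have sub : path (adjacent ([set x; y] |: A)) x s.
  by apply: sub_path ps => a b /andP[nab ab]; rewrite /adjacent nab !inE ab orbT.
have cyc : path.cycle (adjacent ([set x; y] |: A)) c.
  rewrite /c /= rcons_path sub -El /= /adjacent eq_sym ne setUC.
  by rewrite !inE eqxx.
(* A path consisting of a single edge would be [e] itself, which is not in [A]. *)
have sz : (2 < size c)%N.
  rewrite /c; case: s ps us El {c sub cyc} => [|a [|b s]] //= ps _ El.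
    by rewrite El eqxx in ne.
  by move: ps; rewrite -El /= andbT => /andP[_]; rewrite (negbTE enA).
have szV : (size c <= #|V|)%N by rewrite -(card_uniqP us) max_card.
exists [set [set z; next c z] | z in c].
  by apply/existsP; exists (Bseq szV); rewrite sz /ucycleb cyc us /=.
apply/imsetP; exists y; first by rewrite El mem_last.
rewrite setUC; congr [set _; _].
have Ey : y = nth x c (size s) by rewrite El -[size s]/(size c).-1 nth_last.
by rewrite Ey next_nth mem_nth // index_uniq //= nth_default.
Qed.

(** Go round the circuit the other way, from the successor of z back to z. *)
Lemma joined_circuit A C e : is_circuit A C -> e \in C -> joined (C :\ e) e.
Proof.
move=> /existsP[c /and3P[sc /andP[cyc uc] /eqP->]] /imsetP[z zc ->].
have [i s Es] := rot_to zc.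
have nx a : next c a = next (z :: s) a by rewrite -Es next_rot.
have uzs : uniq (z :: s) by rewrite -Es rot_uniq.
have szs : (2 < size (z :: s))%N by rewrite -Es size_rot.
have adj a : a \in c -> adjacent A a (next c a) by move=> ac; exact: next_cycle cyc ac.
have mem a : (a \in c) = (a \in z :: s) by rewrite -Es mem_rot.
case: s Es nx uzs szs mem => [|y [|w s]] // Es nx uzs _ mem.
have fc := cycle_next uzs.
have nz : next c z = y by rewrite nx /= eqxx.
have ny : next c y = w.
  rewrite nx /=; move: uzs; rewrite /= !inE !negb_or => /andP[/andP[zy _] _].
  by rewrite eqxx eq_sym (negbTE zy).
rewrite nz joined_set2 connect_adjacent_sym.
have fp : path (frel (next c)) y (rcons (w :: s) z).
  have : fpath (next (z :: y :: w :: s)) y (rcons (w :: s) z) by case/andP: fc.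
  by apply: sub_path => a b /=; rewrite nx.
have ends : all (fun a => (a != z) && (a \in c)) (belast y (rcons (w :: s) z)).
  rewrite belast_rcons; apply/allP => a ain; rewrite mem inE ain orbT andbT.
  by apply: contraTneq ain => ->; case/andP: uzs.
set D := _ :\ _.
have walk l a : fpath (next c) a l -> all (fun a => (a != z) && (a \in c)) (belast a l) ->
    connect (adjacent D) a (last a l); last by have := walk _ _ fp ends; rewrite last_rcons.
elim: l a => [|b l IH] a //=; move=> /andP[/eqP <- pl] /andP[/andP[az ac] al].
apply: connect_trans (IH _ pl al).
apply: connect1; have /andP[ne _] := adj a ac; rewrite /adjacent ne in_setD1 (imset_f (fun x => [set x; next c x]) ac) andbT.
(* For a other than z, the edge from a to its successor is {z, y} only if a = y and y is followed by
   z; a circuit of length at least 3 excludes this. *)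
apply: contra_neqN az => /eqP/setP E.
have := E a; rewrite !inE eqxx /= => /esym/orP[/eqP//|/eqP Ea].
have := E z; rewrite !inE eqxx /= => /orP[/eqP//|/eqP]; rewrite Ea ny => zw.
by move: uzs; rewrite zw /= !inE eqxx orbT.
Qed.

End Connectivity.

(** * Kruskal trees and external activity *)

Section SpanningTrees.
Variable V : finType.
Implicit Types (A B C T E : {set {set V}}) (e f : {set V}) (x y : V).

(* Each vertex other than r is joined to a neighbour closer to r; these edges
   form a connected subgraph with #|V| - 1 edges, hence all of T. *)
Lemma card_spanning_tree E T (r : V) : (forall e, e \in E -> #|e| = 2) ->
  spanning_tree E T -> #|T| = #|V|.-1.
Proof.
move=> E2 /and3P[TE /forallP conn /forallP acyc].
have T2 e : e \in T -> #|e| = 2 by move=> eT; apply: E2; exact: (subsetP TE).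
have exP v : exists n, [exists s : n.-tuple V, path (adjacent T) r s && (last r s == v)].
  have /connectP[s ps ->] := forallP (conn r) v.
  by exists (size s); apply/existsP; exists (in_tuple s); rewrite ps eqxx.
pose dist v := ex_minn (exP v).
have distP v : exists s, [/\ size s = dist v, path (adjacent T) r s & last r s = v].
  rewrite /dist; case: ex_minnP => n /existsP[s /andP[ps /eqP l]] _.
  by exists s; rewrite size_tuple.
have dist_le s : path (adjacent T) r s -> (dist (last r s) <= size s)%N.
  move=> ps; rewrite /dist; case: ex_minnP => n _; apply.
  by apply/existsP; exists (in_tuple s); rewrite ps eqxx.
have exPar v : exists u, v != r -> adjacent T u v /\ (dist u < dist v)%N.
  have [s [sz ps l]] := distP v; case/lastP: s sz ps l => [|s u] sz ps l.
    by exists r; rewrite -l eqxx.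
  exists (last r s) => _; move: ps; rewrite rcons_path last_rcons in l *; rewrite l => /andP[ps adj].
  by split=> //; rewrite -sz size_rcons ltnS; exact: dist_le.
have [par parP] := boolp.choice exPar.
pose P := [set [set par v; v] | v in [set~ r]].
have PT : P \subset T.
  apply/subsetP => e /imsetP[v]; rewrite !inE => vr ->.
  by have [/andP[]] := parP v vr.
have connP v : connect (adjacent P) r v.
  have [n] := ubnP (dist v); elim: n v => // n IH v lt.
  have [->|vr] := eqVneq v r; first exact: connect0.
  have [/andP[ne _] lt'] := parP v vr; apply: connect_trans (IH (par v) _) _; first exact: leq_trans lt' lt.
  by apply: connect1; rewrite /adjacent ne; apply: imset_f; rewrite !inE.
have -> : T = P.
  apply/eqP; rewrite eqEsubset PT andbT; apply/subsetP => e eT; apply/negPn/negP => eP.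
  have je : joined P e.
    by apply/joinedP => x y _ _; apply: connect_trans (connP y); rewrite connect_adjacent_sym.
  have [C] := circuit_of_joined (T2 e eT) eP je.
  move=> /(circuit_subset (B := T)); rewrite (negbTE (acyc C)); move=> H.
  by have := H _; rewrite subUset PT sub1set eT => /(_ isT).
rewrite card_in_imset => [|v v']; first by rewrite cardsC1.
(* Distinct vertices sharing the edge to their parents would be each other's parent, against the
   decrease of [dist]. *)
rewrite !inE => vr vr' /setP E'; apply/eqP/negPn/negP => ne.
have [_ lt] := parP v vr; have [_ lt'] := parP v' vr'.
have := E' v; rewrite !inE eqxx orbT (negbTE ne) orbF => /esym/eqP Ev.
have := E' v'; rewrite !inE eqxx orbT [v' == v]eq_sym (negbTE ne) orbF => /eqP Ev'.
by rewrite -Ev' in lt; rewrite -Ev in lt'; move: lt lt'; lia.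
Qed.

Variable le : rel {set V}.
Hypotheses (le_total : total le) (le_anti : antisymmetric le) (le_trans : transitive le).

Let le_refl e : le e e. Proof. by have := le_total e e; rewrite orbb. Qed.

Definition above A e := [set f in A | le e f && (e != f)].

(** Kruskal's spanning forest, built from the largest edge downwards; since activity is about
    minimal edges, the edges dropped are the externally active ones. *)
Definition kept A := [set e in A | ~~ joined (above A e) e].

Let above_trans A e f : f \in above A e -> above A f \proper above A e.
Proof.
rewrite !inE => /and3P[fA ef ne]; apply/properP; split.
  apply/subsetP => g; rewrite !inE => /and3P[-> fg nfg]; rewrite (le_trans ef fg) /=.
  by apply: contra_neq nfg => Eeg; apply: le_anti; rewrite fg -Eeg ef.
by exists f; rewrite !inE fA ?ef ?ne // eqxx !andbF.
Qed.

(** A dropped edge is joined by strictly larger edges of A, each of which is joined by kept edges at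
    least as large, by induction. *)
Lemma kept_joined A e : (forall e, e \in A -> #|e| = 2) -> e \in A ->
  joined [set f in kept A | le e f] e.
Proof.
move=> A2; have [n] := ubnP #|above A e|; elim: n e => // n IH e lt eA.
have [eK|] := boolP (e \in kept A); first by apply: joined_mem; rewrite ?A2 // inE eK le_refl.
rewrite inE eA negbK /=; apply: joined_trans => f fe.
have [fA ef] : f \in A /\ le e f by move: fe; rewrite !inE => /and3P[].
apply: joined_subset (IH f _ fA); last by apply: leq_trans (proper_card (above_trans fe)) _.
by apply/subsetP => g; rewrite !inE => /andP[-> /(le_trans ef)->].
Qed.

Lemma kept_connected A : (forall e, e \in A -> #|e| = 2) -> connected_graph A -> connected_graph (kept A).
Proof.
move=> A2 /forallP conn; apply/forallP => x; apply/forallP => y.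
apply: connect_joined (forallP (conn x) y) => e eA; apply: joined_subset (kept_joined A2 eA).
by apply/subsetP => f; rewrite inE => /andP[].
Qed.

Lemma circuit_min A C : is_circuit A C -> exists2 e, e \in C & forall f, f \in C -> le e f.
Proof.
move=> /circuit_neq0/set0Pn[e0 e0C].
have [e eC emax] := arg_maxnP (fun e => #|[set f in C | le e f]|) e0C.
exists e => // f fC; apply: contraT => nle; have := emax f fC; rewrite /geq /= leqNgt => /negP[].
have fe : le f e by have := le_total e f; rewrite (negbTE nle).
apply: proper_card; apply/properP; split; last by exists f; rewrite !inE fC ?le_refl ?(negbTE nle).
by apply/subsetP => g; rewrite !inE => /andP[-> /(le_trans fe)].
Qed.

Lemma above_circuit C e : (forall f, f \in C -> le e f) -> C :\ e \subset above C e.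
Proof.
by move=> emin; apply/subsetP => f; rewrite !inE eq_sym => /andP[-> fC]; rewrite fC emin.
Qed.

Lemma above_subset A B e : A \subset B -> above A e \subset above B e.
Proof. by move=> /subsetP AB; apply/subsetP => f; rewrite !inE => /andP[/AB->]. Qed.

(** The smallest edge of a circuit is joined by the rest of the circuit, which lies above it, so it
    is not kept. *)
Lemma kept_acyclic A C : ~~ is_circuit (kept A) C.
Proof.
apply/negP => CK; have [e eC emin] := circuit_min CK.
have CA : C \subset A.
  by apply: subset_trans (circuit_edges CK) _; apply/subsetP => f; rewrite inE => /andP[].
have := subsetP (circuit_edges CK) e eC; rewrite inE => /andP[_ /negP]; apply.
apply: joined_subset (joined_circuit CK eC); apply: subset_trans (above_circuit emin) _.
exact: above_subset.
Qed.

Lemma kept_spanning E A : (forall e, e \in E -> #|e| = 2) -> A \subset E -> connected_graph A ->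
  spanning_tree E (kept A).
Proof.
move=> E2 AE conn; apply/and3P; split.
- by apply: subset_trans AE; apply/subsetP => f; rewrite inE => /andP[].
- by apply: kept_connected => // e eA; apply: E2; exact: (subsetP AE).
- by apply/forallP => C; exact: kept_acyclic.
Qed.

Definition ext_edges E T := [set e in E :\: T | [exists C, is_circuit (e |: T) C && minimal_in le C e]].

(* The fibres of kept: A keeps T iff it adds to T only externally active edges. *)
Lemma keptE E T A : (forall e, e \in E -> #|e| = 2) -> spanning_tree E T -> A \subset E ->
  (kept A == T) = (T \subset A) && (A :\: T \subset ext_edges E T).
Proof.
move=> E2 /and3P[TE conn /forallP acyc] AE.
have A2 e : e \in A -> #|e| = 2 by move=> eA; apply: E2; exact: (subsetP AE).
apply/eqP/andP => [<-|[TA ext]].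
  split; first by apply/subsetP => f; rewrite inE => /andP[].
  apply/subsetP => e; rewrite inE => /andP[eK eA]; rewrite inE in_setD eK (subsetP AE e eA) /=.
  move: eK; rewrite inE eA /= negbK => je.
  (* The larger edges joining e can be replaced by kept ones, still above e; with e they form a
     circuit in which e is minimal. *)
  have je' : joined (above (kept A) e) e.
    apply: joined_trans je => f fe; have [fA ef ne] : [/\ f \in A, le e f & e != f].
      by move: fe; rewrite !inE => /and3P[].
    apply: joined_subset (kept_joined A2 fA); apply/subsetP => g; rewrite !inE => /andP[-> fg].
    rewrite (le_trans ef fg) /=; apply: contra_neq ne => Eeg.
    by apply: le_anti; rewrite ef Eeg fg.
  have [|C CC eC] := circuit_of_joined (A2 e eA) _ je'; first by rewrite !inE eqxx !andbF.
  apply/existsP; exists C; rewrite /minimal_in eC /=; apply/andP; split.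
    apply: circuit_subset CC; apply: setUS; apply/subsetP => f; rewrite inE => /andP[].
    by [].
  apply/forall_inP => f /(subsetP (circuit_edges CC)); rewrite !inE => /orP[/eqP->//|].
  by case/and3P.
have extP e : e \in A -> e \notin T -> exists C, [/\ is_circuit (e |: T) C, e \in C & forall f, f \in C -> le e f].
  move=> eA eT; have := subsetP ext e; rewrite !inE eT eA => /(_ isT)/andP[_ /existsP[C /andP[CC /andP[eC /forall_inP emin]]]].
  by exists C.
have extT e : e \in A -> e \notin T -> joined (above T e) e.
  move=> eA eT; have [C [CC eC emin]] := extP e eA eT.
  apply: joined_subset (joined_circuit CC eC); apply/subsetP => f; rewrite !inE => /andP[fe fC].
  have := subsetP (circuit_edges CC) f fC; rewrite !inE (negbTE fe) /= => ->.
  by rewrite emin // eq_sym fe.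
apply/setP => e; rewrite inE; have [eT|eT] := boolP (e \in T); last first.
  apply/negbTE; rewrite negb_and negbK; case: (boolP (e \in A)) => //= eA.
  by apply: joined_subset (extT e eA eT); exact: above_subset.
(* If larger edges of A joined an edge e of T, then so would larger edges of T, by [extT]; T would
   contain a circuit. *)
rewrite (subsetP TA) //=; apply/negP => je.
have je' : joined (above T e) e.
  apply: joined_trans je => f; rewrite !inE => /and3P[fA ef ne].
  have [fT|fT] := boolP (f \in T); first by apply: joined_mem; rewrite ?A2 // !inE fT ef ne.
  apply: joined_subset (extT f fA fT); apply/subsetP => g; rewrite !inE => /and3P[-> fg _].
  rewrite (le_trans ef fg) /=; apply: contra_neq ne => Eeg.
  by apply: le_anti; rewrite ef Eeg fg.
have [|C CC _] := circuit_of_joined (A2 e (subsetP TA e eT)) _ je'; first by rewrite !inE eqxx !andbF.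
have /negP := acyc C; apply; apply: circuit_subset CC; rewrite subUset sub1set eT.
by apply/subsetP => f; rewrite inE => /andP[].
Qed.

End SpanningTrees.

Section TutteSubgraphs.
Variables (V : finType) (R : comNzRingType).
Implicit Types (A B C T E : {set {set V}}).

Lemma sum_subset_exp (I : finType) (X : {set I}) (z : R) :
  \sum_(B : {set I} | B \subset X) z ^+ #|B| = (1 + z) ^+ #|X|.
Proof.
rewrite addrC -prodr_const [RHS]big_mkcond /=.
rewrite [RHS](eq_bigr (fun i => (if i \in X then z else 0) + 1)) => [|i _]; last by case: ifP; rewrite ?add0r.
rewrite bigA_distr big_mkcond; apply: eq_bigr => B _ /=; have [BX|] := boolP (B \subset X).
  rewrite -prodr_const big_mkcond; apply: eq_bigr => i _; case: ifP => // iB.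
  by rewrite (subsetP BX).
by move=> /subsetPn[i iB iX]; rewrite (bigD1 i) //= iB (negbTE iX) mul0r.
Qed.

Variable le : rel {set V}.
Hypotheses (le_total : total le) (le_anti : antisymmetric le) (le_trans : transitive le).

Lemma sum_connected_subgraphs E (r : V) (z : R) : (forall e, e \in E -> #|e| = 2) ->
  \sum_(A : {set {set V}} | (A \subset E) && connected_graph A) z ^+ #|A| =
    z ^+ #|V|.-1 * tutte le E 1 (1 + z).
Proof.
move=> E2; rewrite (partition_big (kept le) (spanning_tree E)) /= => [|A /andP[AE conn]]; last exact: kept_spanning.
rewrite /tutte mulr_sumr; apply: eq_bigr => T sT.
have [TE conn _] := and3P sT.
rewrite expr1n mul1r -[ext_activity _ _ _]/#|ext_edges le E T| -sum_subset_exp mulr_sumr.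
(* By [keptE], the fibre over T consists of the T :|: B with B a set of externally active edges. *)
rewrite (reindex_onto (fun B => T :|: B) (fun A => A :\: T)) /=; last first.
  move=> A /andP[/andP[AE _]]; rewrite (keptE le_total le_anti le_trans E2 sT) // => /andP[TA _].
  by rewrite -{1}(setIidPr TA) setID.
have extE : ext_edges le E T \subset E :\: T by apply/subsetP => e; rewrite inE => /andP[].
rewrite -(card_spanning_tree r E2 sT); apply: eq_big => [B|B].
  apply/idP/idP => [/andP[/andP[/andP[TBE _] K] /eqP EB]|BX].
    by move: K; rewrite (keptE le_total le_anti le_trans E2 sT) // EB => /andP[].
  have BE : B \subset E :\: T := subset_trans BX extE.
  have EB : (T :|: B) :\: T = B.
    apply/setP => e; rewrite !inE; case: (boolP (e \in T)) => //= eT.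
    by apply/esym/negbTE; apply/negP => /(subsetP BE); rewrite inE eT.
  have TBE : T :|: B \subset E by rewrite subUset TE (subset_trans BE) // subsetDl.
  rewrite EB eqxx andbT (keptE le_total le_anti le_trans E2 sT TBE) EB BX subsetUl TBE /= andbT.
  by apply/forallP => x; apply/forallP => y; apply: connect_subset (forallP (forallP conn x) y); exact: subsetUl.
move=> /andP[_ /eqP EB]; rewrite -exprD; congr (_ ^+ _).
rewrite cardsU (_ : T :&: B = set0) ?cards0 ?subn0 //.
by apply/setP => e; rewrite -EB !inE; case: (e \in T); rewrite ?andbF.
Qed.

End TutteSubgraphs.

(** * Decomposing words along a connected component *)

Section Components.
Implicit Types (V : finType).

Definition component_of V (A : {set {set V}}) (r : V) := [set x | connect (adjacent A) r x].

Definition induced V (E : {set {set V}}) (S : {set V}) := [set e in E | e \subset S].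

Lemma component_sub V (A : {set {set V}}) (r : V) (S : {set V}) :
  r \in S -> (forall x y, x \in S -> adjacent A x y -> y \in S) -> component_of A r \subset S.
Proof.
move=> rS clos; apply/subsetP => x; rewrite inE => /connectP[s ps ->].
elim: s r rS ps => [|y s IH] r rS //= /andP[ry ps].
by apply: IH ps; exact: clos ry.
Qed.

Lemma component_step V (A : {set {set V}}) (r x y : V) :
  x \in component_of A r -> adjacent A x y -> y \in component_of A r.
Proof. by rewrite !inE => rx xy; apply: connect_trans rx (connect1 xy). Qed.

Lemma component_refl V (A : {set {set V}}) (r : V) : r \in component_of A r.
Proof. by rewrite inE connect0. Qed.

Lemma connected_component V (A : {set {set V}}) (r : V) : connected_graph A = (component_of A r == setT).
Proof.
apply/forallP/eqP => [conn|E x].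
  by apply/setP => x; rewrite !inE (forallP (conn r)).
apply/forallP => y; have c z : connect (adjacent A) r z by have := in_setT z; rewrite -E inE.
by apply: connect_trans (c y); rewrite connect_adjacent_sym.
Qed.

(** No edge of A crosses the boundary of the component S of r, so A splits into its parts inside and
    outside S. The inner part is still a graph on V, hence the condition on its component in place
    of connectedness. *)
Lemma sum_by_component V (R : comNzRingType) (E : {set {set V}}) (r : V) (z : R) :
    (forall e, e \in E -> #|e| = 2) ->
  \sum_(A : {set {set V}} | A \subset E) z ^+ #|A| =
    \sum_(S : {set V} | r \in S)
      (\sum_(A : {set {set V}} | (A \subset induced E S) && (component_of A r == S)) z ^+ #|A|)
      * (\sum_(B : {set {set V}} | B \subset induced E (~: S)) z ^+ #|B|).
Proof.
move=> E2; rewrite (partition_big (fun A => component_of A r) (fun S => r \in S)) /=; last first.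
  by move=> A _; exact: component_refl.
apply: eq_bigr => S rS; rewrite big_distrlr pair_big /=.
have disj (e : {set V}) : #|e| = 2 -> e \subset S -> e \subset ~: S -> false.
  move=> e2 eS eC; have : e \subset S :&: ~: S by rewrite subsetI eS.
  by rewrite setICr subset0 => /eqP e0; rewrite e0 cards0 in e2.
have indE (X : {set V}) (A : {set {set V}}) : A \subset induced E X -> A \subset E.
  by move=> AX; apply: subset_trans AX _; apply/subsetP => e; rewrite inE => /andP[].
rewrite (reindex_onto (fun AB : {set {set V}} * {set {set V}} => AB.1 :|: AB.2)
   (fun A => (induced A S, induced A (~: S)))) /=; last first.
  move=> A /andP[AE /eqP EA]; apply/setP => e; rewrite !inE -andb_orr andb_idr // => eA.
  have /eqP/cards2P[x [y [ne Ee]]] := E2 e (subsetP AE e eA).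
  have xy : adjacent A x y by rewrite /adjacent ne -Ee.
  have yx : adjacent A y x by rewrite adjacent_sym.
  rewrite Ee !subUset !sub1set !inE.
  have [xS|xS] := boolP (x \in S); rewrite -EA in xS.
    by rewrite -{1}EA (component_step xS xy).
  have [yS|yS] := boolP (y \in S); rewrite ?orbT //.
  by rewrite -EA in yS; rewrite (component_step yS yx) in xS.
apply: eq_big => [[A B]|[A B]] /=.
  apply/idP/idP.
    move=> /andP[/andP[ABE /eqP comp] /eqP[EA EB]].
    have sub X : induced (A :|: B) X \subset induced E X.
      by apply/subsetP => e; rewrite !inE => /andP[H ->]; rewrite andbT (subsetP ABE) // inE.
    have AS : A \subset induced E S by rewrite -{1}EA.
    have BS : B \subset induced E (~: S) by rewrite -{1}EB.
    rewrite AS BS andbT /= eqEsubset; apply/andP; split.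
      apply: component_sub => // x y xS /andP[_ /(subsetP AS)]; rewrite inE => /andP[_ /subsetP]; apply.
      by rewrite !inE eqxx orbT.
    rewrite -{1}comp; apply: component_sub; first exact: component_refl.
    move=> x y xc xy; apply: component_step (xc) _.
    have xS : x \in S.
      by rewrite -comp; move: xc; rewrite !inE; apply: connect_subset; exact: subsetUl.
    have yS : y \in S by rewrite -comp; apply: component_step xy; rewrite comp.
    have /andP[ne xyE] := xy; rewrite /adjacent ne -EA in_set xyE.
    by rewrite subUset !sub1set xS yS.
  move=> /andP[/andP[AS /eqP comp] BS].
  have AE := indE _ _ AS; have BE := indE _ _ BS.
  rewrite subUset AE BE /=; apply/andP; split.
    rewrite eqEsubset; apply/andP; split.
      apply: component_sub => // x y xS /andP[_]; rewrite inE => /orP[/(subsetP AS)|/(subsetP BS)].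
        by rewrite inE => /andP[_ /subsetP]; apply; rewrite !inE eqxx orbT.
      by rewrite inE => /andP[_ /subsetP/(_ x)]; rewrite !inE eqxx xS => /(_ isT).
    rewrite -{1}comp; apply: component_sub; first exact: component_refl.
    move=> x y xc xy; apply: component_step (xc) _; move: xy; rewrite /adjacent inE => /andP[-> ->] //.
  apply/eqP; congr pair; apply/setP => e; rewrite !inE.
    apply/andP/idP => [[/orP[//|eB] eS]|eA]; last first.
      by rewrite eA; split=> //; have := subsetP AS e eA; rewrite inE => /andP[].
    have := subsetP BS e eB; rewrite inE => /andP[eE /(disj e (E2 e eE) eS)].
    by [].
  apply/andP/idP => [[/orP[eA|//] eS]|eB]; last first.
    by rewrite eB orbT; split=> //; have := subsetP BS e eB; rewrite inE => /andP[].
  have := subsetP AS e eA; rewrite inE => /andP[eE eS']; have := disj e (E2 e eE) eS' eS.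
  by [].
move=> /andP[/andP[ABE /eqP comp] /eqP[EA EB]]; rewrite -exprD; congr (_ ^+ _).
rewrite cardsU (_ : A :&: B = set0) ?cards0 ?subn0 //; apply/setP => e; rewrite [RHS]inE.
apply/negbTE/negP; rewrite inE => /andP[eA eB]; have eE : e \in E by rewrite (subsetP ABE) // inE eA.
have eS : e \subset S by have := eA; rewrite -EA inE => /andP[].
have eC : e \subset ~: S by have := eB; rewrite -EB inE => /andP[].
by have := disj e (E2 e eE) eS eC.
Qed.

Section Transport.
Variables (U V : finType) (f : U -> V) (E : {set {set V}}).
Hypothesis f_inj : injective f.
Let S := f @: [set: U].

(** The subgraph induced on the image of [f], read as a graph on [U]; with [enum_val] for [f], a
    graph on S becomes one on ['I_#|S|]. *)
Definition pullback := [set e : {set U} | f @: e \in E].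
Let img (A : {set {set U}}) : {set {set V}} := [set f @: e | e : {set U} in A].

Let imf_inj : injective (fun e : {set U} => f @: e). Proof. exact: imset_inj. Qed.

Let img_pre (A : {set {set V}}) : A \subset induced E S -> img [set e : {set U} | f @: e \in A] = A.
Proof.
move=> AS; apply/setP => e; apply/imsetP/idP => [[e']|eA]; first by rewrite inE => ? ->.
have fe : f @: (f @^-1: e) = e.
  have := subsetP AS e eA; rewrite inE => /andP[_ /subsetP eS].
  apply/setP => x; apply/imsetP/idP => [[a]|xe]; first by rewrite inE => ? ->.
  by have /imsetP[a _ Ex] := eS x xe; exists a; rewrite ?inE -?Ex.
by exists (f @^-1: e); rewrite ?inE fe.
Qed.

Let img_sub A : (img A \subset induced E S) = (A \subset pullback).
Proof.
apply/subsetP/subsetP => H e.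
  by move=> eA; have := H _ (imset_f (fun e : {set U} => f @: e) eA); rewrite !inE => /andP[].
move=> /imsetP[e' e'A ->]; have := H e' e'A; rewrite !inE => -> /=.
by apply: imsetS; exact: subsetT.
Qed.

Let card_img A : #|img A| = #|A|. Proof. exact: card_imset. Qed.

Let adjacent_img A x y : adjacent (img A) (f x) (f y) = adjacent A x y.
Proof.
rewrite /adjacent (inj_eq f_inj); congr (_ && _).
have -> : [set f x; f y] = f @: [set x; y] by rewrite imsetU !imset_set1.
exact: (mem_imset _ _ imf_inj).
Qed.

Let component_img A r : component_of (img A) (f r) = f @: component_of A r.
Proof.
apply/eqP; rewrite eqEsubset; apply/andP; split.
  apply: component_sub => [|_ y /imsetP[x xr ->] xy]; first by apply: imset_f; exact: component_refl.
  have [y' Ey] : exists y', y = f y'.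
    move: xy => /andP[_ /imsetP[e _ /setP/(_ y)]]; rewrite !inE eqxx orbT => /esym/imsetP[y' _ ->].
    by exists y'.
  by rewrite Ey in xy *; apply: imset_f; apply: component_step xr _; rewrite -adjacent_img.
apply/subsetP => _ /imsetP[x xr ->].
have sub : component_of A r \subset [set x | f x \in component_of (img A) (f r)].
  apply: component_sub => [|a b]; first by rewrite inE component_refl.
  by rewrite !in_set => ac ab; apply: connect_trans ac (connect1 _); rewrite adjacent_img.
by have := subsetP sub x xr; rewrite in_set.
Qed.

Lemma sum_component_pullback (R : comNzRingType) (r : U) (z : R) :
  \sum_(A : {set {set V}} | (A \subset induced E S) && (component_of A (f r) == S)) z ^+ #|A| =
  \sum_(A : {set {set U}} | (A \subset pullback) && connected_graph A) z ^+ #|A|.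
Proof.
rewrite (reindex_onto img (fun A => [set e : {set U} | f @: e \in A])) /=; last first.
  by move=> A /andP[AS _]; exact: img_pre.
apply: eq_big => A; last by rewrite card_img.
rewrite img_sub (connected_component _ r) component_img (inj_eq imf_inj).
rewrite (_ : [set e : {set U} | f @: e \in img A] = A) ?eqxx ?andbT //.
by apply/setP => e; rewrite inE (mem_imset _ _ imf_inj).
Qed.

Lemma card_induced_pullback : #|induced E S| = #|pullback|.
Proof.
rewrite -card_img; congr #|pred_of_set _|; rewrite -[LHS](img_pre (subxx _)); congr (img _).
apply/setP => e; rewrite !inE (_ : f @: e \subset S) ?andbT //.
by apply: imsetS; exact: subsetT.
Qed.

End Transport.
End Components.

Section WordDecomposition.
Variables (F : fieldType) (N : nat) (z : F).
Local Notation A := {mpoly F[N]}.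
Variable y : 'I_N -> A.

Lemma inversion_graph_card2 n (u : n.-tuple 'I_N) e : e \in inversion_graph u -> #|e| = 2.
Proof.
move=> /imsetP[[i j]]; rewrite inE => /andP[/= ij _] ->; rewrite cards2.
by rewrite -val_eqE neq_ltn ij.
Qed.

Definition subword n (S : {set 'I_n}) (u : n.-tuple 'I_N) : #|S|.-tuple 'I_N :=
  [tuple tnth u (enum_val i) | i < #|S|].

Lemma enum_val_lt n (S : {set 'I_n}) (i j : 'I_#|S|) :
  (i < j)%N = (val (enum_val i) < val (enum_val j))%N.
Proof.
have srt : sorted ltn (map val (enum S)).
  have -> : enum S = filter (mem S) (enum 'I_n) by rewrite enumT.
  apply: (subseq_sorted ltn_trans (s2 := map val (enum 'I_n))); first exact: map_subseq (filter_subseq _ _).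
  by rewrite val_enum_ord iota_ltn_sorted.
have H a b : (a < b)%N -> (b < #|S|)%N -> (nth 0%N (map val (enum S)) a < nth 0%N (map val (enum S)) b)%N.
  by move=> ab bS; apply: (sorted_ltn_nth ltn_trans 0%N srt); rewrite ?inE ?size_map -?cardE //; exact: ltn_trans ab bS.
have E (k : 'I_#|S|) : val (enum_val k) = nth 0%N (map val (enum S)) k.
  by rewrite (nth_map (enum_default k)) // -cardE.
have mono (a b : 'I_#|S|) : (a < b)%N -> (val (enum_val a) < val (enum_val b))%N.
  by move=> ab; rewrite !E; apply: H.
apply/idP/idP; first exact: mono.
by apply: contraTT; rewrite -!leqNgt leq_eqVlt => /orP[/eqP/val_inj->|/mono/ltnW].
Qed.

(** [enum_val] is increasing, so the inversions of a subword are those of the word at positions in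
    S. *)
Lemma pullback_inversion n (S : {set 'I_n}) (u : n.-tuple 'I_N) :
  pullback (@enum_val _ S) (inversion_graph u) = inversion_graph (subword S u).
Proof.
apply/setP => e; rewrite inE; apply/imsetP/imsetP => [[[i j]]|[[a b]]]; rewrite inE /=.
  move=> /andP[ij uij] E.
  have /imsetP[a ae Ea] : i \in @enum_val _ S @: e by rewrite E !inE eqxx.
  have /imsetP[b be Eb] : j \in @enum_val _ S @: e by rewrite E !inE eqxx orbT.
  exists (a, b) => /=; first by rewrite inE /= !tnth_mktuple -Ea -Eb uij andbT enum_val_lt -Ea -Eb.
  apply: (imset_inj (@enum_val_inj _ S)); rewrite E Ea Eb.
  by rewrite imsetU !imset_set1.
rewrite !tnth_mktuple => /andP[ab uab] ->.
exists (enum_val a, enum_val b); first by rewrite inE /= -enum_val_lt ab.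
by rewrite /= imsetU !imset_set1.
Qed.

Lemma imset_enum_val n (S : {set 'I_n}) : @enum_val _ S @: setT = S.
Proof.
apply/setP => i; apply/imsetP/idP => [[a _ ->]|iS]; first exact: enum_valP.
by exists (enum_rank_in iS i); rewrite ?enum_rankK_in.
Qed.

(** A word is determined by its restrictions to S and to the complement, and the numbers of words
    match, so restriction is a bijection. *)
Lemma sum_words_split n (S : {set 'I_n}) (K : #|S|.-tuple 'I_N -> F) (L : #|~: S|.-tuple 'I_N -> F) :
  \sum_(u : n.-tuple 'I_N) (K (subword S u) * L (subword (~: S) u)) *: \prod_(i < n) y (tnth u i) =
  (\sum_u K u *: \prod_i y (tnth u i)) * (\sum_u L u *: \prod_i y (tnth u i)).
Proof.
rewrite big_distrlr pair_big /=.
pose h (u : n.-tuple 'I_N) := (subword S u, subword (~: S) u).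
have h_inj : injective h.
  move=> u u' E; have /(congr1 val) /= E1 : subword S u = subword S u' := congr1 fst E.
  have /(congr1 val) /= E2 : subword (~: S) u = subword (~: S) u' := congr1 snd E; apply: eq_from_tnth => i.
  have [iS|] := boolP (i \in S).
    have := congr1 (fun s => nth (tnth u i) s (enum_rank_in iS i)) E1.
    by rewrite !nth_mktuple enum_rankK_in.
  rewrite -in_setC => iS; have := congr1 (fun s => nth (tnth u i) s (enum_rank_in iS i)) E2.
  by rewrite !nth_mktuple enum_rankK_in.
have h_bij : bijective h.
  apply: inj_card_bij => //; rewrite card_prod !card_tuple !card_ord -expnD.
  by rewrite cardsC card_ord.
rewrite [RHS](reindex h) /=; last exact: onW_bij.
apply: eq_bigr => u _; rewrite -scalerAl -scalerAr scalerA; congr (_ *: _).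
rewrite (bigID (mem S)) /= big_enum_val; congr (_ * _).
  by apply: eq_bigr => i _; rewrite tnth_mktuple.
rewrite (eq_bigl (mem (~: S))) => [|i]; last by rewrite /= in_setC.
by rewrite big_enum_val; apply: eq_bigr => i _; rewrite tnth_mktuple.
Qed.

Definition connected_words n : A :=
  \sum_(u : n.-tuple 'I_N)
    (\sum_(B : {set {set 'I_n}} | (B \subset inversion_graph u) && connected_graph B) z ^+ #|B|)
      *: \prod_(i < n) y (tnth u i).

Lemma inv_words_component n : inv_words (1 + z) n.+1 y =
  \sum_(S : {set 'I_n.+1} | ord0 \in S) connected_words #|S| * inv_words (1 + z) #|~: S| y.
Proof.
transitivity (\sum_(S : {set 'I_n.+1} | ord0 \in S) \sum_(u : n.+1.-tuple 'I_N)
   ((\sum_(B : {set {set 'I_#|S|}} | (B \subset inversion_graph (subword S u)) && connected_graph B) z ^+ #|B|)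
     * (1 + z) ^+ #|inversion_graph (subword (~: S) u)|) *: \prod_(i < n.+1) y (tnth u i)).
  rewrite exchange_big /=; apply: eq_bigr => u _; rewrite -scaler_suml; congr (_ *: _).
  rewrite -sum_subset_exp (sum_by_component ord0); last exact: inversion_graph_card2.
  apply: eq_bigr => S S0; congr (_ * _).
    have r0 : @enum_val _ S (enum_rank_in S0 ord0) = ord0 by rewrite enum_rankK_in.
    have := sum_component_pullback (inversion_graph u) (@enum_val_inj _ S) (enum_rank_in S0 ord0) z.
    by rewrite r0 imset_enum_val pullback_inversion.
  rewrite sum_subset_exp; congr (_ ^+ _).
  have := card_induced_pullback (inversion_graph u) (@enum_val_inj _ (~: S)).
  by rewrite imset_enum_val pullback_inversion.
apply: eq_bigr => S _.
exact: (sum_words_split (fun u : #|S|.-tuple 'I_N =>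
  \sum_(B : {set {set 'I_#|S|}} | (B \subset inversion_graph u) && connected_graph B) z ^+ #|B|)
  (fun u : #|~: S|.-tuple 'I_N => (1 + z) ^+ #|inversion_graph u|)).
Qed.

Lemma sum_sets_ord0 n (h : nat -> A) :
  \sum_(S : {set 'I_n.+1} | ord0 \in S) h #|S| = \sum_(k < n.+1) h k.+1 *+ 'C(n, k).
Proof.
pose D := ~: [set ord0 : 'I_n.+1].
have cD : #|D| = n by rewrite cardsC1 card_ord.
rewrite (reindex_onto (fun S : {set 'I_n.+1} => ord0 |: S) (fun S => S :\ ord0)) /=; last first.
  by move=> S S0; exact: setD1K.
rewrite (eq_big (fun S : {set 'I_n.+1} => S \subset D) (fun S => h #|S|.+1)) /=; last first.
- move=> S /andP[_ /eqP ES]; rewrite cardsU1 -{1}ES !inE eqxx /=.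
  by [].
- move=> S; rewrite !inE eqxx /= subsetC sub1set inE; apply/eqP/idP => [<-|S0]; first by rewrite !inE eqxx.
  exact: setU1K.
rewrite (partition_big (fun S : {set 'I_n.+1} => inord #|S| : 'I_n.+1) xpredT) //=.
apply: eq_bigr => k _.
have lt (S : {set 'I_n.+1}) : S \subset D -> (#|S| < n.+1)%N by move=> /subset_leq_card; rewrite cD.
rewrite (eq_big (fun S : {set 'I_n.+1} => S \in [set S : {set 'I_n.+1} | (S \subset D) && (#|S| == k)]) (fun=> h k.+1)) /=.
- by rewrite sumr_const cards_draws cD.
- move=> S; rewrite inE; case: (boolP (S \subset D)) => //= SD.
  by rewrite -val_eqE /= inordK // lt.
- by move=> S /andP[SD /eqP <-]; rewrite inordK // lt.
Qed.

End WordDecomposition.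

(** * Comparison of the two recursions *)

Lemma inv_words_binomial (F : fieldType) (N : nat) (z : F) (y : 'I_N -> {mpoly F[N]}) n :
  inv_words (1 + z) n.+1 y =
    \sum_(k < n.+1) (connected_words z y k.+1 * inv_words (1 + z) (n - k) y) *+ 'C(n, k).
Proof.
rewrite inv_words_component.
rewrite (eq_bigr (fun S : {set 'I_n.+1} => connected_words z y #|S| * inv_words (1 + z) (n.+1 - #|S|) y)).
  have := sum_sets_ord0 n (fun k => connected_words z y k * inv_words (1 + z) (n.+1 - k) y).
  by move=> /= ->.
move=> S _; have -> : #|~: S| = (n.+1 - #|S|)%N by rewrite -{1}(addKn #|S| #|~: S|) cardsC card_ord.
by [].
Qed.

Lemma connected_words_tutte (F : fieldType) (N : nat) (q : F) (y : 'I_N -> {mpoly F[N]}) n :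
  connected_words (q - 1) y n.+1 =
    (q - 1) ^+ n *: \sum_(u : n.+1.-tuple 'I_N) R_word q u *: \prod_(i < n.+1) y (tnth u i).
Proof.
have [le_total le_anti le_trans] := lex_edge_total_order n.+1.
rewrite /connected_words scaler_sumr; apply: eq_bigr => u _; rewrite scalerA; congr (_ *: _).
rewrite (sum_connected_subgraphs le_total le_anti le_trans ord0); last exact: inversion_graph_card2.
by rewrite card_ord /R_word [1 + _]addrC subrK.
Qed.

(** As f 0 = 1, the last term of the k-th sum is [a k] or [c k] itself, so the relations determine
    the sequence recursively. *)
Lemma binomial_convolution_inj (R : nzRingType) (a c f : nat -> R) : f 0 = 1 ->
    (forall k, \sum_(j < k.+1) (a j * f (k - j)%N) *+ 'C(k, j) = \sum_(j < k.+1) (c j * f (k - j)%N) *+ 'C(k, j)) ->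
  forall k, a k = c k.
Proof.
move=> f0 E k; have [m] := ubnP k; elim: m k => // m IH k lt; have := E k.
rewrite !big_ord_recr /= subnn f0 binn !mulr1n !mulr1.
rewrite (eq_bigr (fun j : 'I_k => (c j * f (k - j)%N) *+ 'C(k, j))); first exact: addrI.
by move=> j _; rewrite IH // (leq_trans (ltn_ord j)).
Qed.

Theorem theorem4p3 (n : nat) (hn : (0 < n)%N) :
  symfun_at_t1
    (Theta q_Qqt t_Qqt (elementary_prod Qqt (nseq n.-1 1%N)) (elementary Qqt 1))
    (fun N => \sum_(u : n.-tuple 'I_N)
                R_word q_Qq u *: \prod_(i < n) 'X_(tnth u i)).
Proof.
case: n hn => // n _; rewrite succnK.
have q1 k : (0 < k)%N -> 1 - q_Qq ^+ k != 0.
  move=> k0; rewrite subr_eq0 -tofracXn -(tofrac1 {poly rat}) tofrac_eq eq_sym.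
  by apply/eqP => /(congr1 (horner^~ 0)); rewrite hornerXn expr0n hornerC gtn_eqF // => /eqP; rewrite eq_sym oner_eq0.
have [theta [tD tZ tM tp]] := derivation_exists char0_Qq
  (fun k => (k%:R * \sum_(i < k) q_Qq ^+ i) *: hexp (bD Qq) k.+1).
suff E N : at_vars N (iter n theta (power_sum Qq 1)) =
    \sum_(u : n.+1.-tuple 'I_N) R_word q_Qq u *: \prod_(i < n.+1) 'X_(tnth u i).
  by move=> N m; rewrite -E; exact: (@Theta_at1 n theta tD tZ tM tp N m).
pose b k := (1 - q_Qq ^+ k)^-1; pose X (i : 'I_N) : {mpoly Qq[N]} := 'X_i.
pose W k : symfun Qq := qfact q_Qq k *: hexp b k.
pose ev (f : symfun Qq) : {mpoly Qq[N]} := at_vars N f.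
have WE k : ev (W k) = inv_words q_Qq k X.
  rewrite /ev linearZ /=; apply: (inv_words_series char0_Qq q1 k (s := smap (at_vars N) (hexp b))).
  have := newton_smap (at_vars N) (newton_hexp char0_Qq b); congr newton; apply: series_ext => -[|j].
    by rewrite /smap /pseries power_sum0 scaler0 rmorph0.
  by rewrite -[LHS]/(b j.+1 *: at_vars N (power_sum Qq j.+1)) at_vars_power_sum.
pose T k : symfun Qq := (q_Qq - 1) ^+ k *: iter k theta (power_sum Qq 1).
(* Both sides solve the same binomial recursion against [inv_words]: one through theta, the other
   through components of the first vertex. *)
have TE k : ev (T k) = connected_words (q_Qq - 1) X k.+1.
  apply: (@binomial_convolution_inj _ (fun k => ev (T k)) (fun k => connected_words (q_Qq - 1) X k.+1)
    (fun k => inv_words q_Qq k X)) => [|{}k]; first exact: inv_words0.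
  have := inv_words_binomial (q_Qq - 1) X k; rewrite [1 + _]addrC subrK => <-.
  rewrite -WE [W _](qexp_binomial char0_Qq q1 tD tZ tM tp) /ev (raddf_sum (at_vars N)).
  by apply: eq_bigr => j _; rewrite (raddfMn (at_vars N)) -WE.
(* The factor (q - 1)^n comes on one side from T n, on the other from the n edges of a spanning tree
   on n + 1 vertices; it cancels. *)
have qn0 : (q_Qq - 1) ^+ n != 0 by rewrite expf_neq0 // -opprB oppr_eq0 -[q_Qq]expr1 q1.
have := TE n; rewrite /ev /T linearZ /= connected_words_tutte => /(congr1 (fun f => ((q_Qq - 1) ^+ n)^-1 *: f)).
by rewrite !scalerA mulVf // !scale1r.
Qed.
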